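(* Fix $\alpha>0$, $T>0$, $\beta\in[0,\infty]$ and a piecewise continuous $\rho_0:\mathbb T\to[0,1]$. Let $\{\mu_n\}_{n\in\mathbb N}$ be a sequence of probability measures on $\Omega=\{0,1\}^{\mathbb T_n}$ associated to $\rho_0$. Then, for any $t\in[0,T]$, every $\delta>0$ and every $H\in C(\mathbb T)$, $$\lim_{n\to\infty}\mathbb P^{\alpha,\beta}_{\mu_n}\Big[\eta_\cdot:\ \Big|\frac1n\sum_{x\in\mathbb T_n}H\big(\tfrac xn\big)\eta_t(x)-\int_{\mathbb T}H(u)\rho(t,u)\,du\Big|>\delta\Big]=0,$$ where, with initial condition $\rho_0$: if $\beta\in[0,1)$, $\rho$ is the unique weak solution of the heat equation with periodic boundary conditions; if $\beta=1$, $\rho$ is the unique weak solution of the heat equation with Robin's boundary conditions with parameter $\alpha$; if $\beta\in(1,\infty]$, $\rho$ is the unique weak solution of the heat equation with Neumann's boundary conditions.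
   Context: Particle system. $\mathbb T_n=\mathbb Z/n\mathbb Z$, $\Omega=\{0,1\}^{\mathbb T_n}$. The symmetric exclusion process with a slow bond is the Markov process on $\Omega$ with generator $\mathcal L_nf(\eta)=\sum_{x\in\mathbb T_n}\xi^n_{x,x+1}[f(\eta^{x,x+1})-f(\eta)]$, where $\xi^n_{x,x+1}=\alpha n^{-\beta}$ if $x=-1$ and $\xi^n_{x,x+1}=1$ otherwise (with $n^{-\infty}=0$), and $\eta^{x,x+1}$ is obtained from $\eta$ by exchanging $\eta(x)$ and $\eta(x+1)$. Below $\{\eta_t\}_{t\ge0}$ denotes this process speeded up by $n^2$, i.e. with generator $n^2\mathcal L_n$. $\mathbb P^{\alpha,\beta}_{\mu_n}$ is the law on càdlàg trajectories $\mathcal D(\mathbb R_+,\Omega)$ of $\{\eta_t\}$ started from $\mu_n$. $\{\mu_n\}$ is associated to $\rho_0:\mathbb T\to[0,1]$ if for every $\delta>0$ and $H\in C(\mathbb T)$, $\lim_{n\to\infty}\mu_n\big[\eta:|\frac1n\sum_{x\in\mathbb T_n}H(\frac xn)\eta(x)-\int_{\mathbb T}H(u)\rho_0(u)du|>\delta\big]=0$. PDE notation. $\mathbb T=\mathbb R/\mathbb Z$ is the continuous torus; functions on $\mathbb T$ and on $[0,1]$ are identified Lebesgue almost everywhere. A subindex $t$ denotes the time variable. $\langle\cdot,\cdot\rangle$ is the inner product of $L^2[0,1]$ (or $L^2(\mathbb T)$). $\Delta=\partial_u^2$. $C^{n,m}(A\times B)$ is the space of real functions on $A\times B$ of class $C^n$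 in the first variable and $C^m$ in the second (with the corresponding derivatives continuous). $\mathcal H^1$ is the set of locally summable $\zeta:[0,1]\to\mathbb R$ having a weak derivative $\partial_u\zeta\in L^2[0,1]$ (i.e. $\langle\partial_uG,\zeta\rangle=-\langle G,\partial_u\zeta\rangle$ for all $G\in C^\infty(0,1)$ with compact support), with norm $(\|\zeta\|_{L^2[0,1]}^2+\|\partial_u\zeta\|_{L^2[0,1]}^2)^{1/2}$. $L^2(0,T;\mathcal H^1)$ is the space of measurable $\xi:[0,T]\to\mathcal H^1$ with $\int_0^T\|\xi_t\|_{\mathcal H^1}^2dt<\infty$ (as usual, $\xi_t\in\mathcal H^1$ for almost every $t$); boundary values are those of the continuous representative. Weak solutions (with $\rho_0$ the given initial condition and $\rho_t\in L^2$ for every $t$): Periodic ($\partial_t\rho=\Delta\rho$ on $\mathbb T$): $\rho$ is measurable and for all $t\in[0,T]$, $H\in C^{1,2}([0,T]\times\mathbb T)$, $\langle\rho_t,H_t\rangle-\langle\rho_0,H_0\rangle-\int_0^t\langle\rho_s,\partial_sH_s+\Delta H_s\rangle ds=0$. Robin ($\partial_t\rho=\Delta\rho$ on $(0,1)$, $\partial_u\rho(t,0)=\partial_u\rho(t,1)=\alpha(\rho(t,0)-\rho(t,1))$): $\rho\in L^2(0,T;\mathcal H^1)$ and for all $t\in[0,T]$, $H\in C^{1,2}([0,T]\times[0,1])$, $$\langle\rho_t,H_t\rangle-\langle\rho_0,H_0\rangle-\int_0^t\langle\rho_s,\partial_sH_s+\Delta H_s\rangle ds-\int_0^t(\rho_s(0)\partial_uH_s(0)-\rho_s(1)\partial_uH_s(1))ds+\int_0^t\alpha(\rho_s(0)-\rho_s(1))(H_s(0)-H_s(1))ds=0.$$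 Neumann ($\partial_t\rho=\Delta\rho$ on $(0,1)$, $\partial_u\rho(t,0)=\partial_u\rho(t,1)=0$): $\rho\in L^2(0,T;\mathcal H^1)$ and the same identity as in the Robin case holds without the last (the $\alpha$) term, for all $t\in[0,T]$, $H\in C^{1,2}([0,T]\times[0,1])$. *)

(* Defs.v *)
From HB Require Import structures.
From mathcomp Require Import all_boot all_order all_fingroup all_algebra.
From mathcomp Require Import all_classical all_reals all_analysis.
Set Implicit Arguments.
Unset Strict Implicit.
Unset Printing Implicit Defensive.
Import Order.TTheory GRing.Theory Num.Theory.
Import numFieldNormedType.Exports.
Local Open Scope classical_set_scope.
Local Open Scope ring_scope.

(* The discrete torus Z/nZ is 'I_n, with cyclic successor ordS.  A function on
   the continuous torus R/Z is a 1-periodic function on R, and integrals over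
   R/Z are integrals over [0, 1]. *)

Definition config (n : nat) := {ffun 'I_n -> bool}.
HB.instance Definition _ n := Finite.on (config n).
HB.instance Definition _ n :=
  isPointed.Build (config n) [ffun=> false].
HB.instance Definition _ n := @isMeasurable.Build default_measure_display
  (config n) discrete_measurable discrete_measurable0
  discrete_measurableC discrete_measurableU.

Section particles.
Context {R : realType}.
Implicit Types (alpha t : R) (beta : \bar R).

Definition exchange n (x : 'I_n) (eta : config n) : config n :=
  [ffun z => eta (tperm x (ordS x) z)].

(* The slow bond {-1, 0} is the one whose left end x satisfies x + 1 = n.
   The last branch is the convention n^{-oo} = 0. *)
Definition rate alpha beta n (x : 'I_n) : R :=
  if x.+1 == n then
    if beta is b%:E then alpha * n%:R `^ (- b) else 0
  else 1.

Definition exclusion_gen alpha beta n (f : config n -> R) (eta : config n) : R :=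
  \sum_(x < n) rate alpha beta x * (f (exchange x eta) - f eta).

Definition speeded_gen alpha beta n (f : config n -> R) (eta : config n) : R :=
  n%:R ^+ 2 * exclusion_gen alpha beta f eta.

(* The semigroup exp(t L) applied to f, evaluated at eta. *)
Definition semigroup n (L : (config n -> R) -> config n -> R) t
    (f : config n -> R) (eta : config n) : R :=
  limn (series (fun k => t ^+ k / k`!%:R * iter k L f eta)).

Definition transition n (L : (config n -> R) -> config n -> R) t
    (eta zeta : config n) : R :=
  semigroup L t (fun xi => (xi == zeta)%:R) eta.

(* X, restricted to times t >= 0, is a cadlag Markov process with generator L
   and initial law mu.  Limits in the finite discrete space config n are
   eventual equalities.  The Markov property at time s conditions on the values
   of X at s and at any finite list of earlier times. *)
Definition markov_process n (L : (config n -> R) -> config n -> R)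
    (mu : probability (config n) R) d (W : measurableType d)
    (P : probability W R) (X : R -> {RV P >-> config n}) : Prop :=
  [/\ forall w t, 0 <= t -> \forall s \near t^'+, X s w = X t w,
      forall w t, 0 < t -> exists zeta, \forall s \near t^'-, X s w = zeta,
      forall A, distribution P (X 0) A = mu A
    & forall (past : seq (R * config n)) (s t : R) (zeta xi : config n),
        (forall p : R * config n, p \in past -> 0 <= p.1 <= s) -> 0 <= s -> 0 <= t ->
        P [set w | [/\ forall p : R * config n, p \in past -> X p.1 w = p.2,
                       X s w = zeta & X (s + t) w = xi]] =
        (P [set w | (forall p : R * config n, p \in past -> X p.1 w = p.2) /\ X s w = zeta]
          * (transition L t zeta xi)%:E)%E].

End particles.

Section functions.
Context {R : realType}.
Implicit Types (alpha T : R) (beta : \bar R) (f g : R -> R).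
Local Notation leb := (@lebesgue_measure R).

Definition periodic1 f := forall u, f (u + 1) = f u.

Definition torus_continuous f := periodic1 f /\ continuous f.

Definition torus_piecewise_continuous f :=
  [/\ periodic1 f,
      exists D : seq R,
        forall u : R, u \in `[0, 1] -> u \notin D -> {for u, continuous f}
    & forall u, cvg (f @ u^'-) /\ cvg (f @ u^'+)].

Definition empirical n (H : R -> R) (eta : config n) : R :=
  n%:R^-1 * \sum_(x < n) H (x%:R / n%:R) * (eta x)%:R.

Definition dot f g : R := (\int[leb]_(u in `[0, 1]) (f u * g u))%R.

Definition associated (mu : forall n, probability (config n) R) (rho0 : R -> R) :=
  forall (delta : R) (H : R -> R), 0 < delta -> torus_continuous H ->
    mu n [set eta | delta < `|empirical H eta - dot H rho0|] @[n --> \oo]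
      --> 0%E.

Definition L2 f := measurable_fun (`[0, 1] : set R) f /\
  (\int[leb]_(u in `[0%R, 1%R]) ((f u) ^+ 2)%:E < +oo)%E.

(* Smooth functions with compact support in ]0, 1[, extended by 0 to R. *)
Definition test_function f :=
  (forall (k : nat) (u : R), derivable (f^`(k))%classic u 1) /\
  exists a b : R, [/\ 0 < a, b < 1 & forall u : R, u \notin `[a, b] -> f u = 0].

Definition is_weak_derivative f g :=
  L2 g /\ forall G, test_function G -> dot (G^`())%classic f = - dot G g.

Definition H1 f :=
  locally_integrable `]0, 1[ f /\ exists g, is_weak_derivative f g.

(* Unique up to almost everywhere equality. *)
Definition weak_derivative f : R -> R :=
  xget (fun=> 0) [set g | is_weak_derivative f g].

Definition H1norm f : R :=
  Num.sqrt (dot f f + dot (weak_derivative f) (weak_derivative f)).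

Definition H1open (U : set (R -> R)) :=
  forall f, H1 f -> U f ->
    exists2 r : R, 0 < r & forall g, H1 g -> H1norm (g - f) < r -> U g.

(* Lebesgue measurability of xi : [0, T] -> H1 is Borel measurability outside
   a null set, which also absorbs the times at which xi is not in H1. *)
Definition L2_H1 T (xi : R -> R -> R) :=
  exists A : set R,
    [/\ measurable A, A `<=` `[0, T], leb (`[0, T] `\` A) = 0%E,
        forall t, A t -> H1 (xi t)
      & (forall U, H1open U -> measurable (A `&` [set t | U (xi t)])) /\
        (\int[leb]_(t in A) ((H1norm (xi t)) ^+ 2)%:E < +oo)%E].

Definition continuous_representative f : R -> R :=
  xget (fun=> 0) [set c : R -> R | {within `[0, 1], continuous c} /\
                          f = c %[ae leb in `[0%R, 1%R]%classic]].

Definition trace f (a : R) : R := continuous_representative f a.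

(* The derivative is one-sided at the points of A that are endpoints. *)
Definition derivative_on (A : set R) f g :=
  forall x, A x -> (f y - f x) / (y - x) @[y --> within A x^'] --> g x.

(* H is of class C^{1,2} on [0, T] x S, with time derivative Ht and first and
   second space derivatives Hu and Huu. *)
Definition is_C12 T (S : set R) (H Ht Hu Huu : R -> R -> R) :=
  [/\ forall u, S u -> derivative_on `[0, T] (H ^~ u) (Ht ^~ u),
      forall t : R, t \in `[0, T] -> derivative_on S (H t) (Hu t),
      forall t : R, t \in `[0, T] -> derivative_on S (Hu t) (Huu t)
    & forall F, [\/ F = H, F = Ht, F = Hu | F = Huu] ->
        {within `[0, T] `*` S, continuous (fun p : R * R => F p.1 p.2)}].

(* In the three weak formulations the time integrals are taken in the extended
   reals, so that the identities force them to be finite: the library's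
   real-valued integral is 0 when the integral is infinite or undefined. *)

Definition periodic_solution T (rho0 : R -> R) (rho : R -> R -> R) :=
  [/\ measurable_fun (`[0, T] `*` `[0, 1] : set (R * R)) (fun p : R * R => rho p.1 p.2),
      forall t : R, t \in `[0, T] -> L2 (rho t)
    & forall (t : R) H Ht Hu Huu, t \in `[0, T] ->
        is_C12 T [set: R] H Ht Hu Huu ->
        (forall s : R, s \in `[0, T] -> periodic1 (H s)) ->
        ((dot (rho t) (H t) - dot rho0 (H 0))%:E
         - \int[leb]_(s in `[0%R, t]) (dot (rho s) (Ht s + Huu s))%:E = 0)%E].

Definition robin_solution alpha T (rho0 : R -> R) (rho : R -> R -> R) :=
  [/\ L2_H1 T rho,
      forall t : R, t \in `[0, T] -> L2 (rho t)
    & forall (t : R) H Ht Hu Huu, t \in `[0, T] ->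
        is_C12 T `[0, 1] H Ht Hu Huu ->
        ((dot (rho t) (H t) - dot rho0 (H 0))%:E
         - \int[leb]_(s in `[0%R, t]) (dot (rho s) (Ht s + Huu s))%:E
         - \int[leb]_(s in `[0%R, t])
             (trace (rho s) 0 * Hu s 0 - trace (rho s) 1 * Hu s 1)%:E
         + \int[leb]_(s in `[0%R, t])
             (alpha * (trace (rho s) 0 - trace (rho s) 1)
                    * (H s 0 - H s 1))%:E = 0)%E].

Definition neumann_solution T (rho0 : R -> R) (rho : R -> R -> R) :=
  [/\ L2_H1 T rho,
      forall t : R, t \in `[0, T] -> L2 (rho t)
    & forall (t : R) H Ht Hu Huu, t \in `[0, T] ->
        is_C12 T `[0, 1] H Ht Hu Huu ->
        ((dot (rho t) (H t) - dot rho0 (H 0))%:E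
         - \int[leb]_(s in `[0%R, t]) (dot (rho s) (Ht s + Huu s))%:E
         - \int[leb]_(s in `[0%R, t])
             (trace (rho s) 0 * Hu s 0 - trace (rho s) 1 * Hu s 1)%:E = 0)%E].

Definition hydrodynamic_solution alpha beta T (rho0 : R -> R) :
    (R -> R -> R) -> Prop :=
  if (beta < 1)%E then periodic_solution T rho0
  else if beta == 1%E then robin_solution alpha T rho0
  else neumann_solution T rho0.

(* rho is the only solution, functions of u being identified almost
   everywhere on [0, 1] at each time. *)
Definition unique_solution T (sol : (R -> R -> R) -> Prop) (rho : R -> R -> R) :=
  sol rho /\
  forall rho', sol rho' -> forall t : R, t \in `[0, T] ->
    rho' t = rho t %[ae leb in `[0%R, 1%R]%classic].

End functions.

(* Main.v *)
(* Let e_k be the eigenfunctions, e_k'' = - nu_k e_k, of the Laplacian with the boundary conditions of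
   the regime; they are complete because the Green operator of w - w'' is positive and compact.
   Testing a weak solution with exp(nu_k s) e_k gives <rho_t, e_k> = exp(- nu_k t) <rho_0, e_k>, whence
   uniqueness, and the series with these coefficients is a weak solution.  On the discrete torus, a
   perturbation h of e_k makes the weighted occupation F = (1/n) sum_x h(x) eta(x) satisfy
   n^2 L F = - nu_k F + o(1) and n^2 (L F^2 - 2 F L F) = o(1), in all three regimes: the size of the
   perturbation is the discrete defect of the boundary condition, e_k'(0) + n r (e_k(1) - e_k(0)) over
   1 + n r with r the rate of the slow bond.  Hence F(eta_t) - exp(- nu_k t) F(eta_0) tends to 0 in L2
   of the trajectories, and no tightness or replacement lemma is needed.  Since eta <= 1, general
   test functions follow by approximating them in L2 by combinations of the e_k. *)
Require Import Defs.
From HB Require Import structures.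
From mathcomp Require Import all_boot all_order all_fingroup all_algebra.
From mathcomp Require Import all_classical all_reals all_analysis.
From mathcomp Require Import measurable_realfun.
From mathcomp Require Import ring lra.
Set Implicit Arguments.
Unset Strict Implicit.
Unset Printing Implicit Defensive.
Import Order.TTheory GRing.Theory Num.Theory.
Import numFieldNormedType.Exports.
Local Open Scope classical_set_scope.
Local Open Scope ring_scope.

(** * Integration on the unit interval *)

(** The particle side closes because [speeded_gen] maps weighted occupations to weighted
    occupations: only a linear problem for the weights is left. A sampled eigenfunction leaves a
    flux mismatch at the slow bond that need not vanish; adding a linear function of suitable slope
    makes the flux through every bond equal to the sampled derivative plus one constant, and a
    constant disappears under summation by parts on the ring. A single boundary condition with
    parameters [gam] and [a] covers the three regimes, so the spectral theory, the series and the
    convergence are each treated once. Completeness is uniform too: smooth functions that vanish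
    near 0 and 1 meet every such condition, hence lie in the range of every Green operator, and they
    are dense in L2. On the PDE side the difficulty sits at time 0. The initial datum is only known
    in L2, the series converges uniformly for positive times only, and yet the boundary terms of the
    weak formulation are integrated from 0. A majorant of the squared H1 norm that is integrable in
    time removes the difficulty. *)

Section calculus.
Context {R : realType}.
Implicit Types (f g h F G : R -> R).
Local Notation leb := (@lebesgue_measure R).
Local Notation I01 := (`[0%R, 1%R]%classic : set R).

Definition integ01 f := leb.-integrable I01 (EFin \o f).
Definition cont01 f := {within I01, continuous f}.
(** The derivatives are two-sided even at 0 and 1, so the usual derivation rules apply without
    one-sided variants; the price is paid in [cont01_primitive]. *)
Definition deriv01 F f := forall x : R, 0 <= x <= 1 -> is_derive x 1 F (f x).

Lemma measurable_I01 : measurable (I01 : set (measurableTypeR R)).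
Proof. exact: measurable_itv. Qed.

Lemma leb_I01 : leb I01 = 1%E.
Proof. by rewrite lebesgue_measure_itv/= lte_fin ltr01 oppr0 adde0. Qed.

Lemma in01 (x : R) : I01 x = (0 <= x <= 1) :> Prop.
Proof. by rewrite /= in_itv. Qed.

Lemma cont01_integ f : cont01 f -> integ01 f.
Proof. by move=> cf; apply: continuous_compact_integrable => //; exact: segment_compact. Qed.

Lemma cont01_measurable f : cont01 f -> measurable_fun I01 f.
Proof. by move=> cf; apply/measurable_EFinP; apply: (measurable_int leb); exact: cont01_integ. Qed.

Lemma cont01_bounded f : cont01 f -> exists2 M, 0 < M & forall x, 0 <= x <= 1 -> `|f x| <= M.
Proof.
move=> cf; have cn : {within I01, continuous (fun x => `|f x|)}.
  by move=> x; apply: cvg_norm; exact: cf.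
have [c _ hc] := EVT_max (@ler01 R) cn.
exists (`|f c| + 1); first by rewrite ltr_wpDl.
by move=> x x01; rewrite (le_trans (hc x _)) ?in_itv// lerDl.
Qed.

Lemma continuous_cont01 f : continuous f -> cont01 f.
Proof. exact: continuous_subspaceT. Qed.

Lemma deriv01_cont F f : deriv01 F f -> cont01 F.
Proof.
move=> dF; apply/continuous_in_subspaceT => x; rewrite inE in01 => x01.
by have [dx _] := dF x x01; exact/differentiable_continuous/derivable1_diffP.
Qed.

Lemma deriv01_LR F f a b : 0 <= a -> a < b -> b <= 1 -> deriv01 F f ->
  derivable_oo_LRcontinuous F a b.
Proof.
move=> a0 ab b1 dF.
have cF x : 0 <= x <= 1 -> {for x, continuous F}.
  by move=> x01; have [dx _] := dF x x01; exact/differentiable_continuous/derivable1_diffP.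
split.
- move=> x; rewrite in_itv/= => /andP[ax xb].
  have x01 : 0 <= x <= 1 by rewrite (le_trans a0 (ltW ax)) (le_trans (ltW xb) b1).
  by have [] := dF x x01.
- by apply: cvg_at_right_filter; apply: cF; rewrite a0 (le_trans (ltW ab)).
- by apply: cvg_at_left_filter; apply: cF; rewrite b1 (le_trans a0 (ltW ab)).
Qed.

Lemma cont01_sub f a b : 0 <= a -> b <= 1 -> cont01 f -> {within `[a, b], continuous f}.
Proof.
move=> a0 b1; apply: continuous_subspaceW => x /=; rewrite !in_itv/= => /andP[ax xb].
by rewrite (le_trans a0 ax) (le_trans xb b1).
Qed.

Lemma FTC01 F f a b : 0 <= a -> a < b -> b <= 1 -> deriv01 F f -> cont01 f ->
  (\int[leb]_(x in `[a, b]) f x)%R = F b - F a.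
Proof.
move=> a0 ab b1 dF cf; rewrite /Rintegral (@continuous_FTC2 _ f F a b)//.
- exact: cont01_sub.
- exact: deriv01_LR dF.
- move=> x; rewrite in_itv/= => /andP[ax xb].
  have x01 : 0 <= x <= 1 by rewrite (le_trans a0 (ltW ax)) (le_trans (ltW xb) b1).
  by have d := dF x x01; rewrite derive1E derive_val.
Qed.

(** Retraction of the line onto [0, 1]: composing with it turns continuity within [0, 1] into
    continuity on the line. *)
Definition clamp01 (x : R) : R := Num.max 0 (Num.min x 1).

Lemma clamp01_in x : 0 <= clamp01 x <= 1.
Proof. by rewrite /clamp01 le_max lexx/= ge_max ler01/= ge_min lexx orbT. Qed.

Lemma clamp01_id x : 0 <= x <= 1 -> clamp01 x = x.
Proof. by move=> /andP[x0 x1]; rewrite /clamp01 min_l// max_r. Qed.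

Lemma clamp01_continuous : continuous clamp01.
Proof.
move=> x; apply: (@continuous_max R R (cst 0) ((@id R) \min (cst 1)) x).
  exact: cst_continuous.
by apply: (@continuous_min R R (@id R) (cst 1)) => //; exact: cst_continuous.
Qed.

Lemma cont01_clamp f : cont01 f -> continuous (f \o clamp01).
Proof.
move=> cf x; apply: (@cvg_comp _ _ _ clamp01 f _ (within I01 (nbhs (clamp01 x)))).
  move=> A hA; have hA' : nbhs (clamp01 x) [set y | I01 y -> A y] := hA.
  have h2 : nbhs x (clamp01 @^-1` [set y | I01 y -> A y]) := @clamp01_continuous x _ hA'.
  change (nbhs x (clamp01 @^-1` A)).
  by apply: filterS h2 => y /=; apply; rewrite in_itv/=; exact: clamp01_in.
have /(_ (clamp01 x)) := cf.
have c01 : I01 (clamp01 x) by rewrite in01; exact: clamp01_in.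
rewrite /continuous_at /from_subspace /= /prop_for (nbhs_subspace_in c01).
exact.
Qed.

Lemma cont01_primitive f : cont01 f -> exists F, F 0 = 0 /\ deriv01 F f.
Proof.
move=> cf; pose g := f \o clamp01; have cg := cont01_clamp cf.
(* The clamped function is integrated from -1 and the theorem is applied on [-1, 2], so that 0 and 1
   are interior points and the derivative there is two-sided. *)
pose G x := (\int[leb]_(t in `[-1%R, x]) g t)%R.
have dG (x : R) : 0 <= x <= 1 -> is_derive x 1 G (f x).
  move=> x01; have [x0 x1] := andP x01.
  have [|||dg dgE] := @continuous_FTC1_closed R g (-1) x 2 _ _ _ (cg x).
  - by lra.
  - apply: continuous_compact_integrable; first exact: segment_compact.
    exact: continuous_subspaceT.
  - by lra.
  apply: DeriveDef => //; rewrite -derive1E dgE /g /=.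
  by rewrite clamp01_id.
exists (fun x => G x - G 0); split; first by rewrite subrr.
by move=> x x01; have := dG _ x01 => d; rewrite -[f x]subr0; apply: is_deriveB.
Qed.

Lemma integ01P f : integ01 f <->
  measurable_fun I01 f /\ (\int[leb]_(x in I01) (`|f x|)%:E < +oo)%E.
Proof.
split=> [/integrableP[mf fi]|[mf fi]]; first by split => //; exact/measurable_EFinP.
by apply/integrableP; split => //; exact/measurable_EFinP.
Qed.

Lemma integ01D f g : integ01 f -> integ01 g -> integ01 (fun u => f u + g u).
Proof. by move=> fi gi; have := integrableD measurable_I01 fi gi. Qed.

Lemma integ01Z (c : R) f : integ01 f -> integ01 (fun u => c * f u).
Proof. by move=> fi; have := integrableZl measurable_I01 c fi. Qed.

Lemma eq_eint01 f g : (forall x, 0 <= x <= 1 -> f x = g x) ->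
  (\int[leb]_(x in I01) (f x)%:E = \int[leb]_(x in I01) (g x)%:E)%E.
Proof. by move=> fg; apply: eq_integral => x; rewrite inE in01 => /fg ->. Qed.

Lemma integ01_abs f : integ01 f -> integ01 (fun x => `|f x|).
Proof. exact: integrable_norm. Qed.

Lemma Rint01_ge0 f : (forall x, 0 <= x <= 1 -> 0 <= f x) -> 0 <= (\int[leb]_(x in I01) f x)%R.
Proof. by move=> f0; apply: Rintegral_ge0 => x; rewrite in01; exact: f0. Qed.

Lemma eq_Rint01 f g : (forall x, 0 <= x <= 1 -> f x = g x) ->
  (\int[leb]_(x in I01) f x)%R = (\int[leb]_(x in I01) g x)%R.
Proof. by move=> fg; apply: eq_Rintegral => x; rewrite inE in01; exact: fg. Qed.

Lemma le_Rint01 f g : integ01 f -> integ01 g -> (forall x, 0 <= x <= 1 -> f x <= g x) ->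
  (\int[leb]_(x in I01) f x)%R <= (\int[leb]_(x in I01) g x)%R.
Proof. by move=> fi gi fg; apply: le_Rintegral => // x; rewrite in01; exact: fg. Qed.

Lemma Rint01_cst (c : R) : (\int[leb]_(x in I01) c)%R = c.
Proof. by rewrite Rintegral_cst //= leb_I01 mulr1. Qed.

Lemma bounded_integ01 f (M : R) : measurable_fun I01 f -> (forall x, 0 <= x <= 1 -> `|f x| <= M) ->
  integ01 f.
Proof.
move=> mf fM.
apply: measurable_bounded_integrable => //;
  first by rewrite /= lebesgue_measure_itv/= lte_fin ltr01 oppr0 adde0 ltry.
exists M; split; first exact: num_real.
by move=> N MN x; rewrite in01 => x01; exact: le_trans (fM x x01) (ltW MN).
Qed.

Lemma Rint01_le_sup f (M : R) : measurable_fun I01 f -> (forall x, 0 <= x <= 1 -> `|f x| <= M) ->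
  `|(\int[leb]_(x in I01) f x)%R| <= M.
Proof.
move=> mf fM.
have fi := bounded_integ01 mf fM.
have ci : integ01 (cst M) by apply: cont01_integ; apply: continuous_cont01; exact: cst_continuous.
rewrite (le_trans (le_normr_Rintegral _ fi))// -[leRHS]Rint01_cst.
by apply: le_Rint01 => //; exact: integ01_abs.
Qed.


Lemma L2_sq f : L2 f -> integ01 (fun u => f u ^+ 2).
Proof.
move=> [mf fi]; apply/integ01P; split; first exact: measurable_funX.
by under eq_eint01 => u _ do rewrite ger0_norm ?sqr_ge0//.
Qed.

Lemma L2_mul f g : L2 f -> L2 g -> integ01 (fun u => f u * g u).
Proof.
move=> Lf Lg; have [mf _] := Lf; have [mg _] := Lg.
apply: (@le_integrable _ _ _ leb _ _ _ (EFin \o (fun u => f u ^+ 2 + g u ^+ 2))) => //.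
- by apply/measurable_EFinP; exact: measurable_funM.
- move=> u _ /=; rewrite lee_fin normrM [leRHS]ger0_norm ?addr_ge0 ?sqr_ge0//.
  rewrite -(real_normK (num_real (f u))) -(real_normK (num_real (g u))).
  have := sqr_ge0 (`|f u| - `|g u|); have := normr_ge0 (f u); have := normr_ge0 (g u).
  nra.
- exact: (integ01D (L2_sq Lf) (L2_sq Lg)).
Qed.

Lemma bounded_L2 f (M : R) : measurable_fun I01 f -> (forall x, 0 <= x <= 1 -> `|f x| <= M) -> L2 f.
Proof.
move=> mf fM; split => //.
have : integ01 (fun u => f u ^+ 2).
  apply: (@bounded_integ01 _ (M ^+ 2)); first exact: measurable_funX.
  by move=> x x01; rewrite normrX ler_pXn2r ?nnegrE ?fM// (le_trans _ (fM x x01)).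
move=> /integ01P[_].
by under eq_eint01 => u _ do rewrite ger0_norm ?sqr_ge0//.
Qed.

Lemma cont01_L2 f : cont01 f -> L2 f.
Proof.
move=> cf; have [M _ fM] := cont01_bounded cf.
by apply: bounded_L2 fM; exact: cont01_measurable.
Qed.

Lemma L2D f g : L2 f -> L2 g -> L2 (fun u => f u + g u).
Proof.
move=> Lf Lg; have [mf _] := Lf; have [mg _] := Lg.
split; first exact: measurable_funD.
have : integ01 (fun u => f u ^+ 2 + f u * g u *+ 2 + g u ^+ 2).
  have fgi := L2_mul Lf Lg; have := L2_sq Lg; have := L2_sq Lf.
  move=> ffi ggi; apply: (integ01D _ ggi).
  by apply: (integ01D ffi); exact: (integ01D fgi fgi).
move=> /integ01P[_].
by under eq_eint01 => u _ do rewrite -sqrrD ger0_norm ?sqr_ge0//.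
Qed.

Lemma L2Z (c : R) f : L2 f -> L2 (fun u => c * f u).
Proof.
move=> Lf; have [mf _] := Lf; split; first exact: measurable_funM.
have /integ01P[_] := integ01Z (c ^+ 2) (L2_sq Lf).
by under eq_eint01 => u _ do rewrite -exprMn ger0_norm ?sqr_ge0//.
Qed.

Lemma L2B f g : L2 f -> L2 g -> L2 (fun u => f u - g u).
Proof.
move=> Lf Lg; rewrite (_ : (fun u => _) = (fun u => f u + (-1) * g u)).
  by apply: L2D => //; exact: L2Z.
by apply/funext => u; rewrite mulN1r.
Qed.

Lemma L2_cst (c : R) : L2 (fun=> c).
Proof. by apply: cont01_L2; apply: continuous_cont01; exact: cst_continuous. Qed.

Lemma L2_sum (I : Type) (r : seq I) (F : I -> R -> R) :
  (forall i, L2 (F i)) -> L2 (fun u => \sum_(i <- r) F i u).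
Proof.
move=> LF; elim: r => [|i r IH].
  by rewrite (_ : (fun u => _) = fun=> 0); [exact: L2_cst|apply/funext => u; rewrite big_nil].
rewrite (_ : (fun u => _) = (fun u => F i u + \sum_(j <- r) F j u)).
  exact: L2D.
by apply/funext => u; rewrite big_cons.
Qed.

Lemma eq_dot f f' g g' : (forall u, 0 <= u <= 1 -> f u = f' u) ->
  (forall u, 0 <= u <= 1 -> g u = g' u) -> dot f g = dot f' g'.
Proof. by move=> ff gg; apply: eq_Rint01 => u u01; rewrite ff// gg. Qed.

Lemma dotC f g : dot f g = dot g f.
Proof. by apply: eq_Rint01 => u _; rewrite mulrC. Qed.

Lemma dotDl f g h : L2 f -> L2 g -> L2 h ->
  dot (fun u => f u + g u) h = dot f h + dot g h.
Proof.
move=> Lf Lg Lh; rewrite /dot -(RintegralD _ (L2_mul Lf Lh) (L2_mul Lg Lh))//.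
by apply: eq_Rint01 => u _; rewrite mulrDl.
Qed.

Lemma dotZl (c : R) f h : L2 f -> L2 h -> dot (fun u => c * f u) h = c * dot f h.
Proof.
move=> Lf Lh; rewrite /dot -(RintegralZl _ _ (L2_mul Lf Lh))//.
by apply: eq_Rint01 => u _; rewrite mulrA.
Qed.

Lemma dotBl f g h : L2 f -> L2 g -> L2 h ->
  dot (fun u => f u - g u) h = dot f h - dot g h.
Proof.
move=> Lf Lg Lh; rewrite /dot -(RintegralB _ (L2_mul Lf Lh) (L2_mul Lg Lh))//.
by apply: eq_Rint01 => u _; rewrite mulrBl.
Qed.

Lemma dotDr f g h : L2 f -> L2 g -> L2 h ->
  dot h (fun u => f u + g u) = dot h f + dot h g.
Proof. by move=> *; rewrite dotC dotDl// dotC (dotC g). Qed.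

Lemma dotZr (c : R) f h : L2 f -> L2 h -> dot h (fun u => c * f u) = c * dot h f.
Proof. by move=> *; rewrite dotC dotZl// dotC. Qed.

Lemma dotBr f g h : L2 f -> L2 g -> L2 h ->
  dot h (fun u => f u - g u) = dot h f - dot h g.
Proof. by move=> *; rewrite dotC dotBl// dotC (dotC g). Qed.

Lemma dot0l h : dot (fun=> 0) h = 0.
Proof. by rewrite /dot (eq_Rint01 (g := fun=> 0)) ?Rint01_cst// => u _; rewrite mul0r. Qed.

Lemma dot_suml (I : Type) (r : seq I) (F : I -> R -> R) h :
  (forall i, L2 (F i)) -> L2 h ->
  dot (fun u => \sum_(i <- r) F i u) h = \sum_(i <- r) dot (F i) h.
Proof.
move=> LF Lh; elim: r => [|i r IH].
  rewrite big_nil -[RHS](dot0l h); by congr dot; apply/funext => u; rewrite big_nil.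
rewrite big_cons -IH -dotDl//; last exact: L2_sum.
by congr dot; apply/funext => u; rewrite big_cons.
Qed.

Lemma dot_sumr (I : Type) (r : seq I) (F : I -> R -> R) h :
  (forall i, L2 (F i)) -> L2 h ->
  dot h (fun u => \sum_(i <- r) F i u) = \sum_(i <- r) dot h (F i).
Proof. by move=> LF Lh; rewrite dotC dot_suml//; apply: eq_bigr => i _; exact: dotC. Qed.

Lemma dot_ge0 f : 0 <= dot f f.
Proof. by apply: Rint01_ge0 => u _; rewrite -expr2 sqr_ge0. Qed.

Lemma quad_CS (a b c : R) : 0 <= a -> 0 <= c ->
  (forall x y : R, 0 <= x ^+ 2 * a - x * y * b *+ 2 + y ^+ 2 * c) -> b ^+ 2 <= a * c.
Proof.
move=> a0 c0 key.
(* The pair (b, a) gives a (a c - b^2) >= 0, which settles a > 0. The other pairs force b = 0 when a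
   = 0, according to whether c vanishes. *)
have := key b a; have := key c b; have := key (-1) (b * (c + 1)); have := key (b*(a+1)) 1.
have [a1 h1 h2 h3 _|a1 _ _ _] := eqVneq a 0.
  rewrite a1 mul0r; move: h1 h2 h3; rewrite a1.
  have [->|c1] := eqVneq c 0; nra.
have {}a0 : 0 < a by rewrite lt_def a1.
move=> h; have : 0 <= a * (a * c - b ^+ 2).
  by move: h => /le_trans; apply; rewrite le_eqVlt; apply/orP; left; apply/eqP; ring.
by rewrite pmulr_rge0// subr_ge0.
Qed.

Lemma dot_CS f g : L2 f -> L2 g -> dot f g ^+ 2 <= dot f f * dot g g.
Proof.
move=> Lf Lg; apply: quad_CS; [exact: dot_ge0|exact: dot_ge0|move=> x y].
have := dot_ge0 (fun u => x * f u - y * g u).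
have Lx := L2Z x Lf; have Ly := L2Z y Lg; have Lxy := L2B Lx Ly.
rewrite dotBl// !dotBr// !dotZl// !dotZr// (dotC g f).
by move=> /le_trans; apply; rewrite le_eqVlt; apply/orP; left; apply/eqP; ring.
Qed.

Lemma dot_CS_norm f g : L2 f -> L2 g -> `|dot f g| <= Num.sqrt (dot f f) * Num.sqrt (dot g g).
Proof.
by move=> Lf Lg; rewrite -sqrtrM ?dot_ge0// -sqrtr_sqr ler_wsqrtr// dot_CS.
Qed.

Lemma dot_abs_le f g : L2 f -> L2 g -> (\int[leb]_(u in I01) `|f u * g u|)%R <=
  Num.sqrt (dot f f) * Num.sqrt (dot g g).
Proof.
move=> Lf Lg; have Labs (k : R -> R) : L2 k -> L2 (fun u => `|k u|).
  move=> Lk; split; first by apply: measurableT_comp => //; exact: Lk.1.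
  have := Lk.2; congr (_ < _)%E; apply: eq_integral => u _.
  by rewrite real_normK// num_real.
have dabs (k : R -> R) : dot (fun u => `|k u|) (fun u => `|k u|) = dot k k.
  by apply: eq_Rint01 => u _; rewrite -expr2 real_normK// num_real.
rewrite -(dabs f) -(dabs g); apply: le_trans (dot_CS_norm (Labs _ Lf) (Labs _ Lg)).
rewrite /dot (eq_Rint01 (g := fun u => `|f u| * `|g u|)) ?ler_norm// => u _.
exact: normrM.
Qed.

Lemma eq_ae_dot f f' g : L2 f -> L2 f' -> L2 g -> f = f' %[ae leb in I01] -> dot f g = dot f' g.
Proof.
move=> Lf Lf' Lg ff'; rewrite /dot /Rintegral; congr fine.
apply: ae_eq_integral => //.
- by apply/measurable_EFinP; exact: measurable_funM Lf.1 Lg.1.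
- by apply/measurable_EFinP; exact: measurable_funM Lf'.1 Lg.1.
by apply: (@filterS _ _ (ae_filter_ringOfSetsType leb)) ff' => u /= h u01; rewrite h.
Qed.

End calculus.

(** * Positive compact operators *)

(** The image ultrafilter converges because [- M, M] is compact. The same [U] serves all bounded
    sequences at once, so pointwise limits on all of [0, 1] need no diagonal argument. *)
Lemma ultra_bounded_cvg (R : realType) (x : nat -> R) (M : R) (U : set_system nat) :
  UltraFilter U -> (forall n, `|x n| <= M) -> exists l : R, forall eps, 0 < eps -> U [set n | `|x n
    - l| < eps].
Proof.
move=> UU xM.
have cK : compact (`[- M, M]%classic : set R) by exact: segment_compact.
have [|l [_ xl]] := cK (x @ U) _.
  change (U (x @^-1` `[- M, M])); apply: (@filterS _ U _ setT); last exact: filterT.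
  by move=> n _ /=; rewrite in_itv/= -ler_norml.
exists l => eps e0.
have [//|hC] := in_ultra_setVsetC [set n | `|x n - l| < eps] UU.
have [y [[n /= hn <-] hy]] : ((x @` ~` [set n | `|x n - l| < eps]) `&` ball l eps !=set0).
  apply: xl; last exact: nbhsx_ballx.
  change (U (x @^-1` (x @` ~` [set n | `|x n - l| < eps]))).
  by apply: filterS hC => n hn; exists n.
by exfalso; apply: hn; move: hy; rewrite /ball/= distrC.
Qed.

Section spectral.
Context {R : realType} {V : lmodType R}.
Variable ip : V -> V -> R.
Hypothesis ipDl : forall f g h, ip (f + g) h = ip f h + ip g h.
Hypothesis ipZl : forall a f h, ip (a *: f) h = a * ip f h.
Hypothesis ipC : forall f g, ip f g = ip g f.
Hypothesis ip_ge0 : forall f, 0 <= ip f f.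

Local Lemma ipDr f g h : ip h (f + g) = ip h f + ip h g.
Proof. by rewrite ipC ipDl ipC (ipC g). Qed.
Local Lemma ipZr a f h : ip h (a *: f) = a * ip h f.
Proof. by rewrite ipC ipZl ipC. Qed.
Local Lemma ipNl f h : ip (- f) h = - ip f h.
Proof. by rewrite -scaleN1r ipZl mulN1r. Qed.
Local Lemma ipNr f h : ip h (- f) = - ip h f.
Proof. by rewrite ipC ipNl ipC. Qed.
Local Lemma ip0l h : ip 0 h = 0.
Proof. by rewrite -(scale0r h) ipZl mul0r. Qed.
Local Definition ipE := (ipDl, ipDr, ipNl, ipNr, ipZl, ipZr).

Local Lemma ip_CS f g : ip f g ^+ 2 <= ip f f * ip g g.
Proof.
apply: quad_CS; [exact: ip_ge0|exact: ip_ge0|move=> x y].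
have := ip_ge0 (x *: f - y *: g); rewrite !ipE (ipC g f).
by move=> /le_trans; apply; rewrite le_eqVlt; apply/orP; left; apply/eqP; ring.
Qed.

Local Lemma ip_null f g : ip f f = 0 -> ip f g = 0.
Proof.
move=> f0; have := ip_CS f g; rewrite f0 mul0r => h.
by apply/eqP; rewrite -sqrf_eq0 eq_le h sqr_ge0.
Qed.

Local Lemma ip_add_le f g : ip (f + g) (f + g) <= 2 * (ip f f + ip g g).
Proof. by have := ip_ge0 (f - g); rewrite !ipE (ipC g f); lra. Qed.

(* Compactness along ultrafilters replaces the extraction of subsequences. *)
Definition ultracompact (K : V -> V) := forall f : nat -> V,
  (forall n, ip (f n) (f n) <= 1) -> forall U : set_system nat, UltraFilter U ->
  exists g, forall eps, 0 < eps -> U [set n | ip (K (f n) - g) (K (f n) - g) < eps].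

Definition positive_compact (K : V -> V) :=
  [/\ forall a f g, K (a *: f + g) = a *: K f + K g,
      forall f g, ip (K f) g = ip f (K g),
      forall f, 0 <= ip (K f) f,
      exists C, forall f, ip (K f) f <= C * ip f f
    & ultracompact K].

Section one_step.
Variable K : V -> V.
Hypothesis Kpc : positive_compact K.

Local Lemma K_lin a f g : K (a *: f + g) = a *: K f + K g. Proof. by case: Kpc. Qed.
Local Lemma K_sym f g : ip (K f) g = ip f (K g). Proof. by case: Kpc. Qed.
Local Lemma K_pos f : 0 <= ip (K f) f. Proof. by case: Kpc. Qed.
Local Lemma K0 : K 0 = 0.
Proof. by have /eqP := K_lin 1 0 0; rewrite !scale1r addr0 -subr_eq0 opprD addrA subrr sub0r
  oppr_eq0 => /eqP. Qed.
Local Lemma KZ a f : K (a *: f) = a *: K f.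
Proof. by have := K_lin a f 0; rewrite !addr0 K0 addr0. Qed.
Local Lemma KD f g : K (f + g) = K f + K g.
Proof. by have := K_lin 1 f g; rewrite !scale1r. Qed.
Local Lemma KN f : K (- f) = - K f.
Proof. by rewrite -scaleN1r KZ scaleN1r. Qed.

Local Lemma K_CS f g : ip (K f) g ^+ 2 <= ip (K f) f * ip (K g) g.
Proof.
apply: quad_CS; [exact: K_pos|exact: K_pos|move=> x y].
have := K_pos (x *: f - y *: g); rewrite KD KN !KZ !ipE (K_sym g f) (ipC g (K f)).
by move=> /le_trans; apply; rewrite le_eqVlt; apply/orP; left; apply/eqP; ring.
Qed.

(** Cauchy-Schwarz for the form (K f, g) at g = K f gives |K f|^4 <= (K f, f) (K K f, K f), and both
    factors are controlled by the bound on the form. *)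
Local Lemma K_norm lam : (forall f, ip (K f) f <= lam * ip f f) ->
  forall f, ip (K f) (K f) <= lam ^+ 2 * ip f f.
Proof.
move=> Kl f; set N := ip (K f) (K f).
have N0 : 0 <= N := ip_ge0 _; have f0 := ip_ge0 f.
have [->|N1] := eqVneq N 0; first by rewrite mulr_ge0// sqr_ge0.
have {N1}N0 : 0 < N by rewrite lt_def N1.
have := K_CS f (K f); rewrite -/N => h.
have h1 := Kl f; have h2 := Kl (K f); have p1 := K_pos f; have p2 := K_pos (K f).
rewrite -/N in h2.
have : N ^+ 2 <= (lam * ip f f) * (lam * N) by rewrite (le_trans h)// ler_pM.
rewrite (_ : _ * (lam * N) = (lam ^+ 2 * ip f f) * N); last by ring.
by rewrite expr2 ler_pM2r.
Qed.

(** The supremum of the Rayleigh quotient is attained by compactness: near-maximisers f_n are almost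
    eigenvectors, and K f_n converges along an ultrafilter. A zero supremum is reported by the pair
    (0, 0). *)
Lemma top_eigenvector : exists le : R * V,
  [/\ 0 <= le.1, (ip le.2 le.2 = 1 /\ 0 < le.1) \/ (le.2 = 0 /\ le.1 = 0),
      ip (K le.2 - le.1 *: le.2) (K le.2 - le.1 *: le.2) = 0
    & forall f, ip (K f) f <= le.1 * ip f f].
Proof.
have [_ _ _ [C KC] Kcomp] := Kpc.
pose S := [set r | exists2 f, ip f f <= 1 & r = ip (K f) f].
have S0 : S 0 by exists 0; rewrite ?ip0l// K0 ip0l.
have Sub : has_ubound S.
  exists `|C| => _ [f f1 ->]; rewrite (le_trans (KC f))//.
  rewrite (le_trans (ler_norm _))// normrM (ger0_norm (ip_ge0 f)).
  by rewrite ler_piMr.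
have supS : has_sup S by split => //; exists 0.
pose lam := sup S.
have lam0 : 0 <= lam by exact: ub_le_sup.
have Klam f : ip (K f) f <= lam * ip f f.
  have [f0|f0] := eqVneq (ip f f) 0; first by have := KC f; rewrite f0 !mulr0.
  have {}f0 : 0 < ip f f by rewrite lt_def f0 ip_ge0.
  pose c := (Num.sqrt (ip f f))^-1.
  have c2 : c ^+ 2 = (ip f f)^-1 by rewrite exprVn sqr_sqrtr// ltW.
  have : ip (K (c *: f)) (c *: f) <= lam.
    apply: ub_le_sup => //; exists (c *: f) => //.
    by rewrite !ipE mulrA -expr2 c2 mulVf// gt_eqF.
  by rewrite KZ !ipE mulrA -expr2 c2 ler_pdivrMl// mulrC.
have [l0|l0] := eqVneq lam 0.
  exists (0, 0); split => //=; [by right|by rewrite K0 scaler0 subr0 ip0l|].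
  by move=> f; have := Klam f; rewrite l0.
have {lam0 l0}lam0 : 0 < lam by rewrite lt_def l0.
have /choice[f fP] : forall n : nat, exists f, ip f f <= 1 /\ lam - n.+1%:R^-1 < ip (K f) f.
  move=> n; have n0 : 0 < (n.+1%:R^-1 : R) by rewrite invr_gt0.
  by have [_ [f f1 ->] h] := sup_adherent n0 supS; exists f.
have [U [UU ooU]] := ultraFilterLemma (eventually_filter : ProperFilter \oo).
have [g gP] := Kcomp f (fun n => (fP n).1) U UU.
have ext eps : 0 < eps -> exists n, ip (K (f n) - g) (K (f n) - g) < eps /\ n.+1%:R^-1 < eps.
  move=> e0; apply: (@filter_ex _ U).
  apply: filterI; first exact: gP.
  by apply: ooU; exact: (near_infty_natSinv_lt (PosNum e0)).
(* If g were null, K f_n would become small and so would (K f_n, f_n), whereas these values approach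
   lam > 0. *)
have gpos : ip g g != 0.
  apply/eqP => g0.
  have [|n [h1 h2]] := ext (Num.min (lam / 2) (lam ^+ 2 / 4)).
    by rewrite lt_min !divr_gt0// exprn_gt0.
  rewrite lt_min in h1; rewrite lt_min in h2.
  have [/andP[_ h1'] /andP[h2' _]] := (h1, h2).
  have [f1 f2] := fP n.
  have e1 : ip (K (f n)) (f n) = ip (K (f n) - g) (f n) by rewrite ipDl ipNl (ip_null _ g0) subr0.
  have := ip_CS (K (f n) - g) (f n); rewrite -e1.
  have := ip_ge0 (f n); have := ip_ge0 (K (f n) - g).
  set A := ip (K (f n) - g) _ in h1' *; set B := ip (f n) (f n) in f1 *.
  set D := ip (K (f n)) (f n) in f2 *; move: h2' f2; set y := _^-1 => h2' f2 A0 B0 DAB.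
  have : A * B <= A by rewrite ler_piMr.
  have : (lam / 2) ^+ 2 <= D ^+ 2 by rewrite ler_pXn2r ?nnegrE//; lra.
  by rewrite expr_div_n (_ : 2 ^+ 2 = 4 :> R)//; [lra|ring].
(* With v = K f_n - lam f_n, the choice of f_n gives |v|^2 <= 2 lam / (n + 1). As g is close to K
   f_n, the vector K g - lam g is K v up to terms in w = K f_n - g. *)
have gnull : ip (K g - lam *: g) (K g - lam *: g) = 0.
  apply/eqP; rewrite eq_le ip_ge0 andbT; apply/ler_addgt0Pr => eps e0; rewrite add0r.
  (* The denominator is what two uses of [ip_add_le] accumulate: 2 (2 (lam^2 + lam^2) + 2 lam^3). *)
  pose d := eps / (8 * lam ^+ 2 + 4 * lam ^+ 3).
  have D0 : 0 < 8 * lam ^+ 2 + 4 * lam ^+ 3 by rewrite addr_gt0 ?mulr_gt0 ?exprn_gt0.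
  have d0 : 0 < d by rewrite divr_gt0.
  have [n [h1 h2]] := ext d d0; have [f1 f2] := fP n.
  set w := K (f n) - g in h1; set v := K (f n) - lam *: f n.
  have -> : K g - lam *: g = (K (- w) + lam *: w) + K v.
    rewrite /w /v opprB 2!KD 2!KN KZ scalerBr.
    by rewrite [RHS]addrAC !addrA !subrK.
  have vv : ip v v <= 2 * lam * n.+1%:R^-1.
    rewrite /v !ipE (ipC (f n) (K (f n))).
    have := K_norm Klam (f n).
    have : lam ^+ 2 * ip (f n) (f n) <= lam ^+ 2 by rewrite ler_piMr// sqr_ge0.
    have : lam * (lam - n.+1%:R^-1) <= lam * ip (K (f n)) (f n) by rewrite ler_pM2l// ltW.
    by set y := _^-1; nra.
  have KW : ip (K (- w)) (K (- w)) <= lam ^+ 2 * ip w w.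
    by rewrite (le_trans (K_norm Klam _))// ipNl ipNr opprK.
  have lW : ip (lam *: w) (lam *: w) = lam ^+ 2 * ip w w by rewrite ipZl ipZr mulrA expr2.
  have KV : ip (K v) (K v) <= lam ^+ 2 * (2 * lam * d).
    rewrite (le_trans (K_norm Klam _))// ler_wpM2l ?sqr_ge0// (le_trans vv)// ler_wpM2l ?ltW//.
    by rewrite mulr_gt0.
  have lW2 : lam ^+ 2 * ip w w <= lam ^+ 2 * d by rewrite ler_wpM2l ?sqr_ge0// ltW.
  have -> : eps = d * (8 * lam ^+ 2 + 4 * lam ^+ 3) by rewrite divfK// gt_eqF.
  have := ip_add_le (K (- w) + lam *: w) (K v); have := ip_add_le (K (- w)) (lam *: w).
  by rewrite lW; nra.
have g0 : 0 < ip g g by rewrite lt_def gpos ip_ge0.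
pose c := (Num.sqrt (ip g g))^-1.
have c2 : c ^+ 2 = (ip g g)^-1 by rewrite exprVn sqr_sqrtr// ltW.
exists (lam, c *: g); split => //=; first exact: ltW.
  by left; split => //; rewrite !ipE mulrA -expr2 c2 mulVf.
by rewrite KZ scalerA mulrC -scalerA -scalerBr ipZl ipZr gnull !mulr0.
Qed.

(** Positivity survives because the new form at f is the old one at f - (f, e) e. Compactness
    survives because the subtracted part has rank one, with bounded coefficients that converge along
    [U]. *)
Lemma deflation_positive_compact (lam : R) (e : V) : 0 <= lam ->
    (ip e e = 1 /\ 0 < lam) \/ (e = 0 /\ lam = 0) -> ip (K e - lam *: e) (K e - lam *: e) = 0 ->
  positive_compact (fun f => K f - (lam * ip f e) *: e).
Proof.
have [_ _ _ [C KC] Kcomp] := Kpc.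
move=> lam0 e1 enull.
have Ke f : ip (K e) f = lam * ip e f.
  by have := ip_null f enull; rewrite !ipE => /eqP; rewrite subr_eq0 => /eqP.
split.
- move=> a f g; rewrite K_lin ipDl ipZl mulrDr scalerDl scalerBr opprD -!addrA.
  congr (_ + _); rewrite addrCA scalerA (_ : lam * (a * _) = a * (lam * ip f e)) //; ring.
- by move=> f g; rewrite !ipE K_sym (ipC e g); ring.
- move=> f; set c := ip f e.
  case: e1 => [[e1 _]|[_ ->]]; last by rewrite mul0r scale0r subr0 K_pos.
  have := K_pos (f - c *: e).
  rewrite KD KN KZ !ipE (ipC (K f) e) !Ke (ipC e f) -K_sym Ke (ipC e f) -/c e1.
  by move=> /le_trans; apply; rewrite le_eqVlt; apply/orP; left; apply/eqP; ring.
- exists C => f; rewrite !ipE (ipC e f) -mulrA; apply: le_trans (KC f).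
  by rewrite gerBl mulr_ge0// -expr2 sqr_ge0.
- move=> f f1 U UU; have [g gP] := Kcomp f f1 U UU.
  have ee : ip e e <= 1 by case: e1 => [[-> _]//|[-> _]]; rewrite ip0l ler01.
  have fe n : `|ip (f n) e| <= 1.
    rewrite -(@ler_pXn2r _ 2)// ?nnegrE// real_normK ?num_real// expr1n.
    by rewrite (le_trans (ip_CS _ _))// -[1]mulr1 ler_pM.
  have [l lP] := ultra_bounded_cvg UU fe.
  exists (g - (lam * l) *: e) => eps eps0.
  pose d := Num.min (eps / 4) (Num.min 1 (eps / (4 * (lam ^+ 2 + 1)))).
  have L0 : 0 < lam ^+ 2 + 1 by rewrite ltr_wpDl// sqr_ge0.
  have d0 : 0 < d by rewrite !lt_min ltr01 !divr_gt0//= mulr_gt0.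
  apply: filterS (filterI (gP d d0) (lP d d0)) => n /= [h1 h2].
  have -> : K (f n) - (lam * ip (f n) e) *: e - (g - (lam * l) *: e) =
      (K (f n) - g) + (lam * (l - ip (f n) e)) *: e.
    by rewrite mulrBr scalerBl opprB addrACA [RHS]addrACA; congr (_ + _); rewrite addrC.
  apply: le_lt_trans (ip_add_le _ _) _.
  move: h1 h2; rewrite !lt_min => /andP[h1 _] /andP[_ /andP[h2 h3]].
  rewrite ipZl ipZr.
  set x := l - _; have x2 : x ^+ 2 < eps / (4 * (lam ^+ 2 + 1)).
    rewrite -real_normK ?num_real// /x distrC; apply: le_lt_trans h3.
    by rewrite expr2 ler_piMr// ltW.
  rewrite ltr_pdivlMr ?mulr_gt0// in x2.
  have : lam ^+ 2 * x ^+ 2 * ip e e <= lam ^+ 2 * x ^+ 2 by rewrite ler_piMr// mulr_ge0 ?sqr_ge0.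
  have := sqr_ge0 x.
  nra.
Qed.

End one_step.

Theorem spectral_decomposition (K : V -> V) : positive_compact K ->
  exists (e : nat -> V) (lam : nat -> R),
  [/\ forall n, 0 <= lam n,
      forall n, (ip (e n) (e n) = 1 /\ 0 < lam n) \/ (e n = 0 /\ lam n = 0),
      forall i j, i != j -> ip (e i) (e j) = 0,
      forall n, ip (K (e n) - lam n *: e n) (K (e n) - lam n *: e n) = 0
    & forall eps, 0 < eps -> exists N, forall f,
        let r := K f - \sum_(k < N) (lam k * ip f (e k)) *: e k in
        ip r r <= eps ^+ 2 * ip f f].
Proof.
move=> K0pc.
(* Operators are bundled with their properties, so that deflation can be iterated. *)
pose T := {K : V -> V | positive_compact K}.
have [s sP] := choice (fun K : T => top_eigenvector (proj2_sig K)).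
pose nxt (K : T) : T := exist _ _
  (let: And4 a b c _ := sP K in deflation_positive_compact (proj2_sig K) a b c).
pose Ks n : T := iter n nxt (exist _ K K0pc).
pose e n := (s (Ks n)).2; pose lam n := (s (Ks n)).1.
have lam0 n : 0 <= lam n by case: (sP (Ks n)).
have e1 n : (ip (e n) (e n) = 1 /\ 0 < lam n) \/ (e n = 0 /\ lam n = 0) by case: (sP (Ks n)).
have Kn n : sval (Ks n) = fun f => K f - \sum_(k < n) (lam k * ip f (e k)) *: e k.
  elim: n => [|n IH]; apply/funext => f; first by rewrite big_ord0 subr0.
  by rewrite big_ord_recr/= opprD addrA -[K f - _](congr1 (fun g => g f) IH).
pose L n f := sval (Ks n) f.
have LS n f : L n.+1 f = L n f - (lam n * ip f (e n)) *: e n by [].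
have Lsym n f g : ip (L n f) g = ip f (L n g) by exact: (K_sym (proj2_sig (Ks n))).
have Lnull n f : ip (L n (e n)) f = lam n * ip (e n) f.
  have [_ _ h _] := sP (Ks n).
  by have := ip_null f h; rewrite !ipE => /eqP; rewrite subr_eq0 => /eqP.
(* After n deflations the operator kills e_j for j < n. By symmetry lam_n (e_n, e_j) = (e_n, L_n
   e_j) = 0, which gives orthogonality when lam_n is nonzero; otherwise e_n = 0. *)
have ort n : (forall j f, (j < n)%N -> ip (L n (e j)) f = 0) /\
             (forall j, (j < n)%N -> ip (e n) (e j) = 0).
  have step m : (forall j f, (j < m)%N -> ip (L m (e j)) f = 0) ->
      forall j, (j < m)%N -> ip (e m) (e j) = 0.
    move=> IH j jm; case: (e1 m) => [[_ l0]|[-> _]]; last exact: ip0l.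
    by apply: (mulfI (lt0r_neq0 l0)); rewrite -Lnull Lsym ipC IH// mulr0.
  elim: n => [|n [IH1 IH2]]; first by split => //; move=> j; rewrite ltn0.
  suff h : forall j f, (j < n.+1)%N -> ip (L n.+1 (e j)) f = 0 by split => //; exact: step.
  move=> j f; rewrite ltnS leq_eqVlt LS !ipE => /predU1P[->|jn].
    by rewrite Lnull; case: (e1 n) => [[-> _]|[-> ->]]; rewrite ?ip0l; ring.
  by rewrite IH1// (ipC (e j)) IH2//; ring.
have eo i j : i != j -> ip (e i) (e j) = 0.
  by rewrite neq_ltn => /orP[ij|ij]; [rewrite ipC|]; apply: (ort _).2.
exists e, lam; split => //.
- move=> n.
  have h f : ip (K (e n)) f = lam n * ip (e n) f.
    rewrite -Lnull /L Kn !ipE; rewrite -[LHS]subr0; congr (_ - _); symmetry.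
    by rewrite big1 ?ip0l// => k _; rewrite eo ?mulr0 ?scale0r// neq_ltn ltn_ord orbT.
  by rewrite ipDl h ipNl ipZl subrr.
(* If all lam_n were at least eps, the e_n would be orthonormal and a limit g of the K e_n would be
   orthogonal to each e_m. Then |K e_n - g|^2 >= lam_n^2 >= eps^2, against convergence. *)
- have small eps : 0 < eps -> exists n, lam n < eps.
    move=> eps0; apply/not_existsP => /= hn.
    have le n : eps <= lam n by rewrite leNgt; apply/negP; exact: hn.
    have en n : ip (e n) (e n) = 1.
      by case: (e1 n) => [[]//|] [_ l0]; have := le n; rewrite l0 leNgt eps0.
    have Ke n f : ip (K (e n)) f = lam n * ip (e n) f.
      rewrite -Lnull /L Kn !ipE; rewrite -[LHS]subr0; congr (_ - _); symmetry.
      by rewrite big1 ?ip0l// => k _; rewrite eo ?mulr0 ?scale0r// neq_ltn ltn_ord orbT.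
    have [U [UU ooU]] := ultraFilterLemma (eventually_filter : ProperFilter \oo).
    have [_ _ _ _ Kcomp] := K0pc.
    have [|g gP] := Kcomp e _ U UU; first by move=> n; rewrite en.
    have ge m : ip g (e m) = 0.
      apply/eqP; rewrite -sqrf_eq0 eq_le sqr_ge0 andbT.
      apply/ler_addgt0Pr => d d0; rewrite add0r.
      have [n [h mn]] : exists n, ip (K (e n) - g) (K (e n) - g) < d /\ (m < n)%N.
        by apply: (@filter_ex _ U); apply: filterI; [exact: gP|apply: ooU; exists m.+1].
      have := ip_CS (K (e n) - g) (e m); rewrite en mulr1 ipDl ipNl Ke eo ?mulr0 ?sub0r ?sqrrN.
        by move=> /le_trans; apply; exact: ltW.
      by rewrite neq_ltn mn orbT.
    have [n h] : exists n, ip (K (e n) - g) (K (e n) - g) < eps ^+ 2.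
      by apply: (@filter_ex _ U); apply: gP; exact: exprn_gt0.
    move: h; rewrite !ipE (ipC g (K (e n))) !Ke (ipC (e n) (K _)) Ke (ipC (e n) g) ge en.
    have := ip_ge0 g; have := le n.
    by have := lam0 n; nra.
  (* The remainder after N steps is the N-th deflated operator, whose form is bounded by lam_N;
     [K_norm] converts this into a norm bound. *)
  move=> eps eps0; have [N hN] := small eps eps0; exists N => f /=.
  have [_ _ _ hK] := sP (Ks N).
  rewrite -[K f - _](congr1 (fun g => g f) (Kn N)).
  apply: (K_norm (proj2_sig (Ks N))) => h; apply: le_trans (hK h) _.
  by rewrite ler_wpM2r// ltW.
Qed.

End spectral.

(** * Test functions *)

Section bump.
Context {R : realType}.
Implicit Types (f : R -> R) (p : {poly R}).

Lemma is_derive_flat f (x C : R) : f x = 0 -> (forall y, `|f y| <= C * (y - x) ^+ 2) ->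
  is_derive x 1 f 0.
Proof.
move=> fx fC; apply/is_derive1_caratheodory.
exists (fun z => f z / (z - x)); split; last by rewrite subrr invr0 mulr0.
- move=> z; rewrite fx subr0; have [->|zx] := eqVneq z x; first by rewrite subrr mulr0 fx.
  by rewrite divfK// subr_eq0.
- have C0 : 0 < `|C| + 1 by rewrite ltr_wpDl.
  rewrite /prop_for /continuous_at subrr invr0 mulr0; apply/cvgr0Pnorm_lt => e e0.
  near=> z; have [->|zx] := eqVneq z x; first by rewrite subrr invr0 mulr0 normr0.
  have zx0 : 0 < `|z - x| by rewrite normr_gt0 subr_eq0.
  rewrite normrM normfV ltr_pdivrMr//; apply: le_lt_trans (fC z) _.
  rewrite -real_normK ?num_real// expr2 mulrA ltr_pM2r//.
  have h : `|z - x| < e / (`|C| + 1).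
    rewrite distrC; near: z; apply: (@nbhsx_ballx _ _ x).
    exact: divr_gt0.
  rewrite ltr_pdivlMr// mulrC in h.
  by apply: le_lt_trans h; rewrite ler_wpM2r// (le_trans (ler_norm C))// lerDl.
Unshelve. all: by end_near. Qed.

Lemma is_derive_pow f (x d : R) n : is_derive x 1 f d ->
  is_derive x 1 (fun y => f y ^+ n) (n%:R * f x ^+ n.-1 * d).
Proof.
move=> df; have := is_deriveX n df.
by rewrite (_ : f ^+ n = fun y => f y ^+ n)// exprfctE.
Qed.

Section fixed.
Context (c a b : R).
Hypotheses (c0 : 0 < c) (ab : a < b).

Local Definition bquad : {poly R} := ('X - a%:P) * (b%:P - 'X).

Local Lemma bquadE u : bquad.[u] = (u - a) * (b - u).
Proof. by rewrite /bquad !hornerE. Qed.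

(* With q = (u - a)(b - u): p q^-m exp(- c / q). The family is stable under differentiation, and
   exp(- c / q) tends to the indicator of ]a, b[ as c tends to 0. *)
Definition bump p m (u : R) : R :=
  if a < u < b then p.[u] * bquad.[u]^-1 ^+ m * expR (- (c * bquad.[u]^-1)) else 0.

Definition bump_next p (m : nat) : {poly R} :=
  p^`() * bquad ^+ 2 - m%:R *: (p * bquad^`() * bquad) + c *: (p * bquad^`()).

Local Lemma bump_nextE p m u : (bump_next p m).[u] =
  p^`().[u] * bquad.[u] ^+ 2 - m%:R * (p.[u] * bquad^`().[u] * bquad.[u]) + c * (p.[u] *
    bquad^`().[u]).
Proof. by rewrite /bump_next; move: bquad => q; rewrite !hornerE. Qed.

Local Lemma bquad_gt0 u : a < u < b -> 0 < bquad.[u].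
Proof. by move=> /andP[au ub]; rewrite bquadE mulr_gt0// subr_gt0. Qed.

(** The exponential series gives exp(c / q) >= (c / q)^(m + 2) / (m + 2)!, which beats the pole q^-m
    with q^2 to spare. Vanishing to second order at a and b then makes the derivative 0 there. *)
Lemma bump_bound p m : exists2 C : R, 0 <= C &
  forall u, a < u < b -> `|bump p m u| <= C * bquad.[u] ^+ 2.
Proof.
have [M M0 pM] : exists2 M : R, 0 <= M & forall u, a < u < b -> `|p.[u]| <= M.
  have cp : {within `[a, b], continuous (fun x => `|p.[x]|)}.
    apply: continuous_subspaceT => x; apply: cvg_norm; exact: continuous_horner.
  have [d _ hd] := EVT_max (ltW ab) cp; exists `|p.[d]| => // u /andP[au ub].
  by apply: hd; rewrite in_itv/= !ltW.
pose K := (m.+2)`!%:R / c ^+ m.+2.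
have K0 : 0 <= K by rewrite divr_ge0// exprn_ge0// ltW.
exists (M * K); first exact: mulr_ge0.
move=> u aub; rewrite /bump aub; have q0 := bquad_gt0 aub; set z := bquad.[u].
rewrite !normrM -!mulrA ler_pM ?pM ?mulr_ge0//.
rewrite [`|expR _|]ger0_norm ?expR_ge0// ger0_norm; last by rewrite exprn_ge0// invr_ge0 ltW.
rewrite expRN.
have z0 : 0 < z := q0.
have := expR_ge1Dxn m.+1 (ltW (_ : 0 < c * z^-1)); rewrite mulr_gt0 ?invr_gt0// => /(_ isT) h.
have {}h : (c * z^-1) ^+ m.+2 / (m.+2)`!%:R <= expR (c * z^-1).
  by apply: le_trans h; rewrite lerDr.
rewrite ler_pdivrMr ?expR_gt0//; apply: le_trans (ler_wpM2l _ h); last first.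
  by rewrite mulr_ge0 ?ler0n// mulr_ge0 ?invr_ge0 ?exprn_ge0 // ltW.
rewrite /K le_eqVlt; apply/orP; left; apply/eqP.
rewrite exprMn -(addn2 m) !exprD !exprVn; field.
by rewrite !gt_eqF ?exprn_gt0 ?ltr0n ?fact_gt0.
Qed.

Lemma bump_is_derive p m (u : R) : is_derive u 1 (bump p m) (bump (bump_next p m) m.+2 u).
Proof.
have outside v : ~~ (a < v < b) -> bump p m v = 0 by rewrite /bump => /negbTE ->.
have [aub|] := boolP (a < u < b).
  have q0 := bquad_gt0 aub; have qn0 : bquad.[u] != 0 by rewrite gt_eqF.
  pose g v := p.[v] * bquad.[v]^-1 ^+ m * expR (- (c * bquad.[v]^-1)).
  have gb : \forall v \near u, g v = bump p m v.
    have /near_in_itvoo : u \in `]a, b[ by rewrite in_itv.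
    by apply: filterS => v; rewrite in_itv /bump /= => ->.
  apply: (near_eq_is_derive gb).
  have dp := is_derive_poly p u; have dq := is_derive_poly bquad u.
  have dqV : is_derive u 1 (fun v => bquad.[v]^-1) (- bquad.[u] ^- 2 * bquad^`().[u]).
    exact: (is_deriveV qn0 dq).
  have dqm : is_derive u 1 (fun v => bquad.[v]^-1 ^+ m)
     (m%:R * bquad.[u]^-1 ^+ m.-1 * (- bquad.[u] ^- 2 * bquad^`().[u])).
    exact: is_derive_pow.
  have de : is_derive u 1 (fun v => expR (- (c * bquad.[v]^-1)))
     (expR (- (c * bquad.[u]^-1)) * (- (c * (- bquad.[u] ^- 2 * bquad^`().[u])))).
    apply: is_derive1_comp; apply: is_deriveN.
  have D : is_derive u 1 g _ := is_deriveM (is_deriveM dp dqm) de.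
  apply: (is_derive_eq D).
  rewrite /bump aub bump_nextE /GRing.scale /= mulrfctE.
  move: qn0 {D de dqm dqV dq dp gb g q0 outside}.
  move: bquad.[u] bquad^`().[u] p.[u] p^`().[u] (expR _) => z z' y y' E z0.
  case: m => [|m] /=; rewrite !exprS ?expr0.
    by field.
  by move: (z^-1 ^+ m) (m.+1%:R : R) => w k; field.
rewrite {2}/bump => /[dup] nau /negbTE ->.
have [C C0 hC] := bump_bound p m.
pose B := C * (b - a) ^+ 2.
have hB v w : (w = a) \/ (w = b) -> `|bump p m v| <= B * (v - w) ^+ 2.
  move=> wab; have [avb|/outside ->] := boolP (a < v < b); last first.
    by rewrite normr0 mulr_ge0 ?sqr_ge0// mulr_ge0 ?sqr_ge0.
  apply: le_trans (hC v avb) _; rewrite /B -mulrA ler_wpM2l// bquadE exprMn.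
  move: avb => /andP[av vb]; case: wab => ->.
    rewrite mulrC ler_wpM2r ?sqr_ge0// ler_pXn2r ?nnegrE//; lra.
  rewrite -[(v - b) ^+ 2]sqrrN opprB ler_wpM2r ?sqr_ge0// ler_pXn2r ?nnegrE//; lra.
have [ua|ua] := ltrP u a.
  have : \forall v \near u, (cst 0 : R -> R) v = bump p m v.
    near=> v; rewrite outside// negb_and -!leNgt; apply/orP; left.
    by apply/ltW; near: v; exact: lt_nbhsl.
  by move=> /near_eq_is_derive; apply; exact: is_derive_cst.
have [ub|ub] := ltrP b u.
  have : \forall v \near u, (cst 0 : R -> R) v = bump p m v.
    near=> v; rewrite outside// negb_and -!leNgt; apply/orP; right.
    by apply/ltW; near: v; exact: lt_nbhsr.
  by move=> /near_eq_is_derive; apply; exact: is_derive_cst.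
have uab : u = a \/ u = b.
  move: nau; rewrite negb_and -!leNgt => /orP[h|h]; [left|right]; apply/eqP; rewrite eq_le.
    by rewrite h ua.
  by rewrite h ub.
apply: is_derive_flat (fun v => hB v u uab).
by rewrite outside.
Unshelve. all: by end_near. Qed.

Lemma bump_derive1n p m k : exists p' m', (bump p m)^`(k)%classic = bump p' m'.
Proof.
elim: k => [|k [p' [m' IH]]]; first by exists p, m; rewrite derive1n0.
exists (bump_next p' m'), m'.+2; rewrite derive1nS IH; apply/funext => u.
by rewrite derive1E; have d := bump_is_derive p' m' u; rewrite derive_val.
Qed.

Lemma bump_test p m : 0 < a -> b < 1 -> test_function (bump p m).
Proof.
move=> a0 b1; split.
  move=> k u; have [p' [m' ->]] := bump_derive1n p m k.
  by have [] := bump_is_derive p' m' u.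
exists a, b; split => // u; rewrite in_itv /bump /= negb_and -!ltNge => /orP[h|h].
  by rewrite ltNge (ltW h).
by rewrite [u < b]ltNge (ltW h) andbF.
Qed.

End fixed.

Local Notation leb := (@lebesgue_measure R).
Local Notation I01 := (`[0%R, 1%R]%classic : set R).

Lemma dominated_Rint01 (F : nat -> R -> R) f (g : R -> R) :
  (forall n, measurable_fun I01 (F n)) -> measurable_fun I01 f -> integ01 g ->
  (forall u : R, 0 <= u <= 1 -> F n u @[n --> \oo] --> f u) ->
  (forall n (u : R), 0 <= u <= 1 -> `|F n u| <= g u) ->
  (\int[leb]_(u in I01) F n u)%R @[n --> \oo] --> (\int[leb]_(u in I01) f u)%R.
Proof.
move=> mF mf gi Ff Fg.
have mE (h : R -> R) : measurable_fun I01 h -> measurable_fun I01 (EFin \o h).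
  by move=> mh; exact/measurable_EFinP.
have c1 : {ae leb, forall u : R, I01 u -> (EFin \o F n) u @[n --> \oo] --> (EFin \o f) u}.
  by apply: aeW => u; rewrite in01 => u01; apply/cvg_EFin; [exact: nearW|exact: Ff].
have c2 : {ae leb, forall (u : R) n, I01 u -> (`|(EFin \o F n) u| <= (EFin \o g) u)%E}.
  by apply: aeW => u n; rewrite in01 => u01; rewrite lee_fin Fg.
have [fi _ h] := @dominated_convergence _ _ _ leb I01 (@measurable_I01 R)
  (fun n => EFin \o F n) (EFin \o f) (EFin \o g) (fun n => mE _ (mF n)) (mE _ mf) c1 gi c2.
have hfin := integrable_fin_num (@measurable_I01 R) fi.
by apply: fine_cvg; rewrite fineK.
Qed.

Lemma bump10E (c a b u : R) : bump c a b 1 0 u =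
  if a < u < b then expR (- (c * ((u - a) * (b - u))^-1)) else 0.
Proof. by rewrite /bump bquadE hornerC expr0 !mul1r. Qed.

Lemma bump10_01 (c a b u : R) : 0 <= c -> 0 <= bump c a b 1 0 u <= 1.
Proof.
move=> c0; rewrite bump10E; case: ifPn => [/andP[au ub]|_]; last by rewrite lexx ler01.
rewrite expR_ge0/= -expR0 ler_expR oppr_le0 mulr_ge0// invr_ge0 mulr_ge0// subr_ge0 ltW//.
Qed.

Lemma bump10_cvg (a b u : R) :
  bump j.+1%:R^-1 a b 1 0 u @[j --> \oo] --> (\1_(`]a, b[%classic : set R) u : R).
Proof.
rewrite indicE.
rewrite (_ : (fun j => _) = fun j => if a < u < b then expR (- (j.+1%:R^-1 * ((u - a) * (b -
  u))^-1)) else 0); last by apply/funext => j; rewrite bump10E.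
have -> : (u \in (`]a, b[%classic : set R)) = (a < u < b).
  by apply/idP/idP; rewrite inE /= in_itv.
case: (a < u < b); last exact: cvg_cst.
rewrite -[X in _ --> X]expR0; apply: (@cvg_comp _ _ _ _ expR); last exact: continuous_expR.
rewrite -oppr0; apply: cvgN; rewrite -[X in _ --> X](mul0r ((u - a) * (b - u))^-1).
by apply: cvgMl; exact: cvg_harmonic.
Qed.

Lemma bump_cont (c a b : R) p m : 0 < c -> a < b -> continuous (bump c a b p m).
Proof.
move=> c0 ab u; have [d _] := bump_is_derive c0 ab p m u.
exact/differentiable_continuous/derivable1_diffP.
Qed.

Lemma test_dot_itv0 f (a b : R) : L2 f -> 0 < a -> a < b -> b < 1 ->
  (forall G, test_function G -> dot f G = 0) -> (\int[leb]_(u in `]a, b[) f u)%R = 0.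
Proof.
move=> Lf a0 ab b1 f0.
have -> : (\int[leb]_(u in `]a, b[) f u)%R = (\int[leb]_(u in I01) (f u * \1_(`]a, b[%classic : set
  R) u))%R.
  have -> : (`]a, b[ : set R)%classic = I01 `&` `]a, b[.
    apply/seteqP; split=> u /=; rewrite !in_itv/=; last by case.
    by move=> /andP[au ub]; split; lra.
  rewrite Rintegral_mkcondr; apply: eq_Rint01 => u u01.
  have uI : u \in I01 by rewrite inE in01.
  by rewrite indicE patchE in_setI uI/=; case: ifP => _; rewrite ?mulr1 ?mulr0.
pose B j := bump j.+1%:R^-1 a b 1 0.
have Bc j : continuous (B j) by apply: bump_cont => //; rewrite invr_gt0.
have lim0 : (\int[leb]_(u in I01) (f u * B j u))%R @[j --> \oo] --> (0 : R).
  have -> : (fun j => (\int[leb]_(u in I01) (f u * B j u))%R) = cst 0.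
    by apply/funext => j; rewrite -/(dot f (B j)) f0//; apply: bump_test => //; rewrite invr_gt0.
  exact: cvg_cst.
have mI : measurable_fun I01 (\1_(`]a, b[%classic : set R) : R -> R) by exact: measurable_indic.
have lim1 := @dominated_Rint01 (fun j u => f u * B j u) (fun u => f u * \1_(`]a, b[%classic : set
  R) u)
  (fun u => `|f u|).
have {lim1} := lim1 _ _ _ _ _; move=> lim1.
apply: (cvg_unique _ (lim1 _ _ _ _ _) lim0) => //.
- by move=> j; apply: measurable_funM; [exact: Lf.1|apply: cont01_measurable;
    exact: continuous_cont01].
- by apply: measurable_funM; [exact: Lf.1|].
- have := L2_mul Lf (L2_cst 1); under eq_fun do rewrite mulr1; exact: integ01_abs.
- by move=> u u01; apply: cvgMr; exact: bump10_cvg.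
- move=> j u u01; rewrite normrM ler_piMr//.
  have /andP[h1 h2] : 0 <= B j u <= 1 by apply: bump10_01; rewrite invr_ge0.
  by rewrite ger0_norm.
Qed.

Lemma ae_notin_seq (s : seq R) : {ae leb, forall u : R, u \notin s}.
Proof.
have cs : countable [set` s] by exact/finite_set_countable/finite_seq.
exists [set` s]; split; first exact: countable_measurable.
  exact: countable_lebesgue_measure0.
by move=> u /= /negP; rewrite negbK.
Qed.

(** All integrals over intervals inside ]0, 1[ vanish, so the primitive is constant there; by
    Lebesgue differentiation its derivative is f almost everywhere. *)
Lemma test_dot_ae0 f : L2 f -> (forall G, test_function G -> dot f G = 0) ->
  f = (fun=> 0) %[ae leb in I01].
Proof.
move=> Lf f0; pose g : R -> R := f \_ I01.
have fi : integ01 f by have := L2_mul Lf (L2_cst 1); under eq_fun do rewrite mulr1.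
have gi : leb.-integrable setT (EFin \o g).
  by rewrite /g -restrict_EFin; apply/(integrable_mkcond _ _).1.
have giS (A : set R) : measurable A -> leb.-integrable A (EFin \o g).
  by move=> mA; apply: integrableS gi.
have gl : locally_integrable setT g by apply: integrable_locally => //; exact: openT.
have gint (a b : R) : 0 < a -> a < b -> b < 1 -> (\int[leb]_(u in `]a, b]) g u)%R = 0.
  move=> a0 ab b1; rewrite -Rintegral_itv_bndo_bndc; last exact: giS.
  rewrite -(test_dot_itv0 Lf a0 ab b1 f0); apply: eq_Rintegral => u;
    rewrite inE /= in_itv/= => /andP[au ub].
  by rewrite /g patchE mem_set//= in_itv/=; lra.
have gcst (x y : R) : 0 < x -> x < y -> y < 1 ->
    (\int[leb]_(t in `[0%R, x]) g t)%R = (\int[leb]_(t in `[0%R, y]) g t)%R.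
  move=> x0 xy y1; have := gint _ _ x0 xy y1.
  have x0' : ((BLeft 0 : itv_bound R) <= BRight x)%O by rewrite bnd_simp ltW.
  have xy' : ((BRight x : itv_bound R) <= BRight y)%O by rewrite bnd_simp ltW.
  rewrite -(@Rintegral_itvB R g (BLeft 0) (BRight y) x (giS _ (measurable_itv _)) x0' xy').
  by move/eqP; rewrite subr_eq0 => /eqP.
have := @FTC1 R g (BLeft 0) (fun y => giS _ (measurable_itv _)) gl.
have n01 := ae_notin_seq [:: 0; 1].
apply: (@filterS2 _ _ (ae_filter_ringOfSetsType leb)) n01 => u + h u01.
rewrite !inE negb_or => /andP[u0 u1].
have {u01} u01 : 0 < u < 1.
  by move: u01; rewrite /= in_itv/= !le_eqVlt eq_sym (negbTE u0) (negbTE u1).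
have /andP[{}u0 {}u1] := u01.
have [|dF FE] := h; first by rewrite lte_fin.
have <- : g u = f u by rewrite /g patchE mem_set//= in_itv/= !ltW.
rewrite -FE derive1E; apply: derive_val.
have : \forall y \near u, cst (\int[leb]_(t in `[0%R, u]) g t)%R y = (\int[leb]_(t in `[0%R, y]) g
  t)%R.
  near=> y; have y0 : 0 < y by near: y; exact: lt_nbhsr.
  have y1 : y < 1 by near: y; exact: lt_nbhsl.
  rewrite /cst; have [uy|yu|->//] := ltgtP u y.
  - by rewrite (gcst u y).
  - by rewrite (gcst y u).
by move=> /near_eq_is_derive; apply; exact: is_derive_cst.
Unshelve. all: by end_near. Qed.

End bump.

(** * L2 density of smooth functions that are flat at both ends *)

Section density.
Context {R : realType}.
Implicit Types (f H : R -> R).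
Local Notation leb := (@lebesgue_measure R).
Local Notation I01 := (`[0%R, 1%R]%classic : set R).

Lemma cvg_sumR (T I : Type) (F : set_system T) (r : seq I) (f : I -> T -> R) (l : I -> R) :
  Filter F -> (forall i, f i x @[x --> F] --> l i) ->
  (\sum_(i <- r) f i x) @[x --> F] --> \sum_(i <- r) l i.
Proof.
move=> FF fl; elim: r => [|i r IH].
  by rewrite big_nil; under eq_fun do rewrite big_nil; exact: cvg_cst.
by rewrite big_cons; under eq_fun do rewrite big_cons; exact: cvgD.
Qed.

Lemma cont01_unif f (eps : R) : cont01 f -> 0 < eps -> exists2 d : R, 0 < d &
  forall x y : R, 0 <= x <= 1 -> 0 <= y <= 1 -> `|x - y| < d -> `|f x - f y| < eps.
Proof.
move=> cf e0; pose g := f \o @clamp01 R; have cg : continuous g := cont01_clamp cf.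
have cI : compact I01 by exact: segment_compact.
pose P (d x : R) := forall y, `|x - y| < d -> `|g x - g y| < eps.
have : \forall d \near 0^'+, I01 `<=` P d.
  apply: ((compact_near_coveringP I01).1 cI R (0^'+) P _) => x xI.
  have /cvgrPdist_lt /(_ (eps / 2)) := cg x.
  rewrite divr_gt0// => /(_ isT) /nbhs_ballP[r /= r0 hr].
  exists (ball x (r / 2), [set d | 0 < d < r / 2]) => /=.
    split; first by apply: nbhsx_ballx; rewrite divr_gt0.
    near=> d; apply/andP; split; first by near: d; exact: nbhs_right_gt.
    by near: d; apply: nbhs_right_lt; rewrite divr_gt0.
  move=> [x' d] /= [xx' /andP[d0 dr]] y x'y.
  have h1 : `|g x - g x'| < eps / 2.
    by apply: hr; apply: le_ball xx'; rewrite ler_pdivrMr// ler_pMr// ler1n.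
  have h2 : `|g x - g y| < eps / 2.
    apply: hr; rewrite /ball/= (le_lt_trans (ler_distD x' _ _))// (splitr r) ltrD//.
    exact: lt_trans dr.
  by rewrite (le_lt_trans (ler_distD (g x) _ _))// (splitr eps) ltrD// distrC.
move=> hP; have [d [d0 dP]] : exists d : R, 0 < d /\ I01 `<=` P d.
  by apply: (@filter_ex _ (0^'+ : set_system R)); apply: filterI => //; exact: nbhs_right_gt.
exists d => // x y x01 y01 xy.
have := dP x; rewrite in01 => /(_ x01) /(_ y xy).
by rewrite /g /= !clamp01_id.
Unshelve. all: by end_near. Qed.

Lemma step_index (m : nat) (u : R) : 0 <= u < 1 -> (0 < m)%N -> 
  exists2 i : 'I_m, i%:R / m%:R <= u & u < i.+1%:R / m%:R.
Proof.
move=> /andP[u0 u1] m0; have m0' : 0 < m%:R :> R by rewrite ltr0n.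
have um : 0 <= u * m%:R by rewrite mulr_ge0// ltW.
have im : (Num.truncn (u * m%:R) < m)%N.
  by rewrite truncn_lt_nat// -[ltRHS]mul1r ltr_pM2r.
have /andP[h1 h2] := truncn_itv um.
by exists (Ordinal im); rewrite /= ?ler_pdivrMr ?ltr_pdivlMr.
Qed.

Lemma le_Rint01_ae f (c : R) : integ01 f -> 0 <= c -> (forall u : R, 0 <= u <= 1 -> 0 <= f u) ->
  {ae leb, forall u : R, I01 u -> f u <= c} -> (\int[leb]_(u in I01) f u)%R <= c.
Proof.
move=> fi c0 f0 fc.
have h : ((\int[leb]_(u in I01) (f u)%:E) <= \int[leb]_(u in I01) c%:E)%E.
  apply: ae_ge0_le_integral => //.
  exact: (measurable_int leb fi).
by rewrite -lee_fin -(Rint01_cst c) /Rintegral !fineK//;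
  [exact: integrable_fin_num (cont01_integ (continuous_cont01 (@cst_continuous _ _ c)))
  |exact: integrable_fin_num fi].
Qed.

Definition step_fun H m (B : nat -> R -> R) (u : R) : R := \sum_(k < m) H (k%:R / m%:R) * B k u.

(** Uniform continuity makes H close to a step function on m equal cells; replacing each indicator
    by a bump with small c costs little in L2 by dominated convergence. *)
Lemma bump_step_dense H (eps : R) : cont01 H -> 0 < eps ->
  exists (m : nat) (c : R), [/\ (0 < m)%N, 0 < c &
  let B k := bump c (k%:R / m%:R) (k.+1%:R / m%:R) 1 0 in
  dot (fun u => H u - step_fun H m B u) (fun u => H u - step_fun H m B u) < eps].
Proof.
move=> cH e0; have [M M0 HM] := cont01_bounded cH.
pose eta := Num.min 1 (eps / 2).
have eta0 : 0 < eta by rewrite lt_min ltr01 divr_gt0.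
have eta2 : eta ^+ 2 < eps.
  have : eta <= 1 by rewrite ge_min lexx.
  have : eta <= eps / 2 by rewrite ge_min lexx orbT.
  nra.
have [d d0 dH] := cont01_unif cH eta0.
have [m m0n md] : exists2 m, (0 < m)%N & m%:R^-1 < d.
  by exists (Num.truncn d^-1).+1 => //; rewrite invf_plt ?posrE// truncnS_gt.
have m0 : 0 < m%:R :> R by rewrite ltr0n.
have node01 (k : nat) : (k <= m)%N -> 0 <= (k%:R / m%:R : R) <= 1.
  by move=> km; rewrite divr_ge0//= ler_pdivrMr// mul1r ler_nat.
have node_lt (k : nat) : k%:R / m%:R < k.+1%:R / m%:R :> R by rewrite ltr_pM2r ?invr_gt0// ltr_nat.
pose chi (k : nat) : R -> R := \1_(`]k%:R / m%:R, k.+1%:R / m%:R[%classic : set R).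
pose B (j k : nat) := bump (j.+1%:R^-1 : R) (k%:R / m%:R) (k.+1%:R / m%:R) 1 0.
have chiE (k : nat) (u : R) : chi k u = (k%:R / m%:R < u < k.+1%:R / m%:R)%R%:R.
  by rewrite /chi indicE; congr (_ %:R); congr nat_of_bool; apply/idP/idP; rewrite inE /= in_itv.
have B01 (j k : nat) (u : R) : 0 <= B j k u <= 1 by apply: bump10_01; rewrite invr_ge0.
have cB (j k : nat) : continuous (B j k) by apply: bump_cont => //; rewrite invr_gt0.
have Bchi (k : nat) (u : R) : B j k u @[j --> \oo] --> chi k u by exact: bump10_cvg.
have mstep (F : nat -> R -> R) : (forall k, measurable_fun I01 (F k)) -> measurable_fun I01
  (step_fun H m F).
  by move=> mF; apply: measurable_sum => k; apply: measurable_funM.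
have mH := cont01_measurable cH.
have mB (j k : nat) : measurable_fun I01 (B j k) by apply: cont01_measurable;
  exact: continuous_cont01.
have mchi (k : nat) : measurable_fun I01 (chi k) by exact: measurable_indic.
have bstep (F : nat -> R -> R) (u : R) : (forall k, 0 <= F k u <= 1) -> `|step_fun H m F u| <= M *+
  m.
  move=> F01; apply: le_trans (ler_norm_sum _ _ _) _.
  rewrite -[X in M *+ X]card_ord -sumr_const ler_sum// => k _.
  have /andP[h1 h2] := F01 k.
  rewrite normrM -[M]mulr1 ler_pM//; last by rewrite ger0_norm.
  by apply: HM; apply: node01; exact/ltnW/ltn_ord.
have chi01 (k : nat) (u : R) : 0 <= chi k u <= 1 by rewrite chiE ler0n lern1 leq_b1.
have bH (F : nat -> R -> R) (u : R) : 0 <= u <= 1 -> (forall k, 0 <= F k u <= 1) ->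
    `|H u - step_fun H m F u| <= M + M *+ m.
  by move=> u01 F01; rewrite (le_trans (ler_normB _ _))// lerD ?HM ?bstep.
pose r (F : nat -> R -> R) u := (H u - step_fun H m F u) * (H u - step_fun H m F u).
have mr F : (forall k, measurable_fun I01 (F k)) -> measurable_fun I01 (r F).
  by move=> mF; apply: measurable_funM; apply: measurable_funB => //; exact: mstep.
have br F (u : R) : 0 <= u <= 1 -> (forall k, 0 <= F k u <= 1) -> `|r F u| <= (M + M *+ m) ^+ 2.
  by move=> u01 F01; rewrite /r normrM expr2 ler_pM// bH.
have lim : (\int[leb]_(u in I01) r (B j) u)%R @[j --> \oo] --> (\int[leb]_(u in I01) r chi u)%R.
  apply: (@dominated_Rint01 _ (fun j => r (B j)) _ (cst ((M + M *+ m) ^+ 2))) => //.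
  - by move=> j; exact: mr.
  - exact: mr.
  - by apply: cont01_integ; apply: continuous_cont01; exact: cst_continuous.
  - move=> u u01.
    have h : H u - step_fun H m (B j) u @[j --> \oo] --> H u - step_fun H m chi u.
      apply: cvgB; first exact: cvg_cst.
      apply: cvg_sumR => k; apply: cvgMr; exact: Bchi.
    exact: (cvgM h h).
  - by move=> j u u01; exact: br.
have small : (\int[leb]_(u in I01) r chi u)%R <= eta ^+ 2.
  apply: le_Rint01_ae.
  - by apply: (@bounded_integ01 _ _ ((M + M *+ m) ^+ 2)); [exact: mr|move=> u u01; exact: br].
  - exact: sqr_ge0.
  - by move=> u _; rewrite /r -expr2 sqr_ge0.
  (* The open cells miss the nodes. Off this finite set exactly one indicator equals 1, and the step
     function takes the value of H at the left end of the cell. *)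
  have := ae_notin_seq [seq (k%:R / m%:R : R) | k <- iota 0 m.+1].
  apply: (@filterS _ _ (ae_filter_ringOfSetsType leb)) => u unode; rewrite in01 => /andP[u0 u1].
  have notnode (k : nat) : (k <= m)%N -> u != k%:R / m%:R.
    move=> km; apply: contra unode => /eqP ->; apply/mapP; exists k => //.
    by rewrite mem_iota.
  have {u1} u1 : u < 1.
    by rewrite lt_neqAle u1 andbT -[X in _ != X](@divff _ m%:R) ?notnode// gt_eqF.
  have [|i iu ui] := @step_index m u _ m0n; first by rewrite u0.
  have {iu} iu : i%:R / m%:R < u by rewrite lt_neqAle iu eq_sym notnode// ltnW.
  rewrite /r; have -> : step_fun H m chi u = H (i%:R / m%:R).
    rewrite /step_fun (bigD1 i)//= chiE iu ui mulr1 big1 ?addr0// => k ki.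
    rewrite chiE (_ : (_ < u < _) = false) ?mulr0//; apply/negP => /andP[ku uk].
    move: ki; rewrite neq_ltn => /orP[ki|ki].
      have := lt_trans iu uk; rewrite ltr_pM2r ?invr_gt0// ltr_nat ltnS leqNgt.
      by rewrite (ki : (k < i)%N).
    have := lt_trans ku ui; rewrite ltr_pM2r ?invr_gt0// ltr_nat ltnS leqNgt.
    by rewrite (ki : (i < k)%N).
  rewrite -expr2 -real_normK ?num_real// ler_pXn2r ?nnegrE ?(ltW eta0)//.
  apply/ltW/dH; [by rewrite u0 ltW|by rewrite node01// ltnW|].
  rewrite ger0_norm ?subr_ge0 ?(ltW iu)//; apply: lt_trans md.
  by move: ui; rewrite -natr1 mulrDl mul1r; set x := m%:R^-1; lra.
have [j hj] : exists j, (\int[leb]_(u in I01) r (B j) u)%R < eps.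
  apply: (@filter_ex _ \oo); apply: cvgr_lt lim _ _.
  exact: le_lt_trans small eta2.
by exists m, j.+1%:R^-1; split => //; rewrite invr_gt0.
Qed.

Lemma deriv_sum_scale (m : nat) (c : nat -> R) (F F1 : nat -> R -> R) (u : R) :
  (forall k, is_derive u 1 (F k) (F1 k u)) ->
  is_derive u 1 (fun u => \sum_(k < m) c k * F k u) (\sum_(k < m) c k * F1 k u).
Proof.
move=> dF; elim: m => [|m IH].
  rewrite big_ord0 (_ : (fun u => _) = cst 0); first exact: is_derive_cst.
  by apply/funext => v; rewrite big_ord0.
rewrite big_ord_recr (_ : (fun u => _) = (fun u => \sum_(k < m) c k * F k u) + (c m *: F m)).
  by apply: is_deriveD.
by apply/funext => v; rewrite big_ord_recr.
Qed.

(** The approximants vanish at 0 and 1 together with their derivatives, so they satisfy every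
    boundary condition considered below. *)
Lemma smooth_dense H (eps : R) : cont01 H -> 0 < eps ->
  exists w w1 w2 : R -> R, [/\ forall u : R, is_derive u 1 w (w1 u),
    forall u : R, is_derive u 1 w1 (w2 u), continuous w2,
    [/\ w 0 = 0, w 1 = 0, w1 0 = 0 & w1 1 = 0] &
    dot (fun u => H u - w u) (fun u => H u - w u) < eps].
Proof.
move=> cH e0; have [m [c [m0 c0 h]]] := bump_step_dense cH e0.
have m0' : 0 < m%:R :> R by rewrite ltr0n.
pose a k : R := k%:R / m%:R; pose h' (k : nat) := H (a k).
have a_lt k : a k < a k.+1 by rewrite ltr_pM2r ?invr_gt0// ltr_nat.
pose p1 k := bump_next c (a k) (a k.+1) 1 0.
pose p2 k := bump_next c (a k) (a k.+1) (p1 k) 2.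
pose F k := bump c (a k) (a k.+1) 1 0; pose F1 k := bump c (a k) (a k.+1) (p1 k) 2.
pose F2 k := bump c (a k) (a k.+1) (p2 k) 4.
have out (G : nat -> R -> R) u : (u = 0 \/ u = 1) -> (forall k, (k < m)%N -> ~~ (a k < u < a k.+1)
  -> G k u = 0) ->
    \sum_(k < m) h' k * G k u = 0.
  move=> u01 G0; rewrite big1// => k _; rewrite G0 ?mulr0//; apply/negP.
  move=> /andP[ku uk]; case: u01 => uE; move: ku uk; rewrite uE.
    by rewrite ltNge /a divr_ge0.
  by move=> _; rewrite ltNge /a ler_pdivrMr// mul1r ler_nat ltn_ord.
have outb p q k u : ~~ (a k < u < a k.+1) -> bump c (a k) (a k.+1) p q u = 0.
  by rewrite /bump => /negbTE ->.
exists (fun u => \sum_(k < m) h' k * F k u), (fun u => \sum_(k < m) h' k * F1 k u),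
       (fun u => \sum_(k < m) h' k * F2 k u); split => //.
- by move=> u; apply: deriv_sum_scale => k; exact: bump_is_derive.
- by move=> u; apply: deriv_sum_scale => k; exact: bump_is_derive.
- move=> u; apply: cvg_sumR => k; apply: cvgMr; exact: bump_cont.
- by split; apply: out; (try by [left|right]) => k km; exact: outb.
Qed.

End density.

(** * The Green operator of the boundary value problem *)

Section cont_space.
Context {R : realType}.

Definition cont01_pred : {pred R -> R} := fun f => `[< cont01 f >].

Lemma cont01_cst (c : R) : cont01 (fun=> c).
Proof. by apply: continuous_cont01; exact: cst_continuous. Qed.

Lemma cont01D (f g : R -> R) : cont01 f -> cont01 g -> cont01 (fun u => f u + g u).
Proof. by move=> cf cg x; apply: cvgD; [exact: cf|exact: cg]. Qed.

Lemma cont01M (f g : R -> R) : cont01 f -> cont01 g -> cont01 (fun u => f u * g u).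
Proof. by move=> cf cg x; apply: cvgM; [exact: cf|exact: cg]. Qed.

Lemma cont01Z (c : R) (f : R -> R) : cont01 f -> cont01 (fun u => c * f u).
Proof. by move=> cf; apply: cont01M => //; exact: cont01_cst. Qed.

Lemma cont01B (f g : R -> R) : cont01 f -> cont01 g -> cont01 (fun u => f u - g u).
Proof. by move=> cf cg x; apply: cvgB; [exact: cf|exact: cg]. Qed.

Lemma eq_cont01 (f g : R -> R) : (forall u : R, 0 <= u <= 1 -> f u = g u) -> cont01 f -> cont01 g.
Proof. by move=> fg; apply: subspace_eq_continuous => u; rewrite inE in01 => u01; exact: fg. Qed.

Lemma cont01_abs (f : R -> R) : cont01 f -> cont01 (fun u => `|f u|).
Proof. by move=> cf x; apply: cvg_norm; exact: cf. Qed.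

Lemma cont01_submod : GRing.submod_closed cont01_pred.
Proof.
split=> [|a f g /asboolP cf /asboolP cg]; apply/asboolP; first exact: cont01_cst.
by apply: cont01D => //; exact: cont01Z.
Qed.
HB.instance Definition _ := GRing.isSubmodClosed.Build R (R -> R) cont01_pred cont01_submod.

(** The pre-Hilbert space of the spectral argument. Its elements are functions on the whole line, so
    two of them may agree on [0, 1] and still differ. *)
Record cont01_space := Cont01 { cval :> R -> R; cvalP : cval \in cont01_pred }.
HB.instance Definition _ := [isSub for cval].
HB.instance Definition _ := [Choice of cont01_space by <:].
HB.instance Definition _ := [SubChoice_isSubLmodule of cont01_space by <:].

Lemma cval_cont (f : cont01_space) : cont01 (cval f).
Proof. by case: f => f /= /asboolP. Qed.

Definition to_cont (f : R -> R) (cf : cont01 f) : cont01_space := Cont01 (asboolT cf).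

Definition cip (f g : cont01_space) : R := dot (cval f) (cval g).

Lemma cvalD (f g : cont01_space) : cval (f + g) = fun u => cval f u + cval g u.
Proof. by []. Qed.

Lemma cvalZ (a : R) (f : cont01_space) : cval (a *: f) = fun u => a * cval f u.
Proof. by []. Qed.

End cont_space.
Arguments cval_cont {R} f.

Section green.
Context {R : realType}.
Implicit Types (f g w z F G : R -> R).
Local Notation leb := (@lebesgue_measure R).
Local Notation I01 := (`[0%R, 1%R]%classic : set R).

Lemma is_derive_mulf f g (x df dg : R) : is_derive x 1 f df -> is_derive x 1 g dg ->
  is_derive x 1 (fun u => f u * g u) (f x * dg + df * g x).
Proof.
move=> hf hg; have h : is_derive x 1 (fun u => f u * g u) _ := is_deriveM hf hg.
by apply: (is_derive_eq h); rewrite /GRing.scale/= [g x * _]mulrC.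
Qed.

Lemma is_derive_addf f g (x df dg : R) : is_derive x 1 f df -> is_derive x 1 g dg ->
  is_derive x 1 (fun u => f u + g u) (df + dg).
Proof. by move=> hf hg; exact: is_deriveD. Qed.

Lemma is_derive_subf f g (x df dg : R) : is_derive x 1 f df -> is_derive x 1 g dg ->
  is_derive x 1 (fun u => f u - g u) (df - dg).
Proof. by move=> hf hg; exact: is_deriveB. Qed.

Lemma is_derive_scalef f (c x df : R) : is_derive x 1 f df ->
  is_derive x 1 (fun u => c * f u) (c * df).
Proof. by move=> hf; exact: is_deriveZ. Qed.

Definition norm2 f := Num.sqrt (dot f f).

Lemma norm2_ge0 f : 0 <= norm2 f. Proof. exact: sqrtr_ge0. Qed.

Lemma norm2_sqr f : norm2 f ^+ 2 = dot f f.
Proof. by rewrite sqr_sqrtr// dot_ge0. Qed.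

Lemma norm2_le f (c : R) : 0 <= c -> dot f f <= c ^+ 2 -> norm2 f <= c.
Proof. by move=> c0 h; rewrite -(ger0_norm c0) -sqrtr_sqr ler_wsqrtr. Qed.

Lemma norm2B f g : L2 f -> L2 g -> norm2 (fun u => f u - g u) <= norm2 f + norm2 g.
Proof.
move=> Lf Lg; apply: norm2_le; first by rewrite addr_ge0 ?norm2_ge0.
have Lfg := L2B Lf Lg.
rewrite dotBl// !dotBr// (dotC g f) sqrrD !norm2_sqr.
have := dot_CS_norm Lf Lg; rewrite -/(norm2 f) -/(norm2 g) ler_norml => /andP[h _].
move: h; lra.
Qed.

Lemma parts01 F f G g : deriv01 F f -> deriv01 G g -> cont01 f -> cont01 g ->
  dot F g + dot f G = F 1 * G 1 - F 0 * G 0.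
Proof.
move=> dF dG cf cg; have cF := deriv01_cont dF; have cG := deriv01_cont dG.
have dFG : deriv01 (fun u => F u * G u) (fun u => F u * g u + f u * G u).
  by move=> u u01; apply: is_derive_mulf; [exact: dF|exact: dG].
have cFG : cont01 (fun u => F u * g u + f u * G u) by apply: cont01D; exact: cont01M.
rewrite -(FTC01 (lexx _) ltr01 (lexx _) dFG cFG) /dot -RintegralD//.
  by apply: cont01_integ; exact: cont01M.
by apply: cont01_integ; exact: cont01M.
Qed.

(** The increment is the integral of [w1] over part of [0, 1]; Cauchy-Schwarz against the constant 1
    bounds it. *)
Lemma deriv01_osc w w1 (x y : R) : deriv01 w w1 -> cont01 w1 -> 0 <= x <= 1 -> 0 <= y <= 1 ->
  `|w x - w y| <= norm2 w1.
Proof.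
move=> dw cw; wlog xy : x y / x < y.
  move=> h x01 y01; have [xy|yx|->] := ltgtP x y; first exact: h.
    by rewrite distrC; exact: h.
  by rewrite subrr normr0 norm2_ge0.
move=> /andP[x0 x1] /andP[y0 y1].
rewrite distrC -(FTC01 x0 xy y1 dw cw).
have xyI : `[x, y] `<=` I01.
  by move=> u /=; rewrite !in_itv/= => /andP[xu uy]; rewrite (le_trans x0) ?(le_trans uy).
have wi : integ01 w1 := cont01_integ cw.
have wxy : leb.-integrable `[x, y] (EFin \o w1).
  by apply: integrableS wi => //; exact: measurable_itv.
apply: le_trans (le_normr_Rintegral _ wxy) _; first exact: measurable_itv.
have ai := integ01_abs wi.
apply: (@le_trans _ _ (\int[leb]_(u in I01) `|w1 u|)%R).
  apply: fine_le.
  - apply: integrable_fin_num; [exact: measurable_itv|exact: integrable_norm].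
  - exact: integrable_fin_num ai.
  - apply: ge0_subset_integral => //; exact: measurable_int ai.
have L1 := cont01_L2 cw.
have := dot_abs_le L1 (L2_cst 1); rewrite (eq_Rint01 (g := fun u => `|w1 u|)); last first.
  by move=> u _; rewrite mulr1.
by move=> /le_trans; apply; rewrite /dot mul1r Rint01_cst sqrtr1 mulr1.
Qed.

Lemma cont01_mean w : cont01 w -> exists2 c : R, 0 <= c <= 1 & `|w c| <= norm2 w.
Proof.
move=> cw; have [c c01 hc] := EVT_min (@ler01 R) (cont01_abs cw).
rewrite in_itv in c01; exists c => //.
rewrite -sqrtr_sqr ler_wsqrtr// -(Rint01_cst (w c ^+ 2)).
apply: le_Rint01.
- by apply: cont01_integ; exact: cont01_cst.
- by apply: cont01_integ; exact: cont01M.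
move=> u u01; rewrite -expr2 -[w c ^+ 2]real_normK ?num_real// -[w u ^+ 2]real_normK ?num_real//.
by rewrite ler_pXn2r ?nnegrE//; apply: hc; rewrite in_itv.
Qed.

(** One-dimensional Sobolev bound: |w| at its minimum is at most its L2 norm, and the oscillation is
    at most the norm of the derivative. *)
Lemma sup_le_H1 w w1 (x : R) : deriv01 w w1 -> cont01 w1 -> 0 <= x <= 1 ->
  `|w x| <= norm2 w + norm2 w1.
Proof.
move=> dw cw x01; have [c c01 hc] := cont01_mean (deriv01_cont dw).
have := deriv01_osc dw cw x01 c01 => h.
rewrite -[w x](subrK (w c)) addrC (le_trans (ler_normD _ _))// lerD//.
Qed.

Lemma lipschitz_cont01 f (L : R) :
  (forall u v : R, 0 <= u <= 1 -> 0 <= v <= 1 -> `|f u - f v| <= L * `|u - v|) -> cont01 f.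
Proof.
move=> fL; apply: (@eq_cont01 _ (f \o @clamp01 R)).
  by move=> u u01 /=; rewrite clamp01_id.
apply: continuous_cont01 => x; apply/cvgrPdist_lt => e e0.
have L0 : 0 < `|L| + 1 by rewrite ltr_wpDl.
near=> y; have h : `|clamp01 x - clamp01 y| < e / (`|L| + 1).
  near: y; have /cvgrPdist_lt := @clamp01_continuous R x; apply.
  by rewrite divr_gt0.
apply: le_lt_trans (fL _ _ (clamp01_in x) (clamp01_in y)) _.
rewrite ltr_pdivlMr// mulrC in h; apply: le_lt_trans h.
by rewrite ler_wpM2r// (le_trans (ler_norm L))// lerDl.
Unshelve. all: by end_near. Qed.

Lemma grid_index (m : nat) (u : R) : 0 <= u <= 1 -> (0 < m)%N ->
  exists2 i : 'I_m.+1, 0 <= (i%:R / m%:R : R) <= 1 & `|u - i%:R / m%:R| <= m%:R^-1.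
Proof.
move=> /andP[u0 u1] m0; have m0' : 0 < m%:R :> R by rewrite ltr0n.
have iP (i : 'I_m.+1) : 0 <= (i%:R / m%:R : R) <= 1.
  by rewrite divr_ge0//= ler_pdivrMr// mul1r ler_nat -ltnS.
have [->|un1] := eqVneq u 1.
  exists ord_max => //=; have -> : m%:R / m%:R = 1 :> R by rewrite divff// gt_eqF.
    by rewrite lexx ler01.
  by rewrite subrr normr0 invr_ge0 ltW.
have [|i iu ui] := @step_index R m u _ m0; first by rewrite u0 lt_neqAle un1.
exists (widen_ord (leqnSn m) i) => //=; move: ui; rewrite -natr1 mulrDl mul1r => ui.
  exact: iP (widen_ord (leqnSn m) i).
by rewrite ger0_norm ?subr_ge0//; move: ui; set q := m%:R^-1; lra.
Qed.

Section boundary.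
Context (gam a : R).
Hypotheses (gam0 : 0 <= gam) (a0 : 0 <= a) (gama : 0 < gam + a).

(* (gam, a) = (1, alpha), (1, 0), (0, 1): Robin, Neumann and periodic conditions for w, w1 = w'. *)
Definition boundary w w1 := w1 0 = w1 1 /\ gam * w1 0 = a * (w 0 - w 1).

(** Integrating w w'' by parts leaves minus this product as boundary term, so its sign is what makes
    the Laplacian nonpositive in each regime. *)
Lemma boundary_sign w w1 : boundary w w1 -> 0 <= w1 0 * (w 0 - w 1).
Proof.
case=> _ h; have [g0|g0] := eqVneq gam 0.
  have a1 : a != 0 by move: gama; rewrite g0 add0r => /gt_eqF ->.
  have : w 0 - w 1 = 0 by apply: (mulfI a1); rewrite -h g0 mul0r mulr0.
  by move=> ->; rewrite mulr0.
have {}g0 : 0 < gam by rewrite lt_def g0.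
by rewrite -(pmulr_rge0 _ g0) mulrA h -mulrA mulr_ge0// -expr2 sqr_ge0.
Qed.

Lemma boundary_cross w w1 z z1 : boundary w w1 -> boundary z z1 ->
  w1 0 * (z 0 - z 1) = z1 0 * (w 0 - w 1).
Proof.
case=> _ hw [_ hz]; have [g0|g0] := eqVneq gam 0.
  have a1 : a != 0 by move: gama; rewrite g0 add0r => /gt_eqF ->.
  have -> : w 0 - w 1 = 0 by apply: (mulfI a1); rewrite -hw g0 mul0r mulr0.
  have -> : z 0 - z 1 = 0 by apply: (mulfI a1); rewrite -hz g0 mul0r mulr0.
  by rewrite !mulr0.
by apply: (mulfI g0); rewrite !mulrA hw hz; ring.
Qed.

Lemma boundary_sym w w1 w2 z z1 z2 : deriv01 w w1 -> deriv01 w1 w2 -> cont01 w2 ->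
  deriv01 z z1 -> deriv01 z1 z2 -> cont01 z2 -> boundary w w1 -> boundary z z1 ->
  dot w2 z = dot w z2.
Proof.
move=> dw dw1 cw2 dz dz1 cz2 bw bz.
have h1 := parts01 dw dz1 (deriv01_cont dw1) cz2.
have h2 := parts01 dw1 dz cw2 (deriv01_cont dz1).
have h3 := boundary_cross bw bz; have [e1 _] := bw; have [e2 _] := bz.
by move: h1 h2 h3; rewrite -e1 -e2; lra.
Qed.

Lemma boundary_energy w w1 w2 : deriv01 w w1 -> deriv01 w1 w2 -> cont01 w2 -> boundary w w1 ->
  dot w w + dot w1 w1 <= dot w (fun u => w u - w2 u).
Proof.
move=> dw dw1 cw2 bw; have Lw := cont01_L2 (deriv01_cont dw); have Lw2 := cont01_L2 cw2.
rewrite dotBr// lerD2l.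
have := parts01 dw dw1 (deriv01_cont dw1) cw2.
have := boundary_sign bw; case: bw => <- _; lra.
Qed.

(** For f = w - w'' the energy inequality bounds w and w' in L2 by N, and w'' = w - f by 2 N. The
    suprema follow from [sup_le_H1] applied to w and to w', whence the factors 2 and 3. *)
Lemma boundary_bounds w w1 w2 : deriv01 w w1 -> deriv01 w1 w2 -> cont01 w2 -> boundary w w1 ->
  let N := norm2 (fun u => w u - w2 u) in
  [/\ norm2 w <= N, norm2 w1 <= N,
     forall x : R, 0 <= x <= 1 -> `|w x| <= 2 * N & forall x : R, 0 <= x <= 1 -> `|w1 x| <= 3 * N].
Proof.
move=> dw dw1 cw2 bw N; have Lw := cont01_L2 (deriv01_cont dw); have Lw2 := cont01_L2 cw2.
have Lf := L2B Lw Lw2.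
have en := boundary_energy dw dw1 cw2 bw.
have cs : dot w (fun u => w u - w2 u) <= norm2 w * N := le_trans (ler_norm _) (dot_CS_norm Lw Lf).
have X0 := norm2_ge0 w; have Y0 := norm2_ge0 w1; have N0 : 0 <= N := norm2_ge0 _.
have XE := norm2_sqr w; have YE := norm2_sqr w1.
have XN : norm2 w <= N by nra.
have YN : norm2 w1 <= N by rewrite -(@ler_pXn2r _ 2) ?nnegrE//; nra.
have w2N : norm2 w2 <= 2 * N.
  have -> : norm2 w2 = norm2 (fun u => w u - (w u - w2 u)).
    by rewrite /norm2; congr Num.sqrt; apply: eq_dot => u _; ring.
  by apply: le_trans (norm2B Lw Lf) _; rewrite -/N; lra.
split=> // x x01.
  by apply: le_trans (sup_le_H1 dw (deriv01_cont dw1) x01) _; lra.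
by apply: le_trans (sup_le_H1 dw1 cw2 x01) _; lra.
Qed.

(** Variation of constants: [p] is the convolution of f with sinh, a solution of p'' = p + f with p
    0 = p' 0 = 0, and two exponentials are added to meet the boundary conditions. *)
Lemma green_exists f : cont01 f -> exists w w1,
  [/\ deriv01 w w1, deriv01 w1 (fun u => w u - f u) & boundary w w1].
Proof.
move=> cf; pose e (u : R) := expR u; pose d (u : R) := expR (- u).
have de (u : R) : is_derive u 1 e (e u) by exact: is_derive_expR.
have dd (u : R) : is_derive u 1 d (- d u).
  by rewrite -mulrN1; apply: (is_derive1_comp (is_derive_expR _)); apply: is_deriveNid.
have ed u : e u * d u = 1 by rewrite /e /d expRN divff// expR_eq0.
have ce : cont01 e by apply: continuous_cont01; exact: continuous_expR.
have cd : cont01 d by apply: deriv01_cont (fun u _ => dd u).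
have [P [P0 dP]] := cont01_primitive (cont01M cd cf).
have [Q [Q0 dQ]] := cont01_primitive (cont01M ce cf).
pose p u := 2^-1 * (e u * P u - d u * Q u); pose p1 u := 2^-1 * (e u * P u + d u * Q u).
have E1 : 1 < e 1 by rewrite /e expR_gt1.
have D1 : d 1 < 1 by rewrite /d expR_lt1 oppr_lt0.
set E := e 1 in E1; set D := d 1 in D1.
(* Up to sign, the determinant of the two linear equations that the boundary conditions impose on A
   and B. It is positive because E > 1 > D and gam + a > 0. *)
pose det := gam * (E - D) + 2 * a * (E - 1) * (1 - D).
have det0 : det != 0.
  rewrite gt_eqF//; have X0 : 0 < (E - 1) * (1 - D) by rewrite mulr_gt0 ?subr_gt0.
  rewrite /det -mulrA; have [g1|g1] := eqVneq gam 0.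
    move: gama; rewrite g1 add0r => a1; rewrite mul0r add0r -mulrA.
    by rewrite mulr_gt0// mulr_gt0.
  apply: ltr_wpDr; first by rewrite mulr_ge0 ?(ltW X0)// mulr_ge0.
  apply: mulr_gt0; first by rewrite lt_def g1.
  by rewrite subr_gt0; exact: lt_trans E1.
pose A := (p1 1 * (gam + a * (1 - D)) + a * p 1 * (1 - D)) / det.
pose B := (p1 1 * (gam + a * (E - 1)) - a * p 1 * (E - 1)) / det.
pose w u := A * e u + B * d u - p u; pose w1 u := A * e u - B * d u - p1 u.
exists w, w1; split.
- move=> u u01.
  have h : is_derive u 1 w _ := is_derive_subf (is_derive_addf (is_derive_scalef A (de u))
    (is_derive_scalef B (dd u)))
    (is_derive_scalef 2^-1 (is_derive_subf (is_derive_mulf (de u) (dP u u01)) (is_derive_mulf (dd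
      u) (dQ u u01)))).
  apply: (is_derive_eq h); rewrite /w1 /p1; have := ed u; nra.
- move=> u u01.
  have h : is_derive u 1 w1 _ := is_derive_subf (is_derive_subf (is_derive_scalef A (de u))
    (is_derive_scalef B (dd u)))
    (is_derive_scalef 2^-1 (is_derive_addf (is_derive_mulf (de u) (dP u u01)) (is_derive_mulf (dd
      u) (dQ u u01)))).
  apply: (is_derive_eq h); rewrite /w /p !mulrA [d u * e u]mulrC !ed; lra.
- have e0 : e 0 = 1 by rewrite /e expR0.
  have d0 : d 0 = 1 by rewrite /d oppr0 expR0.
  have w0 : w 0 = A + B by rewrite /w /p P0 Q0 e0 d0; ring.
  have w10 : w1 0 = A - B by rewrite /w1 /p1 P0 Q0 e0 d0; ring.
  rewrite /boundary w0 w10 /w /w1 -/E -/D /A /B.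
  move: (p1 1) (p 1) det0; rewrite /det => x y hd.
  by split; field.
Qed.

Definition green_pair (f : cont01_space) : (R -> R) * (R -> R) :=
  xget (fun=> 0, fun=> 0) [set p | [/\ deriv01 p.1 p.2,
    deriv01 p.2 (fun u => p.1 u - cval f u) & boundary p.1 p.2]].

Local Notation gw f := (green_pair f).1.
Local Notation gw1 f := (green_pair f).2.

Lemma green_pairP (f : cont01_space) : [/\ deriv01 (gw f) (gw1 f),
  deriv01 (gw1 f) (fun u => gw f u - cval f u) & boundary (gw f) (gw1 f)].
Proof.
have [w [w1 h]] := green_exists (cval_cont f).
exact: (@xgetPex _ (fun=> 0, fun=> 0) [set p | [/\ deriv01 p.1 p.2,
    deriv01 p.2 (fun u => p.1 u - cval f u) & boundary p.1 p.2]] (ex_intro _ (w, w1) h)).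
Qed.

Lemma deriv01_lin (c : R) F f G g : deriv01 F f -> deriv01 G g ->
  deriv01 (fun u => c * F u + G u) (fun u => c * f u + g u).
Proof.
move=> dF dG u u01; apply: is_derive_addf; last exact: dG.
by apply: is_derive_scalef; exact: dF.
Qed.

Lemma boundary_lin (c : R) w w1 z z1 : boundary w w1 -> boundary z z1 ->
  boundary (fun u => c * w u + z u) (fun u => c * w1 u + z1 u).
Proof.
move=> [h1 h2] [h3 h4]; split; first by rewrite h1 h3.
by rewrite mulrDr mulrCA h2 h4; ring.
Qed.

Lemma gw_cont2 (f : cont01_space) : cont01 (fun u => gw f u - cval f u).
Proof.
have [dw _ _] := green_pairP f.
by apply: cont01B; [exact: deriv01_cont dw|exact: cval_cont].
Qed.

Arguments gw_cont2 : clear implicits.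

Lemma gw_bounds (f : cont01_space) (x : R) : 0 <= x <= 1 ->
  `|gw f x| <= 2 * norm2 (cval f) /\ `|gw1 f x| <= 3 * norm2 (cval f).
Proof.
move=> x01; have [dw dw1 bw] := green_pairP f.
have [_ _ h1 h2] := boundary_bounds dw dw1 (gw_cont2 f) bw.
have <- : norm2 (fun u => gw f u - (gw f u - cval f u)) = norm2 (cval f).
  by rewrite /norm2; congr Num.sqrt; apply: eq_dot => u _; ring.
by split; [exact: h1|exact: h2].
Qed.

Lemma boundary_unique w w1 z z1 f : cont01 f -> deriv01 w w1 -> deriv01 w1 (fun u => w u - f u) ->
  boundary w w1 -> deriv01 z z1 -> deriv01 z1 (fun u => z u - f u) -> boundary z z1 ->
  forall x, 0 <= x <= 1 -> w x = z x.
Proof.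
move=> cf dw dw1 bw dz dz1 bz x x01.
have d1 := deriv01_lin (-1) dw dz; have d2 := deriv01_lin (-1) dw1 dz1.
have b := boundary_lin (-1) bw bz.
have cw := deriv01_cont dw; have cz := deriv01_cont dz.
have c2 : cont01 (fun u => -1 * (w u - f u) + (z u - f u)).
  by apply: cont01D; [apply: cont01Z|]; exact: cont01B.
have [_ _ /(_ x x01) + _] := boundary_bounds d1 d2 c2 b.
set N := norm2 _; have -> : N = 0.
  rewrite /N /norm2 (eq_dot (f' := fun=> 0) (g' := fun=> 0)) ?dot0l ?sqrtr0//.
    by move=> u _; ring.
  by move=> u _; ring.
by rewrite mulr0 normr_le0 mulN1r addrC subr_eq0 => /eqP.
Qed.

Lemma restrict01_cont f : cont01 f -> cont01 (fun u => if 0 <= u <= 1 then f u else 0).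
Proof. by apply: eq_cont01 => u ->. Qed.

(* Setting the solution to 0 off [0, 1] makes it unique, hence linear in f. *)
Definition green (f : cont01_space) : cont01_space :=
  to_cont (restrict01_cont (deriv01_cont (let: And3 d _ _ := green_pairP f in d))).

Lemma greenE (f : cont01_space) (u : R) : 0 <= u <= 1 -> cval (green f) u = gw f u.
Proof. by rewrite /green /= => ->. Qed.

Lemma green_of_deriv (f : cont01_space) w w1 : deriv01 w w1 ->
  deriv01 w1 (fun u => w u - cval f u) -> boundary w w1 ->
  forall u, 0 <= u <= 1 -> cval (green f) u = w u.
Proof.
move=> dw dw1 bw u u01; rewrite greenE//; have [dg dg1 bg] := green_pairP f.
exact: (boundary_unique (cval_cont f) dg dg1 bg dw dw1 bw u01).
Qed.

Lemma green_linear (c : R) (f g : cont01_space) : green (c *: f + g) = c *: green f + green g.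
Proof.
apply/val_inj/funext => u.
change (cval (green (c *: f + g)) u = c * cval (green f) u + cval (green g) u); rewrite /green /=.
case: ifPn => [u01|_]; last by rewrite mulr0 addr0.
have [df df1 bf] := green_pairP f; have [dg dg1 bg] := green_pairP g.
have [dh dh1 bh] := green_pairP (c *: f + g).
have dfg1 : deriv01 (fun u => c * gw1 f u + gw1 g u)
    (fun u => (c * gw f u + gw g u) - cval (c *: f + g) u).
  move=> v v01; apply: (is_derive_eq (deriv01_lin c df1 dg1 v01)).
  by rewrite cvalD cvalZ; ring.
exact: (boundary_unique (cval_cont _) dh dh1 bh (deriv01_lin c df dg) dfg1 (boundary_lin c bf bg)
  u01).
Qed.

Lemma eq_cip_green (f : cont01_space) (h : R -> R) : dot (cval (green f)) h = dot (gw f) h.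
Proof. by apply: eq_dot => // u u01; rewrite greenE. Qed.

Lemma green_sym (f g : cont01_space) : cip (green f) g = cip f (green g).
Proof.
rewrite /cip eq_cip_green dotC [RHS]dotC eq_cip_green dotC.
have [df df1 bf] := green_pairP f; have [dg dg1 bg] := green_pairP g.
have h := boundary_sym df df1 (gw_cont2 f) dg dg1 (gw_cont2 g) bf bg.
have Lf := cont01_L2 (cval_cont f); have Lg := cont01_L2 (cval_cont g).
have Lwf := cont01_L2 (deriv01_cont df); have Lwg := cont01_L2 (deriv01_cont dg).
by move: h; rewrite dotBl// dotBr// (dotC (cval f)); lra.
Qed.

Lemma green_energy (f : cont01_space) : dot (gw f) (gw f) + dot (gw1 f) (gw1 f) <= cip (green f) f.
Proof.
rewrite /cip eq_cip_green; have [df df1 bf] := green_pairP f.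
apply: le_trans (boundary_energy df df1 (gw_cont2 f) bf) _.
by rewrite le_eqVlt; apply/orP; left; apply/eqP; apply: eq_dot => // u _; ring.
Qed.

Lemma green_pos (f : cont01_space) : 0 <= cip (green f) f.
Proof. by apply: le_trans (green_energy f); rewrite addr_ge0 ?dot_ge0. Qed.

Lemma green_le (f : cont01_space) : cip (green f) f <= cip f f.
Proof.
have en := green_energy f; have h : cip (green f) f <= norm2 (gw f) * norm2 (cval f).
  rewrite /cip eq_cip_green; have [df _ _] := green_pairP f.
  exact: le_trans (ler_norm _) (dot_CS_norm (cont01_L2 (deriv01_cont df)) (cont01_L2 (cval_cont
    f))).
have := norm2_sqr (gw f); have := norm2_sqr (cval f); rewrite -/(cip f f).
have := dot_ge0 (gw1 f); have := norm2_ge0 (gw f); have := norm2_ge0 (cval f).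
nra.
Qed.

(** Arzela-Ascoli along an ultrafilter: the images are bounded by 2 and 3-Lipschitz, the pointwise
    limits inherit the Lipschitz bound, and a finite grid upgrades pointwise to uniform
    closeness. *)
Lemma green_ultracompact : ultracompact cip green.
Proof.
move=> f f1 U UU.
have N1 n : norm2 (cval (f n)) <= 1 by apply: norm2_le; rewrite ?expr1n//; exact: f1.
have fb n (u : R) : `|cval (green (f n)) u| <= 2.
  rewrite /green /=; case: ifPn => [u01|_]; last by rewrite normr0.
  by have [h _] := gw_bounds (f n) u01; have := N1 n; lra.
have flip n (u v : R) : 0 <= u <= 1 -> 0 <= v <= 1 ->
    `|cval (green (f n)) u - cval (green (f n)) v| <= 3 * `|u - v|.
  wlog uv : u v / u <= v.
    move=> h u01 v01; have [uv|/ltW vu] := leP u v; first exact: h.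
    by rewrite distrC [`|u - v|]distrC; exact: h.
  move=> u01 v01; rewrite !greenE//; have [dw _ _] := green_pairP (f n).
  have sub x : x \in `]u, v[ -> 0 <= x <= 1.
    rewrite in_itv/= => /andP[ux xv]; move: u01 v01 => /andP[? ?] /andP[? ?].
    by rewrite (@le_trans _ _ u) ?(ltW ux)// (@le_trans _ _ v) ?(ltW xv).
  have cwuv : {within `[u, v], continuous (gw (f n))}.
    by apply: cont01_sub (deriv01_cont dw); [case/andP: u01|case/andP: v01].
  rewrite distrC; have [|c cuv ->] := @MVT_segment R (gw (f n)) (gw1 (f n)) u v uv _ cwuv.
    by move=> x /sub /dw.
  have c01 : 0 <= c <= 1.
    move: cuv u01 v01; rewrite in_itv/= => /andP[uc cv] /andP[u0 _] /andP[_ v1].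
    by rewrite (le_trans u0)// (le_trans cv).
  rewrite normrM [`|v - u|]distrC ler_wpM2r//.
  by have [_ h] := gw_bounds (f n) c01; have := N1 n; lra.
have pw (u : R) := ultra_bounded_cvg UU (fun n => fb n u).
have [G GP] := choice pw.
have near2 (u v e : R) : 0 < e -> exists n, `|cval (green (f n)) u - G u| < e /\ `|cval (green (f
  n)) v - G v| < e.
  by move=> e0; apply: (@filter_ex _ U); apply: filterI; exact: GP.
have Glip (u v : R) : 0 <= u <= 1 -> 0 <= v <= 1 -> `|G u - G v| <= 3 * `|u - v|.
  move=> u01 v01; apply/ler_addgt0Pr => e e0.
  have [n [h1 h2]] := near2 u v (e / 2) (divr_gt0 e0 (ltr0Sn _ _)).
  have := flip n u v u01 v01; move: h1 h2.
  move: (cval _ u) (cval _ v) => x y h1 h2 h3.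
  have -> : G u - G v = (x - y) - (x - G u) + (y - G v) by ring.
  apply: le_trans (ler_normD _ _) _; have := ler_normB (x - y) (x - G u); lra.
exists (to_cont (lipschitz_cont01 Glip)) => eps eps0.
pose eta := Num.min 1 (eps / 2).
have eta0 : 0 < eta by rewrite lt_min ltr01 divr_gt0.
have eta2 : eta ^+ 2 < eps.
  have : eta <= 1 by rewrite ge_min lexx.
  have : eta <= eps / 2 by rewrite ge_min lexx orbT.
  nra.
(* Moving to the nearest grid point costs 3 / m < eta / 3 for the image and again for the limit;
   comparing both at the grid point costs eta / 9. *)
have [m m0 md] : exists2 m, (0 < m)%N & m%:R^-1 < eta / 9.
  exists (Num.truncn (eta / 9)^-1).+1 => //; rewrite invf_plt ?posrE ?divr_gt0//.
  exact: truncnS_gt.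
have : U [set n | forall i : 'I_m.+1, `|cval (green (f n)) (i%:R / m%:R) - G (i%:R / m%:R)| < eta /
  9].
  by apply: filter_forall => i; apply: GP; rewrite divr_gt0.
apply: filterS => n hn /=; apply: le_lt_trans eta2.
rewrite /cip expr2; apply: le_trans (ler_norm _) _; apply: Rint01_le_sup.
  by apply: cont01_measurable; apply: cont01M; exact: cval_cont.
have key (u : R) : 0 <= u <= 1 -> `|cval (green (f n)) u - G u| <= eta.
  move=> u01; have [i i01 ui] := grid_index u01 m0.
  have h1 := flip n _ _ u01 i01; have h2 := Glip _ _ u01 i01; have h3 := hn i.
  set y := cval (green (f n)) (i%:R / m%:R) in h1 h3; set x := cval (green (f n)) u in h1 *.
  have -> : x - G u = (x - y) + (y - G (i%:R / m%:R)) - (G u - G (i%:R / m%:R)) by ring.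
  have := ler_normB (x - y + (y - G (i%:R / m%:R))) (G u - G (i%:R / m%:R)).
  have := ler_normD (x - y) (y - G (i%:R / m%:R)).
  move: ui md; set q := m%:R^-1; lra.
move=> u u01; rewrite normrM.
by apply: ler_pM => //; exact: key.
Qed.

Lemma green_positive_compact : positive_compact cip green.
Proof.
split; [exact: green_linear|exact: green_sym|exact: green_pos| |exact: green_ultracompact].
by exists 1 => f; rewrite mul1r green_le.
Qed.

End boundary.
End green.

(** * Eigenfunctions *)

Section modes.
Context {R : realType}.
Implicit Types (f g w z F G H : R -> R).
Local Notation leb := (@lebesgue_measure R).
Local Notation I01 := (`[0%R, 1%R]%classic : set R).

Lemma deriv01_MVT F f (x y : R) : deriv01 F f -> 0 <= x -> x <= y -> y <= 1 ->
  exists2 c, x <= c <= y & F y - F x = f c * (y - x).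
Proof.
move=> dF x0 xy y1.
have [|c] := @MVT_segment R F f x y xy _ (cont01_sub x0 y1 (deriv01_cont dF)).
  move=> u; rewrite in_itv/= => /andP[xu uy]; apply: dF.
  by rewrite (le_trans x0 (ltW xu)) (le_trans (ltW uy) y1).
by rewrite in_itv; exists c.
Qed.

(** The primitive of f^2 is nondecreasing with equal end values, so the mean value theorem yields a
    zero of f near any x, which uniform continuity excludes when f x is nonzero. *)
Lemma cont01_dot0 f : cont01 f -> dot f f = 0 -> forall x, 0 <= x <= 1 -> f x = 0.
Proof.
move=> cf f0 x /andP[x0 x1]; apply/eqP/negPn/negP => fx.
have c2 : cont01 (fun u => f u * f u) by exact: cont01M.
have [F [_ dF]] := cont01_primitive c2.
have F01 : F 1 - F 0 = 0.
  by rewrite -(FTC01 (lexx _) ltr01 (lexx _) dF c2).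
have mono (p q : R) : 0 <= p -> p <= q -> q <= 1 -> F p <= F q.
  move=> p0 pq q1; have [c _ h] := deriv01_MVT dF p0 pq q1.
  by rewrite -subr_ge0 h mulr_ge0 ?subr_ge0// -expr2 sqr_ge0.
have nfx : 0 < `|f x| / 2 by rewrite divr_gt0// normr_gt0.
have [d d0 dP] := cont01_unif cf nfx.
pose p := Num.max 0 (x - d / 2); pose q := Num.min 1 (x + d / 2).
have p0 : 0 <= p by rewrite le_max lexx.
have q1 : q <= 1 by rewrite ge_min lexx.
have px : p <= x by rewrite ge_max x0/=; lra.
have xq : x <= q by rewrite le_min x1/=; lra.
have pd : x - d / 2 <= p by rewrite le_max lexx orbT.
have qd : q <= x + d / 2 by rewrite ge_min lexx orbT.
have pq : p < q.
  rewrite lt_neqAle (le_trans px xq) andbT; apply/eqP => pq.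
  have xp : x = p by apply/le_anti; rewrite px pq xq.
  have : p = 0 \/ q = 1.
    have [|h] := leP x (d / 2); first by move=> h; left; rewrite /p max_l//; lra.
    right; move: xp pq; rewrite /p; case: (leP 0 (x - d / 2)); lra.
  move: xp pq; rewrite /p /q; case: (leP 0 (x - d / 2)); case: (leP 1 (x + d / 2)); lra.
have [c /andP[pc cq] h] := deriv01_MVT dF p0 (ltW pq) q1.
have fc : f c = 0.
  have h1 := mono 0 p (lexx _) p0 (le_trans (ltW pq) q1).
  have h2 := mono q 1 (le_trans p0 (ltW pq)) q1 (lexx _).
  have : F q - F p <= 0 by lra.
  rewrite h pmulr_lle0 ?subr_gt0// -expr2 => fc.
  by apply/eqP; rewrite -sqrf_eq0 eq_le fc sqr_ge0.
have := dP x c; rewrite x0 x1 fc subr0 (le_trans p0 pc) (le_trans cq q1) => /(_ isT isT).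
have -> : `|x - c| < d by rewrite ltr_norml; lra.
by move=> /(_ isT); have := normr_ge0 (f x); lra.
Qed.

(** An eigenfunction of the Green operator is only controlled on [0, 1]; solving the Cauchy problem
    on the line provides its extension. *)
Lemma oscillator_exists (nu A B : R) : 0 <= nu -> exists e e1 : R -> R,
  [/\ forall u : R, is_derive u 1 e (e1 u), forall u : R, is_derive u 1 e1 (- nu * e u), e 0 = A &
    e1 0 = B].
Proof.
rewrite le_eqVlt => /predU1P[<-|nu0].
  exists (fun u => A + B * u), (fun=> B); split; rewrite ?mulr0 ?addr0//.
  - move=> u; have h := is_derive_addf (is_derive_cst A u 1) (is_derive_scalef B (is_derive_id u
      1)).
    by apply: (is_derive_eq h); rewrite add0r mulr1.
  - by move=> u; rewrite oppr0 mul0r; exact: is_derive_cst.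
pose om := Num.sqrt nu; have om0 : 0 < om by rewrite sqrtr_gt0.
have om2 : om * om = nu by rewrite -expr2 sqr_sqrtr// ltW.
have dom (u : R) : is_derive u 1 (fun u => om * u) om.
  by apply: (is_derive_eq (is_derive_scalef om (is_derive_id u 1))); rewrite mulr1.
have ds (u : R) : is_derive u 1 (fun u => sin (om * u)) (cos (om * u) * om).
  exact: (is_derive1_comp (is_derive_sin _) (dom u)).
have dc (u : R) : is_derive u 1 (fun u => cos (om * u)) (- sin (om * u) * om).
  exact: (is_derive1_comp (is_derive_cos _) (dom u)).
exists (fun u => A * cos (om * u) + B / om * sin (om * u)),
       (fun u => - (A * om) * sin (om * u) + B * cos (om * u)); split.
- move=> u; apply: (is_derive_eq (is_derive_addf (is_derive_scalef A (dc u)) (is_derive_scalef (B /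
    om) (ds u)))).
  by field; rewrite gt_eqF.
- move=> u; apply: (is_derive_eq (is_derive_addf (is_derive_scalef (- (A * om)) (ds u))
    (is_derive_scalef B (dc u)))).
  by rewrite -om2; field; rewrite gt_eqF.
- by rewrite mulr0 cos0 sin0 mulr1 mulr0 addr0.
- by rewrite mulr0 cos0 sin0 mulr1 mulr0 add0r.
Qed.

Lemma oscillator_energy (nu : R) F F1 (u : R) :
  is_derive u 1 F (F1 u) -> is_derive u 1 F1 (- nu * F u) ->
  is_derive u 1 (fun u => F1 u * F1 u + nu * (F u * F u)) 0.
Proof.
move=> h1 h2.
apply: (is_derive_eq (is_derive_addf (is_derive_mulf h2 h2) (is_derive_scalef nu (is_derive_mulf h1
  h1)))).
ring.
Qed.

Lemma deriv01_const F : deriv01 F (fun=> 0) -> forall x, 0 <= x <= 1 -> F x = F 0.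
Proof.
move=> dF x /andP[x0 x1]; have [c _] := deriv01_MVT dF (lexx _) x0 x1.
by rewrite mul0r => /eqP; rewrite subr_eq0 => /eqP.
Qed.

(** The energy F'^2 + nu F^2 is conserved and starts at 0. For nu = 0 it controls only F', so F
    itself is recovered as a constant equal to its initial value. *)
Lemma oscillator_unique01 (nu : R) F F1 : 0 <= nu -> deriv01 F F1 -> deriv01 F1 (fun u => - nu * F
  u) ->
  F 0 = 0 -> F1 0 = 0 -> forall x, 0 <= x <= 1 -> F x = 0 /\ F1 x = 0.
Proof.
move=> nu0 dF dF1 F0 F10.
have E0 x : 0 <= x <= 1 -> F1 x * F1 x + nu * (F x * F x) = 0.
  move=> x01; rewrite (deriv01_const (F := fun u => F1 u * F1 u + nu * (F u * F u)) _ x01).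
    by rewrite F0 F10 !mulr0 addr0.
  by move=> u u01; apply: oscillator_energy; [exact: dF|exact: dF1].
have F1x x : 0 <= x <= 1 -> F1 x = 0.
  move=> x01; apply/eqP; rewrite -sqrf_eq0 eq_le sqr_ge0 andbT -(E0 x x01) expr2 lerDl.
  by rewrite mulr_ge0// -expr2 sqr_ge0.
move=> x x01; split; last exact: F1x.
rewrite (deriv01_const (F := F) _ x01)// => u u01.
by rewrite -(F1x u u01); exact: dF.
Qed.

Lemma oscillator_unique (nu : R) F F1 : 0 <= nu -> (forall u : R, is_derive u 1 F (F1 u)) ->
  (forall u : R, is_derive u 1 F1 (- nu * F u)) -> F 0 = 0 -> F1 0 = 0 -> forall x, F x = 0.
Proof.
move=> nu0 dF dF1 F0 F10.
have E0 x : F1 x * F1 x + nu * (F x * F x) = 0.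
  have h := is_derive_0_is_cst x 0 (fun u => oscillator_energy (dF u) (dF1 u)).
  by rewrite h F0 F10 !mulr0 addr0.
have F1x x : F1 x = 0.
  apply/eqP; rewrite -sqrf_eq0 eq_le sqr_ge0 andbT -(E0 x) expr2 lerDl.
  by rewrite mulr_ge0// -expr2 sqr_ge0.
have dF0 (u : R) : is_derive u 1 F 0 by rewrite -(F1x u); exact: dF.
by move=> x; rewrite (is_derive_0_is_cst x 0 dF0).
Qed.

(** The difference F (u + 1) - F u solves the same equation with zero Cauchy data at 0. *)
Lemma oscillator_periodic (nu : R) F F1 : 0 <= nu -> (forall u : R, is_derive u 1 F (F1 u)) ->
  (forall u : R, is_derive u 1 F1 (- nu * F u)) -> F 1 = F 0 -> F1 1 = F1 0 -> periodic1 F.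
Proof.
move=> nu0 dF dF1 F10 F110 x.
have sh (G g : R -> R) (u : R) : (forall u : R, is_derive u 1 G (g u)) ->
    is_derive u 1 (fun u => G (u + 1)) (g (u + 1)).
  move=> dG; have h : is_derive u 1 (fun u : R => u + 1) 1.
    by apply: (is_derive_eq (is_derive_addf (is_derive_id u (1 : R)) (is_derive_cst (1 : R) u (1 :
      R)))); rewrite addr0.
  have := @is_derive1_comp R G (fun u : R => u + 1) u _ _ (dG (u + 1)) h.
  by rewrite mulr1.
have d1 (u : R) := is_derive_subf (sh _ _ u dF) (dF u).
have d2 (u : R) : is_derive u 1 (fun u => F1 (u + 1) - F1 u) (- nu * (F (u + 1) - F u)).
  by apply: (is_derive_eq (is_derive_subf (sh _ _ u dF1) (dF1 u))); ring.
have := oscillator_unique nu0 d1 d2 _ _ x.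
rewrite !add0r F10 F110 !subrr => /(_ erefl erefl)/eqP.
by rewrite subr_eq0 => /eqP.
Qed.

(* Zero members are allowed: deflation goes on producing vectors after it has exhausted the operator. *)
Definition orthosystem (e : nat -> R -> R) := [/\ forall k, L2 (e k),
  forall k, dot (e k) (e k) = 1 \/ e k = (fun=> 0) & forall i j, i != j -> dot (e i) (e j) = 0].

Section ortho.
Context (e : nat -> R -> R).
Hypothesis eo : orthosystem e.

Definition combo (N : nat) (b : nat -> R) (u : R) : R := \sum_(k < N) b k * e k u.

Local Lemma eL2 k : L2 (e k). Proof. by case: eo. Qed.

Lemma combo_L2 N b : L2 (combo N b).
Proof. by apply: (@L2_sum R 'I_N _ (fun k u => b k * e k u)) => k; apply: L2Z; exact: eL2. Qed.

Lemma dot_combo N b f : L2 f -> dot f (combo N b) = \sum_(k < N) b k * dot f (e k).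
Proof.
move=> Lf; rewrite /combo (@dot_sumr R 'I_N _ (fun k u => b k * e k u))//.
  by apply: eq_bigr => k _; rewrite dotZr//; exact: eL2.
by move=> k; apply: L2Z; exact: eL2.
Qed.

Lemma dot_combo_mode N b (k : nat) : dot (e k) (combo N b) = if (k < N)%N then b k * dot (e k) (e
  k) else 0.
Proof.
have [_ _ ort] := eo; rewrite dot_combo; last exact: eL2.
case: ifPn => [kN|kN].
  rewrite (bigD1 (Ordinal kN))//= big1 ?addr0// => i ik; rewrite ort ?mulr0//.
  by rewrite eq_sym.
rewrite big1// => i _; rewrite ort ?mulr0//.
by apply: contraNneq kN => ->; exact: ltn_ord.
Qed.

Lemma mode_norm_le k : dot (e k) (e k) <= 1.
Proof. by have [_ h _] := eo; case: (h k) => ->; rewrite ?dot0l. Qed.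

Lemma dot_combo_self N b : dot (combo N b) (combo N b) = \sum_(k < N) b k ^+ 2 * dot (e k) (e k).
Proof.
rewrite dot_combo; last exact: combo_L2.
apply: eq_bigr => k _; rewrite dotC dot_combo_mode ltn_ord; ring.
Qed.

Lemma combo_norm_le N b : dot (combo N b) (combo N b) <= \sum_(k < N) b k ^+ 2.
Proof.
rewrite dot_combo_self; apply: ler_sum => k _.
by rewrite ler_piMr ?sqr_ge0 ?mode_norm_le.
Qed.

(** Stands for normalisation in a form valid for unit members and zero members alike. *)
Lemma mode_coef f k : L2 f -> dot f (e k) * dot (e k) (e k) = dot f (e k).
Proof.
have [_ h _] := eo; case: (h k) => ek Lf; first by rewrite ek mulr1.
by rewrite ek dotC !dot0l mul0r.
Qed.

Lemma proj_best N b f : L2 f ->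
  dot (fun u => f u - combo N (fun k => dot f (e k)) u) (fun u => f u - combo N (fun k => dot f (e
    k)) u)
  <= dot (fun u => f u - combo N b u) (fun u => f u - combo N b u).
Proof.
move=> Lf; set c := fun k => dot f (e k).
have ex d : dot (fun u => f u - combo N d u) (fun u => f u - combo N d u) =
    dot f f + \sum_(k < N) ((d k ^+ 2) * dot (e k) (e k) - 2 * d k * c k).
  have Ld := combo_L2 N d; have Lfd := L2B Lf Ld.
  rewrite dotBl// !dotBr// (dotC (combo N d) f) dot_combo// dot_combo_self big_split/= sumrN.
  under [X in _ = _ + (_ - X)]eq_bigr => k _ do rewrite -mulrA.
  rewrite -mulr_sumr; ring.
rewrite !ex lerD2l; apply: ler_sum => k _.
have := mode_coef k Lf; have := mode_norm_le k; have := dot_ge0 (e k); rewrite -/(c k).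
have [_ h _] := eo; case: (h k) => ek.
  by rewrite ek !mulr1 => _ _ _; have := sqr_ge0 (b k - c k); rewrite sqrrB; lra.
by rewrite ek dot0l => _ _; rewrite mulr0 => <-; rewrite !mulr0.
Qed.

Lemma bessel N f : L2 f -> \sum_(k < N) dot f (e k) ^+ 2 <= dot f f.
Proof.
move=> Lf; set c := fun k => dot f (e k).
have Lc := combo_L2 N c; have Lfc := L2B Lf Lc.
have := dot_ge0 (fun u => f u - combo N c u).
rewrite dotBl// !dotBr// (dotC (combo N c) f) dot_combo_self dot_combo//.
under [X in _ - (_ - X)]eq_bigr => k _ do rewrite expr2 -mulrA mode_coef//.
under eq_bigr => k _ do rewrite -expr2.
by rewrite subrr subr0 subr_ge0.
Qed.

End ortho.

Section eigenmodes.
Context (gam a : R).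
Hypotheses (gam0 : 0 <= gam) (a0 : 0 <= a) (gama : 0 < gam + a).

(** The modes live on the whole line, because the test functions of the periodic formulation do; the
    boundary conditions, orthogonality and density concern [0, 1] only. *)
Record eigenmodes (e e1 : nat -> R -> R) (nu : nat -> R) : Prop := Eigenmodes {
  mode_deriv : forall k (u : R), is_derive u 1 (e k) (e1 k u);
  mode_deriv2 : forall k (u : R), is_derive u 1 (e1 k) (- nu k * e k u);
  mode_nu : forall k, 0 <= nu k;
  mode_boundary : forall k, boundary gam a (e k) (e1 k);
  mode_periodic : gam = 0 -> forall k, periodic1 (e k);
  mode_ortho : orthosystem e;
  mode_dense : forall H (eps : R), cont01 H -> 0 < eps -> exists N b,
    dot (fun u => H u - combo e N b u) (fun u => H u - combo e N b u) < eps }.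

Lemma is_derive_cont F (f : R -> R) : (forall u : R, is_derive u 1 F (f u)) -> continuous F.
Proof. by move=> dF u; have [d _] := dF u; exact/differentiable_continuous/derivable1_diffP. Qed.

(** With w = green E = lam E one has w'' = w - E = - (1 / lam - 1) w, so nu = 1 / lam - 1. The
    oscillator with the Cauchy data of w / lam at 0 agrees with E on [0, 1] and extends it. *)
Lemma oscillator_of_green (E : cont01_space) (lam : R) : 0 < lam <= 1 ->
  (forall u : R, 0 <= u <= 1 -> cval (green gam0 a0 gama E) u = lam * cval E u) ->
  exists e e1 : R -> R, [/\ forall u : R, is_derive u 1 e (e1 u),
    forall u : R, is_derive u 1 e1 (- (lam^-1 - 1) * e u), boundary gam a e e1,
    gam = 0 -> periodic1 e & forall u : R, 0 <= u <= 1 -> e u = cval E u].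
Proof.
move=> /andP[lam0 lam1] KE.
have [dw dw1 bw] := green_pairP gam0 a0 gama E.
set w := (green_pair gam a E).1 in dw dw1 bw; set w1 := (green_pair gam a E).2 in dw dw1 bw.
have wE u : 0 <= u <= 1 -> w u = lam * cval E u by move=> u01; rewrite -KE// greenE.
set nu := lam^-1 - 1; have nu0 : 0 <= nu by rewrite subr_ge0 invf_ge1.
have [e [e1 [de de1 ee0 ee1]]] := oscillator_exists (lam^-1 * w 0) (lam^-1 * w1 0) nu0.
pose d u := lam^-1 * w u - e u; pose d1 u := lam^-1 * w1 u - e1 u.
have dd : deriv01 d d1.
  by move=> u u01; apply: is_derive_subf => //; apply: is_derive_scalef; exact: dw.
have dd1 : deriv01 d1 (fun u => - nu * d u).
  move=> u u01; apply: (is_derive_eq (is_derive_subf (is_derive_scalef lam^-1 (dw1 u u01)) (de1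
    u))).
  have -> : cval E u = lam^-1 * w u by rewrite wE// mulKf// gt_eqF.
  by rewrite /d /nu; ring.
have hz := oscillator_unique01 nu0 dd dd1 _ _.
have {hz} hz u : 0 <= u <= 1 -> lam^-1 * w u = e u /\ lam^-1 * w1 u = e1 u.
  move=> u01; have [] := hz _ _ u u01; rewrite /d /d1 ?ee0 ?ee1 ?subrr//.
  by move=> /eqP + /eqP; rewrite !subr_eq0 => /eqP -> /eqP ->.
have be : boundary gam a e e1.
  have h0 := hz 0; have h1 := hz 1; rewrite !lexx ler01 in h0 h1.
  have [h00 h01] := h0 isT; have [h10 h11] := h1 isT.
  case: bw => b1 b2; split; first by rewrite -h01 -h11 b1.
  by rewrite -h01 -h00 -h10 mulrCA b2; ring.
exists e, e1; split => //.
  move=> g0; case: be => b1 b2; apply: (oscillator_periodic nu0 de de1) => //.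
  have a1 : a != 0 by move: gama; rewrite g0 add0r => /gt_eqF ->.
  apply/esym/eqP; rewrite -subr_eq0; apply/eqP/(mulfI a1).
  by rewrite -b2 g0 mul0r mulr0.
by move=> u u01; have [<- _] := hz u u01; rewrite wE// mulKf// gt_eqF.
Qed.

Lemma cipDl (f g h : @cont01_space R) : cip (f + g) h = cip f h + cip g h.
Proof. by rewrite /cip cvalD dotDl//; apply: cont01_L2; exact: cval_cont. Qed.

Lemma cipZl c (f h : @cont01_space R) : cip (c *: f) h = c * cip f h.
Proof. by rewrite /cip cvalZ dotZl//; apply: cont01_L2; exact: cval_cont. Qed.

Lemma cipC (f g : @cont01_space R) : cip f g = cip g f.
Proof. exact: dotC. Qed.

Lemma cip_ge0 (f : @cont01_space R) : 0 <= cip f f.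
Proof. exact: dot_ge0. Qed.

Lemma cval_sum (I : Type) (r : seq I) (F : I -> @cont01_space R) :
  cval (\sum_(i <- r) F i) = fun u => \sum_(i <- r) cval (F i) u.
Proof.
elim: r => [|i r IH]; apply/funext => u; rewrite ?big_nil//.
by rewrite !big_cons cvalD IH.
Qed.

Lemma dot_add_le f g : L2 f -> L2 g ->
  dot (fun u => f u + g u) (fun u => f u + g u) <= 2 * (dot f f + dot g g).
Proof.
move=> Lf Lg; have := dot_ge0 (fun u => f u - g u).
have Ls := L2D Lf Lg; have Lm := L2B Lf Lg.
rewrite dotBl// !dotBr// dotDl// !dotDr// (dotC g f); lra.
Qed.

Lemma eigenmodes_exist : exists e e1 nu, eigenmodes e e1 nu.
Proof.
pose K := green gam0 a0 gama.
have [E [lam [lam0 E1 Eo Enull Edense]]] :=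
  spectral_decomposition cipDl cipZl cipC cip_ge0 (green_positive_compact gam0 a0 gama).
have KE k (u : R) : 0 <= u <= 1 -> cval (K (E k)) u = lam k * cval (E k) u.
  move=> u01; apply/eqP; rewrite -subr_eq0; apply/eqP.
  exact: (cont01_dot0 (cval_cont (K (E k) - lam k *: E k)) (Enull k) u01).
have lam1 k : lam k <= 1.
  case: (E1 k) => [[e1 l0]|[_ ->]] //.
  have := green_le gam0 a0 gama (E k).
  suff -> : cip (K (E k)) (E k) = lam k * cip (E k) (E k) by rewrite e1 mulr1.
  rewrite -cipZl; apply: eq_dot => // u u01; exact: KE.
(* A vanishing eigenvector is turned into the zero mode with nu = 0, for which every clause is
   trivial. *)
have step k : exists t : (R -> R) * (R -> R) * R, [/\ forall u : R, is_derive u 1 t.1.1 (t.1.2 u),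
    forall u : R, is_derive u 1 t.1.2 (- t.2 * t.1.1 u), 0 <= t.2,
    boundary gam a t.1.1 t.1.2 & [/\ gam = 0 -> periodic1 t.1.1,
    cip (E k) (E k) = 1 \/ t.1.1 = (fun=> 0) &
    forall u : R, 0 <= u <= 1 -> t.1.1 u = cval (E k) u]].
  have [[e1 l0]|[e0 l0]] := E1 k; last first.
    exists ((fun=> 0), (fun=> 0), 0) => /=; split => //.
    - by move=> u; exact: is_derive_cst.
    - by move=> u; rewrite mulr0; exact: is_derive_cst.
    - by split; rewrite // subrr !mulr0.
    by split => //; [by right|rewrite e0].
  have [|e [e1' [de de1 be pe eE]]] := oscillator_of_green _ (KE k); first by rewrite l0 lam1.
  exists ((e, e1'), (lam k)^-1 - 1) => /=; split => //.
    by rewrite subr_ge0 invf_ge1.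
  by split => //; left.
have [t tP] := choice step.
pose e k := (t k).1.1; pose e1 k := (t k).1.2; pose nu k := (t k).2.
have eE k (u : R) : 0 <= u <= 1 -> e k u = cval (E k) u.
  by have [_ _ _ _ [_ _ h]] := tP k; exact: h.
have de k (u : R) : is_derive u 1 (e k) (e1 k u) by have [h _ _ _ _] := tP k; exact: h.
have Le k : L2 (e k) by apply: cont01_L2; apply: continuous_cont01; exact: is_derive_cont (de k).
have eo : orthosystem e.
  split => // [k|i j ij].
    have [_ _ _ _ [_ [h|h] _]] := tP k; last by right.
    by left; rewrite -h; apply: eq_dot; exact: eE.
  by rewrite -(Eo i j ij); apply: eq_dot; exact: eE.
exists e, e1, nu; split => //.
- by move=> k u; have [_ h _ _ _] := tP k; exact: h.
- by move=> k; have [_ _ h _ _] := tP k.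
- by move=> k; have [_ _ _ h _] := tP k.
- by move=> g0 k; have [_ _ _ _ [h _ _]] := tP k; exact: h.
move=> H eps cH eps0.
have [w [w1 [w2 [dw dw1 cw2 [w00 w01 w10 w11] wH]]]] := smooth_dense cH (divr_gt0 eps0 (ltr0Sn R
  3)).
have cw := continuous_cont01 (is_derive_cont dw); have cw2' := continuous_cont01 cw2.
(* As w meets the boundary conditions, it is the Green image of g = w - w''; the spectral truncation
   of this image is a combination of modes. The two errors of eps / 4 add up to less than eps
   through [dot_add_le]. *)
pose g := to_cont (cont01B cw cw2').
have Kg (u : R) : 0 <= u <= 1 -> cval (K g) u = w u.
  apply: (green_of_deriv gam0 a0 gama (w1 := w1)).
  - by move=> v _; exact: dw.
  - by move=> v _; apply: (is_derive_eq (dw1 v)); rewrite /g /=; ring.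
  - by split; rewrite ?w00 ?w01 ?w10 ?w11 ?subrr ?mulr0.
pose X := cip g g + 1; have X0 : 0 < X by rewrite ltr_wpDl// cip_ge0.
pose d := Num.min 1 (eps / (4 * X)).
have d0 : 0 < d by rewrite lt_min ltr01 divr_gt0// mulr_gt0.
have [N NP] := Edense d d0; pose b k := lam k * cip g (E k).
exists N, b; have {NP} NP := NP g; cbv zeta in NP.
have rE (u : R) : 0 <= u <= 1 -> cval (K g - \sum_(k < N) (lam k * cip g (E k)) *: E k) u = w u -
  combo e N b u.
  move=> u01; change (cval (K g) u - cval (\sum_(k < N) (lam k * cip g (E k)) *: E k) u = w u -
    combo e N b u).
  rewrite Kg// cval_sum /combo; congr (_ - _); apply: eq_bigr => k _.
  by rewrite cvalZ eE.
have rsmall : dot (fun u => w u - combo e N b u) (fun u => w u - combo e N b u) < eps / 4.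
  rewrite -(eq_dot rE rE); apply: le_lt_trans NP _.
  have : d <= 1 by rewrite ge_min lexx.
  have : d * (4 * X) <= eps by rewrite -ler_pdivlMr ?mulr_gt0// ge_min lexx orbT.
  have := cip_ge0 g; rewrite /X; set Y := cip g g; nra.
have LH := cont01_L2 cH; have Lw := cont01_L2 cw; have Lc := combo_L2 eo N b.
have -> : dot (fun u => H u - combo e N b u) (fun u => H u - combo e N b u) =
   dot (fun u => (H u - w u) + (w u - combo e N b u)) (fun u => (H u - w u) + (w u - combo e N b
     u)).
  by apply: eq_dot => u _; ring.
apply: le_lt_trans (dot_add_le (L2B LH Lw) (L2B Lw Lc)) _; lra.
Qed.

End eigenmodes.
End modes.

(** * Coefficients of weak solutions *)

Section weak_notions.
Context {R : realType}.
Implicit Types (f g F G H : R -> R).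
Local Notation leb := (@lebesgue_measure R).
Local Notation I01 := (`[0%R, 1%R]%classic : set R).

Lemma test_function_deriv G : test_function G -> forall u : R, is_derive u 1 G ((G^`())%classic u).
Proof.
move=> [dG _] u; have := dG 0%N u; rewrite derive1n0 => d.
by apply: DeriveDef => //; rewrite derive1E.
Qed.

Lemma test_function_cont G : test_function G -> cont01 G /\ cont01 (G^`())%classic.
Proof.
move=> tG; split.
  by apply: continuous_cont01; apply: is_derive_cont (test_function_deriv tG).
apply: continuous_cont01 => u; have [dG _] := tG.
by have := dG 1%N u; rewrite derive1n1 => /derivable1_diffP/differentiable_continuous.
Qed.

(** [H1norm] uses a chosen weak derivative; this makes the norm computable from any other one. *)
Lemma weak_derivative_unique f g g' : is_weak_derivative f g -> is_weak_derivative f g' ->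
  dot g g = dot g' g'.
Proof.
move=> [Lg hg] [Lg' hg'].
have ae0 : (fun u => g u - g' u) = (fun=> 0) %[ae leb in I01].
  apply: test_dot_ae0; first exact: L2B.
  move=> G tG; have [cG _] := test_function_cont tG; have LG := cont01_L2 cG.
  rewrite dotBl// (dotC g) (dotC g').
  by have := hg G tG; rewrite hg'// => /oppr_inj ->; rewrite subrr.
have ae : g = g' %[ae leb in I01].
  apply: (@filterS _ _ (ae_filter_ringOfSetsType leb)) ae0 => u /= h u01.
  by have /eqP := h u01; rewrite subr_eq0 => /eqP.
by rewrite (eq_ae_dot Lg Lg' Lg ae) dotC (eq_ae_dot Lg Lg' Lg' ae).
Qed.

Lemma H1normE f g : is_weak_derivative f g -> H1norm f = Num.sqrt (dot f f + dot g g).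
Proof.
move=> fg; rewrite /H1norm; congr Num.sqrt; congr (_ + _).
apply: (weak_derivative_unique _ fg).
exact: (@xgetPex _ (fun=> 0) [set g | is_weak_derivative f g] (ex_intro _ g fg)).
Qed.

Lemma ae_eq_cont01 f g : cont01 f -> cont01 g -> f = g %[ae leb in I01] ->
  forall x, 0 <= x <= 1 -> f x = g x.
Proof.
move=> cf cg fg x x01; apply/eqP; rewrite -subr_eq0; apply/eqP.
have Lf := cont01_L2 cf; have Lg := cont01_L2 cg; have Lfg := L2B Lf Lg.
apply: (cont01_dot0 (cont01B cf cg) _ x01).
by rewrite dotBl// (eq_ae_dot Lf Lg Lfg fg) subrr.
Qed.

Lemma traceE f (x : R) : cont01 f -> 0 <= x <= 1 -> trace f x = f x.
Proof.
move=> cf x01; have ff : cont01 f /\ f = f %[ae leb in I01] by split => //; exact: aeW.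
have [cc fc] := @xgetPex _ (fun=> 0) [set c : R -> R | {within `[0, 1], continuous c} /\
                          f = c %[ae leb in `[0%R, 1%R]%classic]] (ex_intro _ f ff).
by rewrite /trace /continuous_representative -(ae_eq_cont01 cf cc fc).
Qed.

Lemma is_derive_derivative_on (A : set R) F f : (forall u : R, is_derive u 1 F (f u)) ->
  derivative_on A F f.
Proof.
move=> dF x Ax; have /is_derive1_caratheodory [g [gE gc <-]] := dF x.
apply: (@cvg_trans _ (g y @[y --> within A x^'])); last first.
  apply: (@cvg_trans _ (g y @[y --> x])); last exact: gc.
  by move=> B /= Bx; rewrite /nbhs/= /within/= /dnbhs /within/=; apply: filterS Bx => y By _.
apply: near_eq_cvg.
have : within A x^' [set y | y != x].
  by change (nbhs x [set y | y != x -> A y -> y != x]);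
    exact: filterS (fun y _ yx _ => yx) (@filterT _ (nbhs x) _).
by apply: filterS => y yx /=; rewrite gE mulfK// subr_eq0.
Qed.

Section modes_tests.
Context (gam a : R) (e e1 : nat -> R -> R) (nu : nat -> R).
Hypothesis em : eigenmodes gam a e e1 nu.

Lemma mode_cont k : continuous (e k). Proof. exact: is_derive_cont (mode_deriv em k). Qed.
Lemma mode_cont1 k : continuous (e1 k). Proof. exact: is_derive_cont (mode_deriv2 em k). Qed.
Lemma mode_cont01 k : cont01 (e k) /\ cont01 (e1 k).
Proof. by split; apply: continuous_cont01; [exact: mode_cont|exact: mode_cont1]. Qed.

Lemma mode_L2 k : L2 (e k). Proof. by case: (mode_ortho em). Qed.

Lemma mode_C12 (T : R) (S : set R) k : is_C12 T S (fun s u => expR (nu k * s) * e k u)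
  (fun s u => nu k * (expR (nu k * s) * e k u)) (fun s u => expR (nu k * s) * e1 k u)
  (fun s u => expR (nu k * s) * (- nu k * e k u)).
Proof.
have ds (c s : R) : is_derive s 1 (fun s => expR (nu k * s) * c) (nu k * (expR (nu k * s) * c)).
  have d1 : is_derive s 1 (fun s => nu k * s) (nu k).
    by apply: (is_derive_eq (is_derive_scalef (nu k) (is_derive_id s 1))); rewrite mulr1.
  have d2 := is_derive1_comp (is_derive_expR (nu k * s)) d1.
  have d3 : is_derive s 1 (fun s => expR (nu k * s) * c) _ := is_derive_mulf d2 (is_derive_cst c s
    1).
  by apply: (is_derive_eq d3); rewrite mulr0 add0r /=; ring.
have cexp : continuous (fun s => expR (nu k * s)).
  move=> s; apply: (@continuous_comp _ _ _ (fun s => nu k * s) expR); last exact: continuous_expR.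
  exact: mulrl_continuous.
have prod (f : R -> R) : continuous f -> continuous (fun p : R * R => expR (nu k * p.1) * f p.2).
  move=> cf p; apply: cvgM.
    by apply: (@continuous_comp _ _ _ fst (fun s => expR (nu k * s))); [exact: cvg_fst|exact: cexp].
  by apply: (@continuous_comp _ _ _ snd f); [exact: cvg_snd|exact: cf].
split.
- by move=> u _; apply: is_derive_derivative_on => s; exact: ds.
- move=> t _; apply: is_derive_derivative_on => u; apply: is_derive_scalef;
    exact: mode_deriv em k u.
- move=> t _; apply: is_derive_derivative_on => u; apply: is_derive_scalef;
    exact: mode_deriv2 em k u.
- move=> F hF; apply: continuous_subspaceT; case: hF => ->.
  + by apply: prod; exact: mode_cont.
  + move=> p; apply: cvgM; first exact: cvg_cst.
    by apply: prod; exact: mode_cont.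
  + by apply: prod; exact: mode_cont1.
  + by apply: (prod (fun u => - nu k * e k u)) => u; apply: cvgM; [exact: cvg_cst|exact: mode_cont].
Qed.

(** Infinite X is impossible: opposite infinities add up to -oo, which is not 0. *)
Lemma ereal_cancel (r : R) (X Y : \bar R) : X = Y -> (r%:E - X + Y = 0)%E -> r = 0.
Proof. by move=> ->; case: Y => [y| |] //= [] /eqP; rewrite subrK => /eqP. Qed.

Lemma dot_caloric (f : R -> R) k (s : R) :
  dot f ((fun u => nu k * (expR (nu k * s) * e k u)) + (fun u => expR (nu k * s) * (- nu k * e k
    u))) = 0.
Proof.
rewrite dotC -[RHS](dot0l f); apply: eq_dot => // u _ /=.
by rewrite addrfctE; ring.
Qed.

Lemma mode_coef_of_zero (rho0 rt : R -> R) (t : R) k : L2 rho0 -> L2 rt ->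
  dot rt (fun u => expR (nu k * t) * e k u) - dot rho0 (fun u => expR (nu k * 0) * e k u) = 0 ->
  dot rt (e k) = expR (- (nu k * t)) * dot rho0 (e k).
Proof.
move=> L0 Lt; rewrite !dotZr//; try exact: mode_L2.
rewrite mulr0 expR0 mul1r => /eqP; rewrite subr_eq0 => /eqP <-.
by rewrite expRN mulKf// expR_eq0.
Qed.

Lemma periodic_mode (T : R) (rho0 : R -> R) rho k (t : R) : gam = 0 -> L2 rho0 ->
  periodic_solution T rho0 rho -> t \in `[0, T] ->
  dot (rho t) (e k) = expR (- (nu k * t)) * dot rho0 (e k).
Proof.
move=> g0 L0 [_ Lrho sol] tT; apply: mode_coef_of_zero => //; first exact: Lrho.
have := sol _ _ _ _ _ tT (mode_C12 T setT k) _.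
under eq_integral do rewrite dot_caloric; rewrite integral0 sube0 => h.
have {}h := h _; apply/eqP; rewrite -eqe; apply/eqP; apply: h => s _ u.
by rewrite (mode_periodic em g0).
Qed.

Lemma robin_mode (T : R) (rho0 : R -> R) rho k (t : R) : gam = 1 -> L2 rho0 ->
  robin_solution a T rho0 rho -> t \in `[0, T] ->
  dot (rho t) (e k) = expR (- (nu k * t)) * dot rho0 (e k).
Proof.
move=> g1 L0 [_ Lrho sol] tT; apply: mode_coef_of_zero => //; first exact: Lrho.
have := sol _ _ _ _ _ tT (mode_C12 T _ k).
under eq_integral do rewrite dot_caloric; rewrite integral0 sube0.
(* By the Robin condition of the mode, the flux integrand against the test function equals the jump
   integrand pointwise in time, so both integrals cancel whatever the traces are. *)
apply: ereal_cancel; apply: eq_integral => s _; congr EFin.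
have [b1 b2] := mode_boundary em k; rewrite g1 mul1r in b2.
by rewrite -b1 b2; ring.
Qed.

Lemma neumann_mode (T : R) (rho0 : R -> R) rho k (t : R) : gam = 1 -> a = 0 -> L2 rho0 ->
  neumann_solution T rho0 rho -> t \in `[0, T] ->
  dot (rho t) (e k) = expR (- (nu k * t)) * dot rho0 (e k).
Proof.
move=> g1 a0 L0 [_ Lrho sol] tT; apply: mode_coef_of_zero => //; first exact: Lrho.
have := sol _ _ _ _ _ tT (mode_C12 T _ k).
under eq_integral do rewrite dot_caloric; rewrite integral0 sube0.
have [b1 b2] := mode_boundary em k; rewrite g1 a0 mul1r mul0r in b2.
rewrite b2 in b1; rewrite b2 -b1.
by under eq_integral do rewrite !mulr0 subr0; rewrite integral0 sube0 => -[].
Qed.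

(** A function orthogonal to all modes is orthogonal, by density, to every continuous function, in
    particular to all test functions. *)
Lemma modes_separate f g : L2 f -> L2 g -> (forall k, dot f (e k) = dot g (e k)) ->
  f = g %[ae leb in I01].
Proof.
move=> Lf Lg fg; have Lh := L2B Lf Lg; set h := fun u => f u - g u in Lh.
have he k : dot h (e k) = 0 by rewrite dotBl ?fg ?subrr//; exact: mode_L2.
have h0 H : cont01 H -> dot h H = 0.
  move=> cH; apply/eqP; rewrite -sqrf_eq0 eq_le sqr_ge0 andbT.
  apply/ler_addgt0Pr => eps eps0; rewrite add0r.
  have X0 : 0 < dot h h + 1 by rewrite ltr_wpDl ?dot_ge0.
  have [N [b hb]] := mode_dense em cH (divr_gt0 eps0 X0).
  have LH := cont01_L2 cH; have Lc := combo_L2 (mode_ortho em) N b.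
  have -> : dot h H = dot h (fun u => H u - combo e N b u).
    rewrite dotBr// dot_combo//; last exact: mode_ortho em.
    by rewrite big1 ?subr0// => k _; rewrite he mulr0.
  apply: le_trans (dot_CS Lh (L2B LH Lc)) _.
  rewrite ltr_pdivlMr// in hb; apply: le_trans (ltW hb).
  by rewrite mulrC ler_wpM2l ?dot_ge0// lerDl.
have := test_dot_ae0 Lh (fun G tG => h0 G (test_function_cont tG).1).
apply: (@filterS _ _ (ae_filter_ringOfSetsType leb)) => u /= hu u01.
by have /eqP := hu u01; rewrite subr_eq0 => /eqP.
Qed.

End modes_tests.
End weak_notions.

(** * Space-time test functions *)

Section time_tests.
Context {R : realType}.
Implicit Types (f g F G : R -> R).
Local Notation leb := (@lebesgue_measure R).
Local Notation I01 := (`[0%R, 1%R]%classic : set R).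

Lemma continuous_pair (S : topologicalType) (f g : S -> R) : continuous f -> continuous g ->
  continuous (fun x => (f x, g x)).
Proof. by move=> cf cg x; apply: (@cvg_pair _ _ _ _ (nbhs (f x)) (nbhs (g x)));
  [exact: cf|exact: cg]. Qed.

Lemma derivative_on_is_derive (A : set R) F f (x : R) : nbhs x A -> derivative_on A F f ->
  is_derive x 1 F (f x).
Proof.
move=> nA dF; have Ax := nbhs_singleton nA; have sl := dF x Ax.
apply/is_derive1_caratheodory.
exists (fun z => if z == x then f x else (F z - F x) / (z - x)); split; last by rewrite eqxx.
  move=> z; case: eqP => [->|/eqP zx]; first by rewrite !subrr mulr0.
  by rewrite divfK// subr_eq0.
apply/continuous_withinNx; rewrite eqxx.
have h : (F y - F x) / (y - x) @[y --> x^'] --> f x.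
  apply: cvg_trans sl => B; rewrite /nbhs/= /within/= => hB.
  have dA : x^' A by apply: filterS nA => y Ay _.
  by apply: filterS2 dA hB => y Ay /(_ Ay).
apply: cvg_trans h; apply: near_eq_cvg.
have : x^' [set y | y != x] by change (nbhs x [set y | y != x -> y != x]);
  exact: filterS (fun y _ yx => yx) (@filterT _ (nbhs x) _).
by apply: filterS => y /negbTE ->.
Qed.

(* [derivative_on] is one-sided at 0 and 1, whereas [deriv01] asks for two-sided derivatives. *)
Lemma derivative_on01_primitive F f : cont01 F -> cont01 f -> derivative_on I01 F f ->
  exists2 P, deriv01 P f & forall x, 0 <= x <= 1 -> P x = F x.
Proof.
move=> cF cf dF; have [P [P0 dP]] := cont01_primitive cf.
have cD : cont01 (fun u => P u - F u) by apply: cont01B => //; exact: deriv01_cont dP.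
have dD (x : R) : x \in `]0, 1[ -> is_derive x 1 (fun u => P u - F u) 0.
  rewrite in_itv/= => /andP[x0 x1].
  have d1 : is_derive x 1 P (f x) by apply: dP; rewrite !ltW.
  have d2 : is_derive x 1 F (f x).
    apply: derivative_on_is_derive dF.
    by apply: filterS2 (lt_nbhsr x0) (lt_nbhsl x1) => y y0 y1; rewrite /= in_itv/= !ltW.
  by apply: (is_derive_eq (is_derive_subf d1 d2)); rewrite subrr.
exists (fun u => P u + F 0).
  move=> x x01; apply: (is_derive_eq (is_derive_addf (dP x x01) (is_derive_cst (F 0) x 1))).
  by rewrite addr0.
move=> x x01; have [x0 x1] := andP x01.
have [->|xn0] := eqVneq x 0; first by rewrite P0 add0r.
have {xn0}x0 : 0 < x by rewrite lt_neqAle eq_sym xn0.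
have dD' (c : R) : c \in `]0, x[ -> is_derive c 1 (fun u => P u - F u) 0.
  by rewrite in_itv/= => /andP[c0 cx]; apply: dD; rewrite in_itv/= c0 (lt_le_trans cx x1).
have [c _ /eqP] := MVT x0 dD' (cont01_sub (lexx _) x1 cD).
by rewrite mul0r P0 sub0r opprK addrAC subr_eq add0r => /eqP.
Qed.

Section rectangle.
Context (T : R).
Hypothesis T0 : 0 < T.
Local Notation IT := (`[0%R, T]%classic : set R).

Definition clampT (s : R) : R := T * clamp01 (s / T).

Lemma clampT_in s : 0 <= clampT s <= T.
Proof.
have /andP[h0 h1] := clamp01_in (s / T).
by rewrite /clampT mulr_ge0 ?(ltW T0)//= ler_piMr// ltW.
Qed.

Lemma clampT_id s : 0 <= s <= T -> clampT s = s.
Proof.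
move=> /andP[s0 sT]; rewrite /clampT clamp01_id; first by rewrite mulrC divfK// gt_eqF.
by rewrite divr_ge0 ?(ltW T0)//= ler_pdivrMr// mul1r.
Qed.

Lemma clampT_continuous : continuous clampT.
Proof.
move=> s; apply: cvgM; first exact: cvg_cst.
apply: (@cvg_comp _ _ _ (fun s => s / T) clamp01 _ (nbhs (s / T))); last exact: clamp01_continuous.
by apply: cvgM; [exact: cvg_id|exact: cvg_cst].
Qed.

Definition cont_rect (F : R -> R -> R) :=
  {within IT `*` I01, continuous (fun p : R * R => F p.1 p.2)}.

Definition clamp_rect (F : R -> R -> R) (s u : R) := F (clampT s) (clamp01 u).

Lemma clamp_rectE (F : R -> R -> R) (s u : R) : 0 <= s <= T -> 0 <= u <= 1 -> clamp_rect F s u = F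
  s u.
Proof. by move=> sT u01; rewrite /clamp_rect clampT_id// clamp01_id. Qed.

Lemma cont_rect_clamp (F : R -> R -> R) : cont_rect F -> continuous (fun p : R * R => clamp_rect F
  p.1 p.2).
Proof.
move=> cF p; pose cl (p : R * R) : R * R := (clampT p.1, clamp01 p.2).
have clc : continuous cl.
  apply: continuous_pair => q.
    by apply: (@continuous_comp _ _ _ fst clampT); [exact: cvg_fst|exact: clampT_continuous].
  by apply: (@continuous_comp _ _ _ snd clamp01); [exact: cvg_snd|exact: clamp01_continuous].
have clin q : (IT `*` I01) (cl q).
  by split => /=; rewrite in_itv/=; [exact: clampT_in|exact: clamp01_in].
apply: (@cvg_comp _ _ _ cl (fun p : R * R => F p.1 p.2) _ (within (IT `*` I01) (nbhs (cl p)))).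
  move=> A hA; have hA' : nbhs (cl p) [set y | (IT `*` I01) y -> A y] := hA.
  have h2 : nbhs p (cl @^-1` [set y | (IT `*` I01) y -> A y]) := clc p _ hA'.
  change (nbhs p (cl @^-1` A)).
  exact: filterS (fun y hy => hy (clin y)) h2.
have /(_ (cl p)) := cF.
rewrite /continuous_at /from_subspace /= /prop_for (nbhs_subspace_in (clin p)).
exact.
Qed.

Lemma cont_rect_bounded (F : R -> R -> R) : cont_rect F -> exists2 M, 0 < M &
  forall s u : R, 0 <= s <= T -> 0 <= u <= 1 -> `|F s u| <= M.
Proof.
move=> cF; have cR : compact (IT `*` I01) by apply: compact_setX; exact: segment_compact.
have := continuous_compact cF cR => /compact_bounded [M [Mr hM]].
exists (`|M| + 1); first by rewrite ltr_wpDl.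
move=> s u sT u01; apply: (hM (`|M| + 1)); first by rewrite (le_lt_trans (ler_norm M))// ltrDl.
by exists (s, u) => //; split; rewrite /= in_itv.
Qed.

Lemma cont_rect_slice (F : R -> R -> R) (s : R) : cont_rect F -> 0 <= s <= T -> cont01 (F s).
Proof.
move=> cF sT; apply: (@eq_cont01 R (clamp_rect F s)) => [u u01|]; first by rewrite clamp_rectE.
apply: continuous_cont01 => u.
apply: (@continuous_comp _ _ _ (fun u : R => (s, u)) (fun p : R * R => clamp_rect F p.1 p.2)).
  by apply: continuous_pair => v; [exact: cvg_cst|exact: cvg_id].
exact: cont_rect_clamp.
Qed.

Lemma cont_rect_time (F : R -> R -> R) (u : R) : cont_rect F -> 0 <= u <= 1 -> {within IT,
  continuous (F ^~ u)}.
Proof.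
move=> cF u01; apply: (@subspace_eq_continuous _ _ _ (fun s => clamp_rect F s u)).
  by move=> s; rewrite inE/= in_itv/= => sT; rewrite /from_subspace/= clamp_rectE.
apply: continuous_subspaceT => s.
apply: (@continuous_comp _ _ _ (fun s : R => (s, u)) (fun p : R * R => clamp_rect F p.1 p.2)).
  by apply: continuous_pair => v; [exact: cvg_id|exact: cvg_cst].
exact: cont_rect_clamp.
Qed.

Lemma dot_cont_time (F : R -> R -> R) f : cont_rect F -> cont01 f -> {within IT, continuous (fun s
  => dot f (F s))}.
Proof.
move=> cF cf; pose h s u := f u * clamp_rect F s u.
apply: (@subspace_eq_continuous _ _ _ (fun s => (\int[leb]_(u in I01) h s u)%R)).
  move=> s; rewrite inE/= in_itv/= => sT; rewrite /from_subspace/=.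
  by apply: eq_Rint01 => u u01; rewrite /h clamp_rectE.
apply: continuous_subspaceT => s.
have [M M0 hM] := cont_rect_bounded cF; have [N N0 hN] := cont01_bounded cf.
have hc t : cont01 (h t).
  apply: cont01M => //; apply: (@eq_cont01 R (F (clampT t))).
    by move=> u u01; rewrite /clamp_rect clamp01_id.
  by apply: cont_rect_slice => //; exact: clampT_in.
apply: (@continuity_under_integral R _ _ leb h I01 measurable_I01 (s - 1) (s + 1) _ _ (fun=> N *
  M)).
- by move=> t _; exact: cont01_integ.
- apply: aeW => u u01 t _.
  apply: cvgM; first exact: cvg_cst.
  apply: (@continuous_comp _ _ _ (fun s : R => (s, u)) (fun p : R * R => clamp_rect F p.1 p.2)).
    by apply: continuous_pair => v; [exact: cvg_id|exact: cvg_cst].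
  exact: cont_rect_clamp.
- by apply: cont01_integ; exact: cont01_cst.
- move=> t _; apply: aeW => u; rewrite in01 => u01; rewrite normrM ler_pM//; first exact: hN.
  by apply: hM; [exact: clampT_in|exact: clamp01_in].
- by rewrite inE/= in_itv/=; lra.
Qed.

Lemma dot_deriv_time (F Ft : R -> R -> R) f (s : R) : cont_rect F -> cont_rect Ft -> cont01 f ->
  (forall u : R, 0 <= u <= 1 -> derivative_on IT (F ^~ u) (Ft ^~ u)) -> 0 < s < T ->
  is_derive s 1 (fun s => dot f (F s)) (dot f (Ft s)).
Proof.
move=> cF cFt cf dF sT; pose h s u := f u * F s u.
have [M M0 hM] := cont_rect_bounded cFt; have [N N0 hN] := cont01_bounded cf.
have dh (t u : R) : 0 < t < T -> 0 <= u <= 1 -> is_derive t 1 (h ^~ u) (f u * Ft t u).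
  move=> /andP[t0 tT] u01; apply: is_derive_scalef; apply: derivative_on_is_derive (dF u u01).
  by apply: filterS2 (lt_nbhsr t0) (lt_nbhsl tT) => y y0 y1; rewrite /= in_itv/= !ltW.
have d1 (t u : R) : 0 < t < T -> 0 <= u <= 1 -> partial1of2 h t u = f u * Ft t u.
  by move=> tT u01; rewrite partial1of2E; have d := dh t u tT u01; rewrite derive_val.
have is_ : (`]0, T[%classic : set R) s by rewrite /= in_itv.
have H1 : forall x : R, `]0, T[%classic x -> leb.-integrable I01 (EFin \o h x).
  move=> t; rewrite /= in_itv/= => /andP[t0 tT].
  by apply: cont01_integ; apply: cont01M => //; apply: cont_rect_slice => //; rewrite !ltW.
have H2 : forall x y : R, `]0, T[%classic x -> I01 y -> derivable (h ^~ y) x 1.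
  by move=> t u; rewrite /= !in_itv/= => tT u01; have [] := dh t u tT u01.
have H3 : forall x y : R, `]0, T[%classic x -> I01 y -> `|partial1of2 h x y| <= N * M.
  move=> t u; rewrite /= !in_itv/= => tT u01; rewrite d1// normrM ler_pM//; first exact: hN.
  by apply: hM => //; have /andP[t0 tT'] := tT; rewrite !ltW.
have H4 : leb.-integrable I01 (EFin \o (fun _ : R => N * M)) by apply: cont01_integ;
  exact: cont01_cst.
have H5 : forall y : R, 0 <= N * M by move=> _; rewrite mulr_ge0 ?ltW.
have dd := @derivable_under_integral R _ _ leb h I01 measurable_I01 s 0 T is_ H1 H2 _ H5 H4 H3.
have de := @differentiation_under_integral R _ _ leb h I01 measurable_I01 s 0 T is_ H1 H2 _ H5 H4
  H3.
apply: DeriveDef; first exact: dd.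
rewrite -derive1E de; apply: eq_Rint01 => u u01; exact: d1.
Qed.

Lemma cont_withinM (A : set R) f g : {within A, continuous f} -> {within A, continuous g} ->
  {within A, continuous (fun s => f s * g s)}.
Proof. by move=> cf cg s; apply: cvgM; [exact: cf|exact: cg]. Qed.

Lemma cont_withinB (A : set R) f g : {within A, continuous f} -> {within A, continuous g} ->
  {within A, continuous (fun s => f s - g s)}.
Proof. by move=> cf cg s; apply: cvgB; [exact: cf|exact: cg]. Qed.

Lemma cont_withinD (A : set R) f g : {within A, continuous f} -> {within A, continuous g} ->
  {within A, continuous (fun s => f s + g s)}.
Proof. by move=> cf cg s; apply: cvgD; [exact: cf|exact: cg]. Qed.

Lemma cont_itv_sub f (t : R) : t <= T -> {within IT, continuous f} -> {within `[0, t], continuous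
  f}.
Proof.
move=> tT; apply: continuous_subspaceW => s; rewrite /= !in_itv/= => /andP[-> st].
exact: le_trans st tT.
Qed.

Lemma decay_is_derive (c s : R) : is_derive s 1 (fun s => expR (- (c * s))) (- c * expR (- (c *
  s))).
Proof.
have d1 : is_derive s 1 (fun s => - (c * s)) (- c).
  by apply: (is_derive_eq (is_deriveN (is_derive_scalef c (is_derive_id s 1)))); rewrite mulr1.
have d2 : is_derive s 1 (fun s => expR (- (c * s))) _ :=
  @is_derive1_comp _ expR (fun s => - (c * s)) s _ _ (is_derive_expR (- (c * s))) d1.
by apply: (is_derive_eq d2); rewrite mulrC.
Qed.

Section mode_identity.
Context (gam a : R) (e e1 : nat -> R -> R) (nu : nat -> R).
Hypothesis em : eigenmodes gam a e e1 nu.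
Context (H Ht Hu Huu : R -> R -> R).
Hypothesis HC : is_C12 T I01 H Ht Hu Huu.

Lemma test_rect : [/\ cont_rect H, cont_rect Ht, cont_rect Hu & cont_rect Huu].
Proof.
by have [_ _ _ h] := HC; split; apply: h;
  [apply: Or41|apply: Or42|apply: Or43|apply: Or44].
Qed.

(** The integrand of the weak formulation at rho = e_k, with a (e 0 - e 1) written as e1 0. In this
    form it also serves gam = 0, where the end terms vanish for periodic H. *)
Definition mode_flux k (s : R) := dot (e k) (Ht s + Huu s)
  + (e k 0 * Hu s 0 - e k 1 * Hu s 1) - e1 k 0 * (H s 0 - H s 1).

(** Two integrations by parts move the second derivative onto e_k; the end terms of [mode_flux] are
    exactly those that arise, given e1 0 = e1 1. *)
Lemma mode_fluxE k (s : R) : 0 <= s <= T ->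
  mode_flux k s = dot (e k) (Ht s) - nu k * dot (e k) (H s).
Proof.
move=> sT; have [cH cHt cHu cHuu] := test_rect; have [_ d1 d2 _] := HC.
have sT' : s \in `[0, T] by rewrite in_itv.
have [cHs cHts cHus cHuus] := And4 (cont_rect_slice cH sT) (cont_rect_slice cHt sT)
  (cont_rect_slice cHu sT) (cont_rect_slice cHuu sT).
have [P dP PE] := derivative_on01_primitive cHs cHus (d1 s sT').
have [Q dQ QE] := derivative_on01_primitive cHus cHuus (d2 s sT').
have [z0 z1] : (0 <= (0 : R) <= 1) /\ (0 <= (1 : R) <= 1) by rewrite !lexx ler01.
have de : deriv01 (e k) (e1 k) by move=> x _; exact: mode_deriv em k x.
have de1 : deriv01 (e1 k) (fun u => - nu k * e k u) by move=> x _; exact: mode_deriv2 em k x.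
have [ce ce1] := mode_cont01 em k.
have p1 := parts01 de dQ ce1 cHuus.
have p2 := parts01 de1 dP (@cont01Z _ _ _ ce) cHus.
have e1Q : dot (e1 k) Q = dot (e1 k) (Hu s) by apply: eq_dot => // u u01; exact: QE.
have eP : dot (fun u => - nu k * e k u) P = - nu k * dot (e k) (H s).
  rewrite dotZl; [|exact: cont01_L2|exact: cont01_L2 (deriv01_cont dP)].
  by congr (_ * _); apply: eq_dot => // u u01; exact: PE.
have [b1 _] := mode_boundary em k.
rewrite e1Q !QE// in p1; rewrite eP !PE// in p2.
rewrite /mode_flux; have -> : dot (e k) (Ht s + Huu s) = dot (e k) (Ht s) + dot (e k) (Huu s).
  by apply: dotDr; exact: cont01_L2.
have -> : dot (e k) (Huu s) = e k 1 * Hu s 1 - e k 0 * Hu s 0 - dot (e1 k) (Hu s) by rewrite -p1;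
  ring.
have -> : dot (e1 k) (Hu s) = e1 k 1 * H s 1 - e1 k 0 * H s 0 - - nu k * dot (e k) (H s) by rewrite
  -p2; ring.
by rewrite -b1; ring.
Qed.

Lemma mode_flux_cont k : {within IT, continuous (mode_flux k)}.
Proof.
have [cH cHt cHu cHuu] := test_rect; have [ce _] := mode_cont01 em k.
apply: (@subspace_eq_continuous _ _ _ (fun s => dot (e k) (Ht s) - nu k * dot (e k) (H s))).
  by move=> s; rewrite inE/= in_itv/= => sT; rewrite /from_subspace/= mode_fluxE.
move=> s; apply: cvgB; first exact: dot_cont_time.
by apply: cvgM; [exact: cvg_cst|exact: dot_cont_time].
Qed.

Lemma decay_cont (c : R) : continuous (fun s => expR (- (c * s))).
Proof. exact: is_derive_cont (decay_is_derive c). Qed.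

Lemma mode_weak k (t : R) : 0 <= t <= T ->
  expR (- (nu k * t)) * dot (e k) (H t) - dot (e k) (H 0) =
  (\int[leb]_(s in `[0, t]) (expR (- (nu k * s)) * mode_flux k s))%R.
Proof.
move=> /andP[t0 tT]; have [->|tn0] := eqVneq t 0.
  by rewrite set_itv1 Rintegral_set1 mulr0 oppr0 expR0 mul1r subrr.
have {tn0}t0 : 0 < t by rewrite lt_neqAle eq_sym tn0.
have [cH cHt cHu cHuu] := test_rect; have [ce _] := mode_cont01 em k.
pose phi s := expR (- (nu k * s)) * dot (e k) (H s).
have [dH _ _ _] := HC.
have dphi (s : R) : 0 < s < t -> is_derive s 1 phi (expR (- (nu k * s)) * mode_flux k s).
  move=> /andP[s0 st]; have sT := lt_le_trans st tT.
  have d1 : is_derive s 1 (fun s => dot (e k) (H s)) (dot (e k) (Ht s)).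
    by apply: (@dot_deriv_time H) => //; rewrite s0.
  apply: (is_derive_eq (is_derive_mulf (decay_is_derive (nu k) s) d1)).
  by rewrite mode_fluxE ?ltW//; ring.
have cphi : {within `[0, t], continuous phi}.
  apply: cont_withinM; first by apply: continuous_subspaceT; exact: decay_cont.
  by apply: cont_itv_sub tT _; exact: dot_cont_time.
rewrite /Rintegral (@continuous_FTC2 _ _ phi 0 t)//=.
- by rewrite /phi mulr0 oppr0 expR0 mul1r.
- apply: cont_withinM; first by apply: continuous_subspaceT; exact: decay_cont.
  by apply: cont_itv_sub tT _; exact: mode_flux_cont.
- have /(continuous_within_itvP _ t0) [_ cr cl] := cphi; split => //.
  by move=> x; rewrite in_itv/= => x0t; have [] := dphi x x0t.
- by move=> x; rewrite in_itv/= => x0t; have d := dphi x x0t; rewrite derive1E derive_val.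
Qed.

End mode_identity.
End rectangle.
End time_tests.

(** * Series solutions *)

Section flow.
Context {R : realType}.
Implicit Types (f g w : R -> R) (b : nat -> R).
Local Notation leb := (@lebesgue_measure R).
Local Notation I01 := (`[0%R, 1%R]%classic : set R).

Lemma cvg_le (u : nat -> R) (l C : R) : u N @[N --> \oo] --> l -> (forall N, u N <= C) -> l <= C.
Proof.
move=> ul uC; rewrite -(cvg_lim _ ul)//; apply: limr_le; first by apply/cvg_ex; exists l.
exact: nearW.
Qed.

Lemma cvg_abs_le (u : nat -> R) (l C : R) : u N @[N --> \oo] --> l -> (forall N, `|u N| <= C) ->
  `|l| <= C.
Proof. by move=> ul uC; apply: (cvg_le (cvg_norm ul)). Qed.

Lemma cvg_of_sqr_increments (u S : nat -> R) (C B : R) : 0 < C ->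
  (forall N M, (N <= M)%N -> S N <= S M) -> (forall N, S N <= B) ->
  (forall N M, (N <= M)%N -> (u M - u N) ^+ 2 <= C * (S M - S N)) -> cvgn u.
Proof.
move=> C0 Snd SB uS.
have cS : cvgn S by apply: nondecreasing_is_cvgn => //; exists B => _ [N _ <-].
apply/cauchy_cvgP/cauchy_exP => eps eps0.
have X0 : 0 < eps ^+ 2 / C by rewrite divr_gt0// exprn_gt0.
have /cvgrPdist_lt /(_ _ X0) [N _ hN] := cS.
exists (u N); exists N => // M /= NM; rewrite /ball /= distrC.
have SM := nondecreasing_cvgn_le Snd cS M.
have := hN N (leqnn N); rewrite ger0_norm ?subr_ge0; last exact: nondecreasing_cvgn_le.
rewrite ltr_pdivlMr// mulrC => h; have h1 := uS N M NM.
rewrite -(@ltr_pXn2r _ 2) ?nnegrE// ?real_normK ?num_real//; last exact: ltW.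
apply: le_lt_trans h1 (le_lt_trans _ h); apply: ler_wpM2l; first exact: ltW.
by rewrite lerD2r.
Qed.

Lemma combo_widen (e : nat -> R -> R) N M b (x : R) : (N <= M)%N ->
  combo e N b x = combo e M (fun k => if (k < N)%N then b k else 0) x.
Proof.
move=> NM; rewrite /combo (big_ord_widen _ (fun k => b k * e k x) NM) big_mkcond/=.
by apply: eq_bigr => k _; case: ifP => //; rewrite mul0r.
Qed.

Lemma comboB (e : nat -> R -> R) N b b' (x : R) :
  combo e N (fun k => b k - b' k) x = combo e N b x - combo e N b' x.
Proof. by rewrite /combo -sumrB; apply: eq_bigr => k _; rewrite mulrBl. Qed.

Lemma combo_increment (e : nat -> R -> R) N M b (x : R) : (N <= M)%N ->
  combo e M b x - combo e N b x = combo e M (fun k => if (k < N)%N then 0 else b k) x.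
Proof.
move=> NM; rewrite (combo_widen _ _ _ NM) -comboB; apply: eq_bigr => k _; congr (_ * _).
by case: ifP => _; rewrite ?subrr ?subr0.
Qed.

Lemma sum_increment N M b : (N <= M)%N ->
  \sum_(k < M) b k - \sum_(k < N) b k = \sum_(k < M) (if (k < N)%N then 0 else b k).
Proof.
move=> NM; have := @combo_increment (fun _ _ => 1) N M b 0 NM; rewrite /combo.
by under eq_bigr do rewrite mulr1; under [X in _ - X]eq_bigr do rewrite mulr1;
  under [RHS]eq_bigr do rewrite mulr1.
Qed.

Lemma sum_sqr_mono N M b : (N <= M)%N -> \sum_(k < N) b k ^+ 2 <= \sum_(k < M) b k ^+ 2.
Proof.
move=> NM; rewrite -subr_ge0 (@sum_increment N M (fun k => b k ^+ 2))//; apply: sumr_ge0 => k _.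
by case: ifP => // _; exact: sqr_ge0.
Qed.

Section modes.
Context (gam a : R) (gam0 : 0 <= gam) (a0 : 0 <= a) (gama : 0 < gam + a).
Context (e e1 : nat -> R -> R) (nu : nat -> R).
Hypothesis em : eigenmodes gam a e e1 nu.

Lemma combo_is_derive N b (u : R) : is_derive u 1 (combo e N b) (combo e1 N b u).
Proof. by apply: deriv_sum_scale => k; exact: mode_deriv em k u. Qed.

Lemma combo_is_derive2 N b (u : R) :
  is_derive u 1 (combo e1 N b) (- combo e N (fun k => nu k * b k) u).
Proof.
apply: (is_derive_eq (@deriv_sum_scale R N b e1 (fun k u => - nu k * e k u) u _)).
  by move=> k; exact: mode_deriv2 em k u.
by rewrite /combo -sumrN; apply: eq_bigr => k _; ring.
Qed.

Lemma combo_boundary N b : boundary gam a (combo e N b) (combo e1 N b).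
Proof.
have hb := mode_boundary em; split.
  by apply: eq_bigr => k _; have [-> _] := hb k.
rewrite -sumrB !mulr_sumr; apply: eq_bigr => k _; have [_ h] := hb k.
by rewrite mulrCA h; ring.
Qed.

Lemma combo_cont N b : continuous (combo e N b) /\ continuous (combo e1 N b).
Proof.
split; first exact: is_derive_cont (combo_is_derive N b).
exact: is_derive_cont (combo_is_derive2 N b).
Qed.

Lemma combo_cont01 N b : cont01 (combo e N b) /\ cont01 (combo e1 N b).
Proof. by have [c c1] := combo_cont N b; split; exact: continuous_cont01. Qed.

Lemma combo_resolvent N b (u : R) :
  combo e N b u - - combo e N (fun k => nu k * b k) u = combo e N (fun k => (1 + nu k) * b k) u.
Proof. by rewrite opprK /combo -big_split/=; apply: eq_bigr => k _; ring. Qed.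

Lemma combo_derivs N b : [/\ deriv01 (combo e N b) (combo e1 N b),
  deriv01 (combo e1 N b) (fun u => - combo e N (fun k => nu k * b k) u) &
  cont01 (fun u => - combo e N (fun k => nu k * b k) u)].
Proof.
split; [by move=> u _; exact: combo_is_derive|by move=> u _; exact: combo_is_derive2|].
have [c _] := combo_cont01 N (fun k => nu k * b k).
by apply: (eq_cont01 _ (cont01Z (c := -1) c)) => u _; rewrite mulN1r.
Qed.

(** The coefficients (1 + nu) b are those of w - w'', so [boundary_bounds] applies; 9 is the square
    of its larger constant 3. *)
Lemma combo_sup N b (x : R) : 0 <= x <= 1 ->
  combo e N b x ^+ 2 <= 9 * (\sum_(k < N) ((1 + nu k) * b k) ^+ 2) /\
  combo e1 N b x ^+ 2 <= 9 * (\sum_(k < N) ((1 + nu k) * b k) ^+ 2).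
Proof.
move=> x01; have [d1 d2 c2] := combo_derivs N b.
have [_ _ h h1] := boundary_bounds gam0 a0 gama d1 d2 c2 (combo_boundary N b).
set n := norm2 _ in h h1.
have nE : n ^+ 2 <= \sum_(k < N) ((1 + nu k) * b k) ^+ 2.
  rewrite norm2_sqr; apply: le_trans (@combo_norm_le _ _ (mode_ortho em) N (fun k => (1 + nu k) * b
    k)).
  by rewrite (@eq_dot _ _ (combo e N (fun k => (1 + nu k) * b k)) _ (combo e N (fun k => (1 + nu k)
    * b k)))// => u _;
    rewrite combo_resolvent.
have n0 : 0 <= n by exact: norm2_ge0.
have sq (y c : R) : `|y| <= c * n -> 0 <= c <= 3 -> y ^+ 2 <= 9 * (\sum_(k < N) ((1 + nu k) * b k)
  ^+ 2).
  move=> yc /andP[c0 c3]; apply: le_trans (ler_wpM2l _ nE) => //.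
  rewrite -real_normK ?num_real//.
  have -> : 9 * n ^+ 2 = (3 * n) ^+ 2 by ring.
  rewrite ler_pXn2r ?nnegrE ?mulr_ge0//; apply: le_trans yc _; exact: ler_wpM2r.
split; [apply: sq (h x x01) _|apply: sq (h1 x x01) _]; lra.
Qed.

Lemma combo_energy N b : dot (combo e N b) (combo e N b) + dot (combo e1 N b) (combo e1 N b)
  <= \sum_(k < N) (1 + nu k) * b k ^+ 2.
Proof.
have [d1 d2 c2] := combo_derivs N b.
apply: le_trans (boundary_energy gam0 a0 gama d1 d2 c2 (combo_boundary N b)) _.
rewrite (@eq_dot _ _ (combo e N b) _ (combo e N (fun k => (1 + nu k) * b k)))//; last first.
  by move=> u _; rewrite combo_resolvent.
have eo := mode_ortho em; rewrite dot_combo//; last exact: combo_L2.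
apply: ler_sum => k _; rewrite dotC dot_combo_mode// ltn_ord -mulrA ler_wpM2l//.
  by rewrite addr_ge0// (mode_nu em).
by rewrite mulrA -expr2 ler_piMr ?sqr_ge0// mode_norm_le.
Qed.

(** Weaker than [combo_sup] by one power of 1 + nu. For the heat flow this is the bound that stays
    integrable in time down to 0. *)
Lemma combo_sup_energy N b (x : R) : 0 <= x <= 1 ->
  `|combo e N b x| <= 1 + \sum_(k < N) (1 + nu k) * b k ^+ 2.
Proof.
move=> x01; have [d1 _ _] := combo_derivs N b; have [_ c1] := combo_cont01 N b.
apply: le_trans (sup_le_H1 d1 c1 x01) _; apply: le_trans (lerD (lexx 1) (combo_energy N b)).
rewrite -!norm2_sqr; set p := norm2 _; set q := norm2 _.
by have := sqr_ge0 (p - 2^-1); have := sqr_ge0 (q - 2^-1); nra.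
Qed.

(** Membership in the domain of the Laplacian, expressed on coefficients. It forces the series and
    its termwise derivative to converge at every point of [0, 1], with bounded partial sums. *)
Definition smooth_coef b := exists B, forall N, \sum_(k < N) ((1 + nu k) * b k) ^+ 2 <= B.

Definition modal (h : nat -> R -> R) b (x : R) : R := limn (fun N => combo h N b x).

Lemma smooth_coefB b b' : smooth_coef b -> smooth_coef b' -> smooth_coef (fun k => b k - b' k).
Proof.
move=> [B hB] [B' hB']; exists (2 * (B + B')) => N.
apply: le_trans (ler_wpM2l _ (lerD (hB N) (hB' N))) => //.
rewrite -big_split/= mulr_sumr; apply: ler_sum => k _.
by have := sqr_ge0 ((1 + nu k) * b k + (1 + nu k) * b' k); nra.
Qed.

Lemma modal_cvg b (x : R) : smooth_coef b -> 0 <= x <= 1 ->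
  combo e N b x @[N --> \oo] --> modal e b x /\ combo e1 N b x @[N --> \oo] --> modal e1 b x.
Proof.
move=> [B hB] x01; pose S N := \sum_(k < N) ((1 + nu k) * b k) ^+ 2.
have Sm N M : (N <= M)%N -> S N <= S M by exact: (@sum_sqr_mono N M (fun k => (1 + nu k) * b k)).
have Sd N M : (N <= M)%N -> S M - S N = \sum_(k < M) ((1 + nu k) * (if (k < N)%N then 0 else b k))
  ^+ 2.
  move=> NM; rewrite /S (@sum_increment N M (fun k => ((1 + nu k) * b k) ^+ 2))//.
  by apply: eq_bigr => k _; case: ifP => // _; rewrite mulr0 expr0n.
by split; apply: (@cvg_of_sqr_increments _ S 9 B) => // N M NM;
  rewrite combo_increment// Sd//; have [] := combo_sup M (fun k => if (k < N)%N then 0 else b k)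
    x01.
Qed.

Lemma modal_bounded b : smooth_coef b -> exists C, forall N (x : R), 0 <= x <= 1 ->
  `|combo e N b x| <= C /\ `|combo e1 N b x| <= C.
Proof.
move=> [B hB]; exists (3 * (1 + B)) => N x x01.
have B0 : 0 <= B by have := hB 0%N; rewrite big_ord0.
have h (y : R) : y ^+ 2 <= 9 * \sum_(k < N) ((1 + nu k) * b k) ^+ 2 -> `|y| <= 3 * (1 + B).
  have := hB N; set s := (\sum_(_ < _) _) => sB ys.
  rewrite -(@ler_pXn2r _ 2) ?nnegrE//; last by lra.
  by rewrite real_normK ?num_real//; nra.
by have [h0 h1] := combo_sup N b x01; split; apply: h.
Qed.

Lemma modalB b b' (x : R) : smooth_coef b -> smooth_coef b' -> 0 <= x <= 1 ->
  modal e (fun k => b k - b' k) x = modal e b x - modal e b' x /\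
  modal e1 (fun k => b k - b' k) x = modal e1 b x - modal e1 b' x.
Proof.
move=> sb sb' x01; have [h h1] := modal_cvg sb x01; have [h' h1'] := modal_cvg sb' x01.
by split; apply/cvg_lim => //; under eq_fun do rewrite comboB; exact: cvgB.
Qed.

Lemma modal_cont01 b : smooth_coef b -> cont01 (modal e b).
Proof.
move=> sb; have [C hC] := modal_bounded sb.
apply: (@lipschitz_cont01 _ _ C) => u v u01 v01.
have [hu _] := modal_cvg sb u01; have [hv _] := modal_cvg sb v01.
have lip N (x y : R) : 0 <= x <= 1 -> 0 <= y <= 1 -> x <= y ->
    `|combo e N b x - combo e N b y| <= C * `|x - y|.
  move=> /andP[x0 x1] /andP[y0 y1] xy; have [d1 _ _] := combo_derivs N b.
  have [c /andP[xc cy] E] := deriv01_MVT d1 x0 xy y1.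
  rewrite distrC E normrM (distrC x); apply: ler_wpM2r => //.
  by have [] := hC N c _; first by rewrite (le_trans x0 xc) (le_trans cy y1).
apply: (cvg_abs_le (cvgB hu hv)) => N /=.
have [uv|vu] := leP u v; first exact: lip.
by rewrite distrC (distrC u); apply: lip => //; exact: ltW.
Qed.

Lemma modal_L2 b : smooth_coef b -> L2 (modal e b) /\ L2 (modal e1 b).
Proof.
move=> sb; split; first exact: cont01_L2 (modal_cont01 sb).
have [C hC] := modal_bounded sb; apply: (@bounded_L2 _ _ C).
  apply: (@measurable_fun_cvg _ _ R I01 (fun N => combo e1 N b)).
    by move=> N; apply: cont01_measurable; have [] := combo_cont01 N b.
  by move=> x; rewrite in01 => x01; have [] := modal_cvg sb x01.
move=> x x01; have [_ h1] := modal_cvg sb x01.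
by apply: (cvg_abs_le h1) => N; have [] := hC N x x01.
Qed.

Lemma dot_modal_cvg b f : smooth_coef b -> L2 f ->
  dot (combo e N b) f @[N --> \oo] --> dot (modal e b) f /\
  dot (combo e1 N b) f @[N --> \oo] --> dot (modal e1 b) f.
Proof.
move=> sb Lf; have [C hC] := modal_bounded sb; have [L L1] := modal_L2 sb.
have mf : measurable_fun I01 f by have [] := Lf.
have i1 : integ01 (fun u => C * `|f u|).
  apply: integ01Z; apply: integ01_abs.
  by have := L2_mul Lf (L2_cst 1); under eq_fun do rewrite mulr1.
split; apply: (@dominated_Rint01 _ _ _ _ _ _ i1).
- move=> N; apply: measurable_funM => //; apply: cont01_measurable.
  by have [] := combo_cont01 N b.
- by apply: measurable_funM => //; have [] := L.
- by move=> x x01; apply: cvgM; [have [] := modal_cvg sb x01|exact: cvg_cst].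
- by move=> N x x01; rewrite normrM ler_wpM2r//; have [] := hC N x x01.
- move=> N; apply: measurable_funM => //; apply: cont01_measurable.
  by have [] := combo_cont01 N b.
- by apply: measurable_funM => //; have [] := L1.
- by move=> x x01; apply: cvgM; [have [] := modal_cvg sb x01|exact: cvg_cst].
- by move=> N x x01; rewrite normrM ler_wpM2r//; have [] := hC N x x01.
Qed.

Lemma modal_weak_derivative b : smooth_coef b -> is_weak_derivative (modal e b) (modal e1 b).
Proof.
move=> sb; have [L L1] := modal_L2 sb; split => // G tG.
have [cG cG1] := test_function_cont tG.
have [h _] := dot_modal_cvg sb (cont01_L2 cG1); have [_ h1] := dot_modal_cvg sb (cont01_L2 cG).
rewrite dotC (dotC G) -(cvg_lim _ h)//; apply/cvg_lim => //.
have -> : (fun N => dot (combo e N b) (G^`())%classic) = fun N => - dot (combo e1 N b) G.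
  apply/funext => N; have [d1 _ _] := combo_derivs N b; have [_ c1] := combo_cont01 N b.
  have dG : deriv01 G (G^`())%classic by move=> u _; exact: test_function_deriv.
  have := parts01 d1 dG c1 cG1.
  have [_ [al [be [al0 be1 hG]]]] := tG.
  have G0 : G 0 = 0 by apply: hG; rewrite in_itv/= negb_and -ltNge al0.
  have G1 : G 1 = 0 by apply: hG; rewrite in_itv/= negb_and -!ltNge be1 orbT.
  by rewrite G0 G1 !mulr0 subrr => /eqP; rewrite addr_eq0 => /eqP.
exact: cvgN.
Qed.

Lemma modal_norm_cvg b : smooth_coef b ->
  dot (combo e N b) (combo e N b) + dot (combo e1 N b) (combo e1 N b) @[N --> \oo] -->
  dot (modal e b) (modal e b) + dot (modal e1 b) (modal e1 b).
Proof.
move=> sb; have [C hC] := modal_bounded sb; have [[m _] [m1 _]] := modal_L2 sb.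
have h : dot (combo e N b) (combo e N b) @[N --> \oo] --> dot (modal e b) (modal e b).
  apply: (@dominated_Rint01 _ _ _ (fun=> C ^+ 2)).
  - by move=> N; apply: measurable_funM; apply: cont01_measurable; have [] := combo_cont01 N b.
  - exact: measurable_funM.
  - by apply: cont01_integ; exact: cont01_cst.
  - by move=> x x01; apply: cvgM; have [] := modal_cvg sb x01.
  - move=> N x x01; rewrite normrM -expr2 ler_pXn2r ?nnegrE//; last by have [hx _] := hC N x x01;
      exact: le_trans (normr_ge0 _) hx.
    by have [h _] := hC N x x01; exact: le_trans h.
have h1 : dot (combo e1 N b) (combo e1 N b) @[N --> \oo] --> dot (modal e1 b) (modal e1 b).
  apply: (@dominated_Rint01 _ _ _ (fun=> C ^+ 2)).
  - by move=> N; apply: measurable_funM; apply: cont01_measurable; have [] := combo_cont01 N b.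
  - exact: measurable_funM.
  - by apply: cont01_integ; exact: cont01_cst.
  - by move=> x x01; apply: cvgM; have [] := modal_cvg sb x01.
  - move=> N x x01; rewrite normrM -expr2 ler_pXn2r ?nnegrE//; last by have [hx _] := hC N x x01;
      exact: le_trans (normr_ge0 _) hx.
    by have [_ h1] := hC N x x01; exact: le_trans h1.
exact: cvgD h h1.
Qed.

Lemma modal_energy b (S : R) : smooth_coef b -> (forall N, \sum_(k < N) (1 + nu k) * b k ^+ 2 <= S)
  ->
  dot (modal e b) (modal e b) + dot (modal e1 b) (modal e1 b) <= S.
Proof.
move=> sb hS; apply: (cvg_le (modal_norm_cvg sb)) => N.
exact: le_trans (combo_energy N b) (hS N).
Qed.

Lemma cont01_H1 f g : cont01 f -> is_weak_derivative f g -> H1 f.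
Proof.
move=> cf fg; split; last by exists g.
have /integ01P [mf fi] := cont01_integ cf; have mI := measurable_I01.
have s01 : `]0, 1[%classic `<=` I01 by move=> x /=; rewrite !in_itv/= => /andP[x0 x1]; rewrite !ltW.
split; first by apply: measurable_funS s01 mf.
  exact: interval_open.
move=> K K01 cK; apply: le_lt_trans fi; apply: ge0_subset_integral => //.
- by apply: closed_measurable; apply: compact_closed.
- apply/measurable_EFinP; exact: measurableT_comp.
- exact: subset_trans s01.
Qed.

End modes.
End flow.

(** * The heat flow as a weak solution *)

Section heat.
Context {R : realType}.
Implicit Types (f g w : R -> R) (b : nat -> R).
Local Notation leb := (@lebesgue_measure R).
Local Notation I01 := (`[0%R, 1%R]%classic : set R).

Lemma decay_le (v s : R) : 0 <= v -> 0 < s -> (1 + v) * expR (- (v * s)) <= 1 + s^-1.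
Proof.
move=> v0 s0; rewrite expRN ler_pdivrMr ?expR_gt0//.
have h := expR_ge1Dx (v * s); have i0 : 0 < s^-1 by rewrite invr_gt0.
have vs : v = s^-1 * (v * s) by rewrite mulrCA mulVf ?gt_eqF// mulr1.
have : 0 <= v * s by rewrite mulr_ge0// ltW.
by move: h vs; set p := v * s; set q := expR p; set r := s^-1 in i0 *; nra.
Qed.

Lemma decay_diff (v s t r : R) : 0 <= v -> r <= s -> r <= t ->
  `|expR (- (v * t)) - expR (- (v * s))| <= `|t - s| * (v * expR (- (v * r))).
Proof.
move=> v0; wlog st : s t / s <= t => [h rs rt|rs rt].
  have [st|/ltW ts] := leP s t; first exact: h.
  by rewrite distrC (distrC t); exact: h.
rewrite (ger0_norm (_ : 0 <= t - s)) ?subr_ge0// distrC ger0_norm; last first.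
  by rewrite subr_ge0 ler_expR lerN2 ler_wpM2l.
have -> : expR (- (v * t)) = expR (- (v * s)) * expR (- (v * (t - s))).
  by rewrite -expRD; congr expR; ring.
have h1 : expR (- (v * s)) <= expR (- (v * r)) by rewrite ler_expR lerN2 ler_wpM2l.
have h2 := expR_ge1Dx (- (v * (t - s))); have h0 := expR_gt0 (- (v * s)).
have d0 : 0 <= v * (t - s) by rewrite mulr_ge0// subr_ge0.
apply: (@le_trans _ _ (expR (- (v * s)) * (v * (t - s)))).
  have -> : expR (- (v * s)) - expR (- (v * s)) * expR (- (v * (t - s))) =
    expR (- (v * s)) * (1 - expR (- (v * (t - s)))) by ring.
  by apply: ler_wpM2l; [exact: ltW|lra].
have -> : (t - s) * (v * expR (- (v * r))) = expR (- (v * r)) * (v * (t - s)) by ring.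
exact: ler_wpM2r.
Qed.

Lemma cont_itv_sum N (F : nat -> R -> R) (A : set R) : (forall k, {within A, continuous (F k)}) ->
  {within A, continuous (fun s => \sum_(k < N) F k s)}.
Proof. by move=> cF s; apply: cvg_sumR => k; exact: cF. Qed.

Lemma Rintegral_itv_sum N (F : nat -> R -> R) (t : R) : (forall k, {within `[0, t], continuous (F
  k)}) ->
  (\int[leb]_(s in `[0, t]) (\sum_(k < N) F k s))%R = \sum_(k < N) (\int[leb]_(s in `[0, t]) F k
    s)%R.
Proof.
move=> cF; have int (G : R -> R) : {within `[0, t], continuous G} -> leb.-integrable `[0,
  t]%classic (EFin \o G).
  by move=> cG; apply: continuous_compact_integrable => //; exact: segment_compact.
elim: N => [|N IH].
  by rewrite big_ord0; under eq_Rintegral do rewrite big_ord0; rewrite Rintegral_cst// mul0r.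
rewrite big_ord_recr/= -IH.
transitivity (\int[leb]_(s in `[0, t]) (\sum_(k < N) F k s + F N s))%R.
  by apply: eq_Rintegral => s _; rewrite big_ord_recr.
rewrite RintegralD//; apply: int => //.
exact: cont_itv_sum.
Qed.

Section modes.
Context (gam a : R) (gam0 : 0 <= gam) (a0 : 0 <= a) (gama : 0 < gam + a).
Context (e e1 : nat -> R -> R) (nu : nat -> R).
Hypothesis em : eigenmodes gam a e e1 nu.

(** Density gives one good combination of N0 modes; the orthogonal projection is at least as good
    for every N >= N0. *)
Lemma parseval_cvg f H : L2 f -> cont01 H ->
  \sum_(k < N) dot f (e k) * dot (e k) H @[N --> \oo] --> dot f H.
Proof.
move=> Lf cH; have LH := cont01_L2 cH; have eo := mode_ortho em.
apply/cvgrPdist_le => eps eps0.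
have K0 : 0 < dot f f + 1 by rewrite ltr_wpDl ?dot_ge0.
have X0 : 0 < eps ^+ 2 / (dot f f + 1) by rewrite divr_gt0// exprn_gt0.
have [N0 [b hb]] := mode_dense em cH X0.
exists N0 => // N /= N0N.
have -> : \sum_(k < N) dot f (e k) * dot (e k) H = dot f (combo e N (fun k => dot H (e k))).
  by rewrite dot_combo//; apply: eq_bigr => k _; rewrite mulrC (dotC (e k)).
rewrite -dotBr//; last exact: combo_L2.
rewrite -(@ler_pXn2r _ 2) ?nnegrE// ?real_normK ?num_real//; last exact: ltW.
apply: le_trans (dot_CS Lf (L2B LH (combo_L2 eo _ _))) _.
have := @proj_best _ _ eo N (fun k => if (k < N0)%N then b k else 0) _ LH.
have -> : (fun u : R => H u - combo e N (fun k => if (k < N0)%N then b k else 0) u) =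
  fun u => H u - combo e N0 b u by apply/funext => u; rewrite -combo_widen.
move=> /le_lt_trans /(_ hb); rewrite ltr_pdivlMr// => h; apply: le_trans (ltW h).
by rewrite mulrC; apply: ler_wpM2l; [exact: dot_ge0|rewrite lerDl].
Qed.

Context (rho0 : R -> R).
Hypothesis L0 : L2 rho0.
Local Notation c k := (dot rho0 (e k)).
Local Notation C0 := (dot rho0 rho0).

Definition decay_coef (t : R) (k : nat) : R := expR (- (nu k * t)) * c k.

(** At t = 0 the series is only controlled in L2 and may fail to converge at a point, so the initial
    datum is taken itself. *)
Definition heat (t : R) : R -> R := if t <= 0 then rho0 else modal e (decay_coef t).

Lemma heatE (t : R) : 0 < t -> heat t = modal e (decay_coef t).
Proof. by rewrite /heat ltNge => /negbTE ->. Qed.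

Lemma coef_sum N : \sum_(k < N) c k ^+ 2 <= C0.
Proof. exact: bessel (mode_ortho em) N _ L0. Qed.

Lemma sum_coef_le N b (D : R) : (forall k, b k <= D * c k ^+ 2) -> 0 <= D ->
  \sum_(k < N) b k <= D * C0.
Proof.
move=> h D0; apply: le_trans (ler_wpM2l D0 (coef_sum N)).
by rewrite mulr_sumr; apply: ler_sum.
Qed.

Lemma decay_smooth (t : R) : 0 < t -> smooth_coef nu (decay_coef t).
Proof.
move=> t0; exists ((1 + t^-1) ^+ 2 * C0) => N.
apply: (@sum_coef_le N (fun k => ((1 + nu k) * decay_coef t k) ^+ 2)); last exact: sqr_ge0.
move=> k; rewrite /decay_coef mulrA exprMn; apply: ler_wpM2r; first exact: sqr_ge0.
have n0 := mode_nu em k; have h := decay_le n0 t0.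
have q0 := expR_ge0 (- (nu k * t)).
rewrite ler_pXn2r ?nnegrE//; first by rewrite mulr_ge0// addr_ge0.
by rewrite addr_ge0// invr_ge0 ltW.
Qed.

(** The factor exp(- nu r) is split into two copies of exp(- nu r / 2), each of which absorbs one
    factor 1 + nu by [decay_le]; hence r / 2 and the square. *)
Lemma decay_diff_energy (r s t : R) : 0 < r -> r <= s -> r <= t -> forall N,
  \sum_(k < N) (1 + nu k) * (decay_coef t k - decay_coef s k) ^+ 2
  <= (`|t - s| * (1 + (r / 2)^-1) ^+ 2) ^+ 2 * C0.
Proof.
move=> r0 rs rt N.
apply: (@sum_coef_le N (fun k => (1 + nu k) * (decay_coef t k - decay_coef s k) ^+ 2));
  last exact: sqr_ge0.
move=> k; rewrite /decay_coef -mulrBl exprMn mulrA; apply: ler_wpM2r; first exact: sqr_ge0.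
have n0 := mode_nu em k; have h := decay_le n0 (divr_gt0 r0 (ltr0n R 2)).
have d := decay_diff n0 rs rt; rewrite -real_normK ?num_real//.
have qE : expR (- (nu k * r)) = expR (- (nu k * (r / 2))) ^+ 2.
  by rewrite expr2 -expRD; congr expR; field.
rewrite qE in d; have q0 := expR_ge0 (- (nu k * (r / 2))).
move: h d q0 n0; set q := expR (- (nu k * (r / 2))); set D := 1 + (r / 2)^-1.
set x := `|expR _ - _|; set v := nu k => h d q0 n0.
have x0 : 0 <= x := normr_ge0 _; have y0 : 0 <= `|t - s| := normr_ge0 _.
move: d y0; set y := `|t - s| => d y0.
apply: (@le_trans _ _ ((1 + v) ^+ 2 * x ^+ 2)).
  by apply: ler_wpM2r; [exact: sqr_ge0|nra].
rewrite -exprMn ler_pXn2r ?nnegrE//; [|by rewrite mulr_ge0// addr_ge0|by rewrite mulr_ge0//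
  sqr_ge0].
apply: (@le_trans _ _ ((1 + v) * (y * (v * q ^+ 2)))); first by apply: ler_wpM2l => //;
  rewrite addr_ge0.
have -> : (1 + v) * (y * (v * q ^+ 2)) = y * (((1 + v) * q) * (v * q)) by ring.
apply: ler_wpM2l => //; rewrite expr2; apply: ler_pM => //.
- by rewrite mulr_ge0// addr_ge0.
- by rewrite mulr_ge0.
- by apply: le_trans h; rewrite mulrDl mul1r lerDr.
Qed.

Lemma heat_cont01 (t : R) : 0 < t -> cont01 (heat t).
Proof. by move=> t0; rewrite heatE//; exact: (modal_cont01 gam0 a0 gama em (decay_smooth t0)). Qed.

Lemma heat_L2 (t : R) : L2 (heat t).
Proof.
by have [t0|t0] := leP t 0; [rewrite /heat t0|exact: cont01_L2 (heat_cont01 t0)].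
Qed.

Lemma heat_weak_derivative (t : R) : 0 < t -> is_weak_derivative (heat t) (modal e1 (decay_coef t)).
Proof.
by move=> t0; rewrite heatE//; exact: (modal_weak_derivative gam0 a0 gama em (decay_smooth t0)).
Qed.

Lemma heat_mode (t : R) k : 0 <= t -> dot (heat t) (e k) = decay_coef t k.
Proof.
move=> t0; have eo := mode_ortho em; have Le := mode_L2 em k.
have [t1|t1] := leP t 0.
  have -> : t = 0 by apply/eqP; rewrite eq_le t1.
  by rewrite /heat lexx /decay_coef mulr0 oppr0 expR0 mul1r.
rewrite heatE//; have [h _] := dot_modal_cvg gam0 a0 gama em (decay_smooth t1) Le.
rewrite -(cvg_lim _ h)//; apply/cvg_lim => //; apply: cvg_near_cst; exists k.+1 => // N /= kN.
by rewrite dotC dot_combo_mode// kN /decay_coef -mulrA mode_coef.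
Qed.

(** The flow is Lipschitz into H1 on times bounded away from 0, which gives its measurability as an
    H1-valued map. *)
Lemma H1norm_heatB (r s t : R) : 0 < r -> r <= s -> r <= t ->
  H1norm (heat t - heat s) <= `|t - s| * ((1 + (r / 2)^-1) ^+ 2 * Num.sqrt C0).
Proof.
move=> r0 rs rt; have s0 := lt_le_trans r0 rs; have t0 := lt_le_trans r0 rt.
have ss := decay_smooth s0; have st := decay_smooth t0; have sd := smooth_coefB st ss.
have wd : is_weak_derivative (heat t - heat s) (modal e1 (fun k => decay_coef t k - decay_coef s
  k)).
  have [Ld wd] := modal_weak_derivative gam0 a0 gama em sd; split => // G tG; rewrite -wd//.
  apply: eq_dot => // u u01; rewrite !heatE//.
  by have [-> _] := modalB gam0 a0 gama em st ss u01.
rewrite (H1normE wd).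
have E : dot (heat t - heat s) (heat t - heat s) = dot (modal e (fun k => decay_coef t k -
  decay_coef s k))
   (modal e (fun k => decay_coef t k - decay_coef s k)).
  have E u : 0 <= u <= 1 -> (heat t - heat s) u = modal e (fun k => decay_coef t k - decay_coef s
    k) u.
    by move=> u01; rewrite !heatE//; have [-> _] := modalB gam0 a0 gama em st ss u01.
  exact: eq_dot.
rewrite E; have y0 : 0 <= `|t - s| * (1 + (r / 2)^-1) ^+ 2 by rewrite mulr_ge0// sqr_ge0.
rewrite mulrA -(ger0_norm y0) -sqrtr_sqr -sqrtrM ?sqr_ge0//.
rewrite ler_sqrt; last by rewrite mulr_ge0 ?sqr_ge0 ?dot_ge0.
exact: (modal_energy gam0 a0 gama em sd (decay_diff_energy r0 rs rt)).
Qed.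

Section time.
Context (T : R).
Hypothesis T0 : 0 < T.
Local Notation IT := (`[0%R, T]%classic : set R).

(* Bounds the k-th term of the squared H1 norm at time s, with a closed-form time integral. *)
Definition energy_term k (s : R) : R := c k ^+ 2 * (1 + nu k * expR (- (2 * nu k * s))).

Definition energy_series (s : R) : \bar R := (\sum_(0 <= k <oo) (energy_term k s)%:E)%E.

Lemma energy_term_ge0 k s : 0 <= energy_term k s.
Proof.
by rewrite /energy_term mulr_ge0 ?sqr_ge0// addr_ge0// mulr_ge0 ?expR_ge0// (mode_nu em).
Qed.

Lemma energy_term_cont k : continuous (energy_term k).
Proof.
move=> s; apply: cvgM; first exact: cvg_cst.
apply: cvgD; first exact: cvg_cst.
apply: cvgM; first exact: cvg_cst.
exact: (@decay_cont R (2 * nu k)).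
Qed.

Lemma energy_term_ge k (s : R) : 0 <= s -> (1 + nu k) * decay_coef s k ^+ 2 <= energy_term k s.
Proof.
move=> s0; rewrite /energy_term /decay_coef exprMn mulrA [leLHS]mulrC ler_wpM2l ?sqr_ge0//.
have -> : expR (- (2 * nu k * s)) = expR (- (nu k * s)) ^+ 2.
  by rewrite expr2 -expRD; congr expR; ring.
rewrite mulrDl mul1r lerD2r expr_le1 ?expR_ge0// expR_le1 oppr_le0 mulr_ge0//.
exact: mode_nu em k.
Qed.

(** The time integral pays for the factor nu: that of nu exp(- 2 nu s) is at most 1 / 2 whatever nu
    is, so summing over k only needs the square sum of the coefficients of [rho0]. *)
Lemma energy_term_integral k : (\int[leb]_(s in IT) (energy_term k s)%:E <= (c k ^+ 2 * (T +
  2^-1))%:E)%E.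
Proof.
pose F s := c k ^+ 2 * (s - 2^-1 * expR (- (2 * nu k * s))).
have dF (s : R) : is_derive s 1 F (energy_term k s).
  apply: is_derive_scalef.
  apply: (is_derive_eq (is_derive_subf (is_derive_id s 1)
    (is_derive_scalef 2^-1 (@decay_is_derive R (2 * nu k) s)))).
  by field.
rewrite (@continuous_FTC2 _ _ F 0 T)//=.
- rewrite -EFinB lee_fin /F -mulrBr; apply: ler_wpM2l; first exact: sqr_ge0.
  rewrite mulr0 oppr0 expR0 mulr1 sub0r.
  by have := expR_ge0 (- (2 * nu k * T)); lra.
- by apply: continuous_subspaceT; exact: energy_term_cont.
- have cF : continuous F := is_derive_cont dF.
  split; [by move=> x _; have [] := dF x| |].
  + exact: cvg_at_right_filter (cF 0).
  + exact: cvg_at_left_filter (cF T).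
- by move=> x _; have d := dF x; rewrite derive1E derive_val.
Qed.

Lemma energy_integrable : leb.-integrable IT energy_series.
Proof.
have mk k : measurable_fun IT (fun s => (energy_term k s)%:E).
  apply/measurable_EFinP; apply: measurable_funTS.
  by apply: continuous_measurable_fun; exact: energy_term_cont.
have g0 k s : IT s -> (0 <= (energy_term k s)%:E)%E by rewrite lee_fin energy_term_ge0.
apply/integrableP; split.
  by apply: (@ge0_emeasurable_sum _ _ R IT (fun k s => (energy_term k s)%:E) predT) => // k s Is _;
    exact: g0.
under eq_integral => s Is.
  rewrite gee0_abs; last by apply: nneseries_ge0 => k _ _; rewrite lee_fin energy_term_ge0.
  over.
rewrite integral_nneseries//.
apply: (@le_lt_trans _ _ (((T + 2^-1) * C0)%:E)); last exact: ltry.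
apply: lime_le.
  by apply: is_cvg_nneseries => k _ _; apply: integral_ge0 => s Is; exact: g0.
apply: nearW => N; rewrite big_mkord.
apply: (@le_trans _ _ (\sum_(k < N) (c k ^+ 2 * (T + 2^-1))%:E)%E).
  by apply: lee_sum => k _; exact: energy_term_integral.
rewrite sumEFin lee_fin; apply: (@sum_coef_le N (fun k => c k ^+ 2 * (T + 2^-1))) => [k|].
  by rewrite mulrC.
by rewrite addr_ge0 ?invr_ge0// ltW.
Qed.

Lemma energy_partial N (s : R) : 0 <= s ->
  ((\sum_(k < N) (1 + nu k) * decay_coef s k ^+ 2)%:E <= energy_series s)%E.
Proof.
move=> s0; apply: (@le_trans _ _ (\sum_(0 <= k < N | true) (energy_term k s)%:E)%E).
  rewrite big_mkord sumEFin lee_fin; apply: ler_sum => k _; exact: energy_term_ge.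
by apply: nneseries_lim_ge => k _ _; rewrite lee_fin energy_term_ge0.
Qed.

(** Dominated convergence with majorant C (1 + [energy_series]). It is carried out on ]0, t], since
    nothing is assumed about convergence at time 0, a null set. *)
Lemma decay_dct (t : R) (F : nat -> R -> R) f (C : R) : 0 <= t <= T -> 0 <= C ->
  (forall N, {within `[0, t], continuous (F N)}) ->
  (forall s : R, 0 < s <= t -> F N s @[N --> \oo] --> f s) ->
  (forall N (s : R), 0 < s <= t ->
     `|F N s| <= C * (1 + \sum_(k < N) (1 + nu k) * decay_coef s k ^+ 2)) ->
  exists I : R, [/\ forall N, leb.-integrable `[0, t]%classic (EFin \o F N),
    (\int[leb]_(s in `[0%R, t]) (f s)%:E = I%:E)%E &
    (\int[leb]_(s in `[0, t]) F N s)%R @[N --> \oo] --> I].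
Proof.
move=> /andP[t0 tT] C_ge0 cF Ff Fb; pose D := `]0%R, t]%classic : set R.
have DT : D `<=` IT by move=> s; rewrite /D /= !in_itv/= => /andP[s0 st];
  rewrite ltW//= (le_trans st).
have D0t : D `<=` `[0, t]%classic by move=> s; rewrite /D /= !in_itv/= => /andP[s0 ->]; rewrite ltW.
have mD : measurable (D : set (measurableTypeR R)) by exact: measurable_itv.
have iF N : leb.-integrable `[0, t]%classic (EFin \o F N).
  by apply: continuous_compact_integrable; [exact: segment_compact|exact: cF].
have mF N : measurable_fun D (F N).
  apply: measurable_funS D0t _ => //.
  by apply: subspace_continuous_measurable_fun; [exact: measurable_itv|exact: cF].
have mf : measurable_fun D f.
  by apply: (@measurable_fun_cvg _ _ R D F) => // s; rewrite /D /= in_itv/=; exact: Ff.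
pose g s : \bar R := (C%:E * (1 + energy_series s))%E.
have ig : leb.-integrable D g.
  apply: integrableZl => //; apply: integrableD => //.
    have i1 : leb.-integrable IT (EFin \o cst (1 : R)).
      apply: continuous_compact_integrable; first exact: segment_compact.
      by apply: continuous_subspaceT; exact: cst_continuous.
    have i2 : leb.-integrable D (EFin \o cst (1 : R)) by apply: integrableS i1 => //;
      exact: measurable_itv.
    exact: i2.
  by apply: integrableS energy_integrable => //; exact: measurable_itv.
have mFE N : measurable_fun D (EFin \o F N) by exact/measurable_EFinP.
have mfE : measurable_fun D (EFin \o f) by exact/measurable_EFinP.
have FfE : {ae leb, forall s, D s -> (EFin \o F N) s @[N --> \oo] --> (EFin \o f) s}.
  apply: aeW => s; rewrite /D /= in_itv/= => st.
  by apply: cvg_EFin; [exact: nearW|exact: Ff].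
have [|If _ lim] := @dominated_convergence _ _ _ leb D mD _ _ g mFE mfE FfE ig.
  apply: aeW => s N; rewrite /D /= in_itv/= => s0t; have [s0 st] := andP s0t.
  apply: (@le_trans _ _ (C * (1 + \sum_(k < N) (1 + nu k) * decay_coef s k ^+ 2))%:E).
    by rewrite lee_fin; exact: Fb.
  rewrite EFinM EFinD; apply: lee_wpmul2l; first by rewrite lee_fin.
  by apply: leeD => //; apply: energy_partial; exact: ltW.
have If' := integrable_fin_num mD If.
exists (fine (\int[leb]_(s in D) (f s)%:E)); split => //.
  rewrite -integral_itv_obnd_cbnd; last exact/measurable_EFinP.
  by rewrite fineK.
have -> : (fun N => (\int[leb]_(s in `[0, t]) F N s)%R) = fun N => fine (\int[leb]_(s in D) (F N
  s)%:E).
  apply/funext => N; rewrite /Rintegral -integral_itv_obnd_cbnd//; exact/measurable_EFinP.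
by apply: fine_cvg; rewrite fineK.
Qed.

Lemma coef_cont k : continuous (fun s => decay_coef s k).
Proof. by move=> s; apply: cvgM; [exact: decay_cont|exact: cvg_cst]. Qed.


Lemma combo_coef_cont (h : nat -> R -> R) N (x : R) : continuous (fun s => combo h N (decay_coef s)
  x).
Proof.
move=> s; apply: (@cvg_sumR R R 'I_N _ _ (fun k s => decay_coef s k * h k x)) => k.
by apply: cvgM; [exact: coef_cont|exact: cvg_cst].
Qed.

Section weak_identity.
Context (H Ht Hu Huu : R -> R -> R).
Hypothesis HC : is_C12 T I01 H Ht Hu Huu.
Local Notation rhoN N s := (combo e N (decay_coef s)).

Lemma modal_identity N (t : R) : 0 <= t <= T ->
  dot (rhoN N t) (H t) - \sum_(k < N) c k * dot (e k) (H 0) =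
  (\int[leb]_(s in `[0, t]) (dot (rhoN N s) (Ht s + Huu s)
    + (rhoN N s 0 * Hu s 0 - rhoN N s 1 * Hu s 1)
    - combo e1 N (decay_coef s) 0 * (H s 0 - H s 1)))%R.
Proof.
move=> tT; have /andP[t0 tT'] := tT; have eo := mode_ortho em.
have [cH cHt cHu cHuu] := test_rect HC.
pose F k s := c k * (expR (- (nu k * s)) * mode_flux e e1 H Ht Hu Huu k s).
have cF k : {within `[0, t], continuous (F k)}.
  apply: cont_withinM; first by apply: continuous_subspaceT; exact: cst_continuous.
  apply: cont_withinM; first by apply: continuous_subspaceT; exact: decay_cont.
  by apply: (cont_itv_sub tT'); exact: (mode_flux_cont T0 em HC).
transitivity (\int[leb]_(s in `[0, t]) (\sum_(k < N) F k s))%R; last first.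
  apply: eq_Rintegral => s; rewrite inE/= in_itv/= => /andP[s0 st].
  have sT : 0 <= s <= T by rewrite s0 (le_trans st).
  have LS : L2 (Ht s + Huu s).
    by apply: L2D; apply: cont01_L2; [exact: (cont_rect_slice T0 cHt sT)|exact: (cont_rect_slice T0
      cHuu sT)].
  rewrite dotC dot_combo// /combo !mulr_suml -!sumrB -big_split/= -sumrB.
  apply: eq_bigr => k _; rewrite /F /mode_flux /decay_coef (dotC (Ht s + Huu s)); ring.
rewrite Rintegral_itv_sum// dotC dot_combo//; last by apply: cont01_L2;
  exact: (cont_rect_slice T0 cH tT).
rewrite -sumrB; apply: eq_bigr => k _; rewrite /F RintegralZl//.
  by rewrite -(mode_weak T0 em HC k tT) /decay_coef (dotC (H t)); ring.
apply: continuous_compact_integrable; first exact: segment_compact.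
apply: cont_withinM; first by apply: continuous_subspaceT; exact: decay_cont.
by apply: (cont_itv_sub tT'); exact: (mode_flux_cont T0 em HC).
Qed.

Lemma bulk_limit (t : R) : 0 <= t <= T ->
  exists I : R, [/\ forall N, leb.-integrable `[0, t]%classic (EFin \o (fun s => dot (rhoN N s) (Ht
    s + Huu s))),
    (\int[leb]_(s in `[0%R, t]) (dot (heat s) (Ht s + Huu s))%:E = I%:E)%E &
    (\int[leb]_(s in `[0, t]) dot (rhoN N s) (Ht s + Huu s))%R @[N --> \oo] --> I].
Proof.
move=> tT; have /andP[t0 tT'] := tT; have eo := mode_ortho em.
have [cH cHt cHu cHuu] := test_rect HC.
have [M M0 hM] := cont_rect_bounded cHt; have [M' M0' hM'] := cont_rect_bounded cHuu.
have slice (s : R) : 0 <= s <= T -> cont01 (Ht s + Huu s).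
  by move=> sT; apply: cont01D; [exact: (cont_rect_slice T0 cHt sT)|exact: (cont_rect_slice T0 cHuu
    sT)].
have sub (s : R) : 0 <= s <= t -> 0 <= s <= T by move=> /andP[-> st]; exact: le_trans st tT'.
apply: (@decay_dct t _ _ (M + M')) => //; first by rewrite addr_ge0// ltW.
- move=> N; apply: (@subspace_eq_continuous _ _ _ (fun s => \sum_(k < N) decay_coef s k * (dot (e
    k) (Ht s) + dot (e k) (Huu s)))).
    move=> s; rewrite inE/= in_itv/= => st; rewrite /from_subspace/=.
    have sT := sub s st; rewrite dotC dot_combo//; last by apply: cont01_L2; exact: slice.
    apply: eq_bigr => k _; rewrite (dotC (Ht s + Huu s)); congr (_ * _); apply/esym/dotDr.
    + exact: cont01_L2 (cont_rect_slice T0 cHt sT).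
    + exact: cont01_L2 (cont_rect_slice T0 cHuu sT).
    + exact: mode_L2 em k.
  apply: (@cont_itv_sum N (fun k s => decay_coef s k * (dot (e k) (Ht s) + dot (e k) (Huu s)))) =>
    k.
  have [ce _] := mode_cont01 em k.
  apply: cont_withinM; first by apply: continuous_subspaceT; exact: coef_cont.
  apply: cont_withinD.
    exact: (cont_itv_sub tT' (dot_cont_time T0 cHt ce)).
  exact: (cont_itv_sub tT' (dot_cont_time T0 cHuu ce)).
- move=> s /andP[s0 st]; rewrite heatE//.
  have sT : 0 <= s <= T by apply: sub; rewrite ltW.
  by have [] := dot_modal_cvg gam0 a0 gama em (decay_smooth s0) (cont01_L2 (slice s sT)).
- move=> N s /andP[s0 st]; have sT : 0 <= s <= T by apply: sub; rewrite ltW.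
  have [cN _] := combo_cont01 em N (decay_coef s).
  apply: Rint01_le_sup.
    by apply: cont01_measurable; apply: cont01M cN _; exact: slice.
  move=> u u01; rewrite normrM mulrC; apply: ler_pM => //.
    apply: le_trans (ler_normD _ _) _; apply: lerD; [exact: hM|exact: hM'].
  exact: (combo_sup_energy gam0 a0 gama em).
Qed.

Lemma trace_heat (s x : R) : 0 < s -> 0 <= x <= 1 -> trace (heat s) x = heat s x.
Proof. by move=> s0 x01; rewrite traceE//; exact: heat_cont01. Qed.

Lemma heat_cvg (s x : R) : 0 < s -> 0 <= x <= 1 -> rhoN N s x @[N --> \oo] --> trace (heat s) x.
Proof.
move=> s0 x01; rewrite trace_heat// heatE//.
by have [] := modal_cvg gam0 a0 gama em (decay_smooth s0) x01.
Qed.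

Lemma in01_ends : 0 <= (0 : R) <= 1 /\ 0 <= (1 : R) <= 1.
Proof. by rewrite !lexx ler01. Qed.

Lemma flux_limit (t : R) : 0 <= t <= T ->
  exists I : R, [/\ forall N, leb.-integrable `[0, t]%classic
       (EFin \o (fun s => rhoN N s 0 * Hu s 0 - rhoN N s 1 * Hu s 1)),
    (\int[leb]_(s in `[0%R, t])
     (trace (heat s) 0 * Hu s 0 - trace (heat s) 1 * Hu s 1)%:E = I%:E)%E &
    (\int[leb]_(s in `[0, t]) (rhoN N s 0 * Hu s 0 - rhoN N s 1 * Hu s 1))%R @[N --> \oo] --> I].
Proof.
move=> tT; have /andP[t0 tT'] := tT; have [z0 z1] := in01_ends.
have [_ _ cHu _] := test_rect HC; have [M M0 hM] := cont_rect_bounded cHu.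
apply: (@decay_dct t _ _ (2 * M)) => //; first by rewrite mulr_ge0// ltW.
- move=> N; apply: cont_withinB; apply: cont_withinM.
  + by apply: continuous_subspaceT; exact: combo_coef_cont.
  + by apply: (cont_itv_sub tT'); exact: (cont_rect_time T0).
  + by apply: continuous_subspaceT; exact: combo_coef_cont.
  + by apply: (cont_itv_sub tT'); exact: (cont_rect_time T0).
- by move=> s /andP[s0 st]; apply: cvgB; apply: cvgM; try exact: cvg_cst; exact: heat_cvg.
- move=> N s /andP[s0 st]; have sT : 0 <= s <= T by rewrite ltW// (le_trans st).
  have h x : 0 <= x <= 1 -> `|rhoN N s x * Hu s x| <= M * (1 + \sum_(k < N) (1 + nu k) * decay_coef
    s k ^+ 2).
    move=> x01; rewrite normrM mulrC; apply: ler_pM => //; first exact: hM.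
    exact: (combo_sup_energy gam0 a0 gama em).
  apply: le_trans (ler_normB _ _) _; apply: le_trans (lerD (h 0 z0) (h 1 z1)) _.
  by rewrite -mulrA mulr_natl mulr2n.
Qed.

Lemma jump_limit (t : R) : 0 <= t <= T ->
  exists I : R, [/\ forall N, leb.-integrable `[0, t]%classic
       (EFin \o (fun s => a * (rhoN N s 0 - rhoN N s 1) * (H s 0 - H s 1))),
    (\int[leb]_(s in `[0%R, t])
     (a * (trace (heat s) 0 - trace (heat s) 1) * (H s 0 - H s 1))%:E = I%:E)%E &
    (\int[leb]_(s in `[0, t]) (a * (rhoN N s 0 - rhoN N s 1) * (H s 0 - H s 1)))%R @[N --> \oo] -->
      I].
Proof.
move=> tT; have /andP[t0 tT'] := tT; have [z0 z1] := in01_ends.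
have [cH _ _ _] := test_rect HC; have [M M0 hM] := cont_rect_bounded cH.
apply: (@decay_dct t _ _ (a * 2 * (2 * M))) => //; first by rewrite !mulr_ge0// ltW.
- move=> N; apply: cont_withinM; first apply: cont_withinM.
  + by apply: continuous_subspaceT; exact: cst_continuous.
  + by apply: continuous_subspaceT => s; apply: cvgB; exact: combo_coef_cont.
  + apply: cont_withinB.
      exact: (cont_itv_sub tT' (cont_rect_time T0 cH z0)).
    exact: (cont_itv_sub tT' (cont_rect_time T0 cH z1)).
- move=> s /andP[s0 st]; apply: cvgM; last exact: cvg_cst.
  by apply: cvgM; [exact: cvg_cst|apply: cvgB; exact: heat_cvg].
- move=> N s /andP[s0 st]; have sT : 0 <= s <= T by rewrite ltW// (le_trans st).
  have h0 := combo_sup_energy gam0 a0 gama em N (decay_coef s) z0.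
  have h1 := combo_sup_energy gam0 a0 gama em N (decay_coef s) z1.
  have k0 := hM s 0 sT z0; have k1 := hM s 1 sT z1.
  rewrite !normrM (ger0_norm a0).
  have -> (S : R) : a * 2 * (2 * M) * S = a * (2 * S) * (2 * M) by ring.
  apply: ler_pM => //; first by rewrite mulr_ge0.
    by apply: ler_wpM2l => //; apply: le_trans (ler_normB _ _) _; apply: le_trans (lerD h0 h1) _;
      rewrite mulr_natl mulr2n.
  by apply: le_trans (ler_normB _ _) _; apply: le_trans (lerD k0 k1) _; rewrite mulr_natl mulr2n.
Qed.

Lemma ends_limit (t : R) : 0 < t <= T ->
  dot (rhoN N t) (H t) - \sum_(k < N) c k * dot (e k) (H 0) @[N --> \oo] -->
  dot (heat t) (H t) - dot rho0 (H 0).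
Proof.
move=> /andP[t0 tT]; have [cH _ _ _] := test_rect HC; rewrite heatE//.
have tI : 0 <= t <= T by rewrite ltW.
have oI : 0 <= (0 : R) <= T by rewrite lexx ltW.
apply: cvgB.
  by have [] := dot_modal_cvg gam0 a0 gama em (decay_smooth t0) (cont01_L2 (cont_rect_slice T0 cH
    tI)).
exact: parseval_cvg L0 (cont_rect_slice T0 cH oI).
Qed.

End weak_identity.


Lemma heat0 : heat 0 = rho0. Proof. by rewrite /heat lexx. Qed.

(** Finite sums satisfy the identity exactly, with the initial term replaced by its partial sum,
    because their boundary condition turns e1 0 into the jump term; then N tends to infinity. The
    case a = 0 serves Neumann. *)
Lemma robin_weak (t : R) H Ht Hu Huu : gam = 1 -> t \in `[0, T] -> is_C12 T I01 H Ht Hu Huu ->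
  ((dot (heat t) (H t) - dot rho0 (H 0))%:E
   - \int[leb]_(s in `[0%R, t]) (dot (heat s) (Ht s + Huu s))%:E
   - \int[leb]_(s in `[0%R, t]) (trace (heat s) 0 * Hu s 0 - trace (heat s) 1 * Hu s 1)%:E
   + \int[leb]_(s in `[0%R, t]) (a * (trace (heat s) 0 - trace (heat s) 1) * (H s 0 - H s 1))%:E =
       0)%E.
Proof.
move=> g1; rewrite in_itv/= => tT HC; have /andP[t0 tT'] := tT.
have [t1|t1] := leP t 0.
  have -> : t = 0 by apply/eqP; rewrite eq_le t1.
  by rewrite set_itv1 !integral_set1 heat0 subrr !sube0 adde0.
have [IA [iA -> cA]] := bulk_limit HC tT; have [IB [iB -> cB]] := flux_limit HC tT.
have [IC [iC -> cC]] := jump_limit HC tT.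
have t1T : 0 < t <= T by rewrite t1.
have iAB N : leb.-integrable `[0, t]%classic (EFin \o (fun s => dot (combo e N (decay_coef s)) (Ht
  s + Huu s)
    + (combo e N (decay_coef s) 0 * Hu s 0 - combo e N (decay_coef s) 1 * Hu s 1))).
  have mt : measurable (`[0, t]%classic : set (measurableTypeR R)) by exact: measurable_itv.
  exact: (integrableD mt (iA N) (iB N)).
have E : dot (heat t) (H t) - dot rho0 (H 0) = IA + IB - IC.
  rewrite -(cvg_lim _ (ends_limit HC t1T))//; apply/cvg_lim => //.
  apply: cvg_trans (cvgB (cvgD cA cB) cC); apply: near_eq_cvg; apply: nearW => N.
  rewrite (modal_identity HC N tT) !fctE -(RintegralD _ (iA N) (iB N))//.
  rewrite -(RintegralB _ (iAB N) (iC N))//.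
  apply: eq_Rintegral => s _; congr (_ - _ * _).
  by have [_] := combo_boundary em N (decay_coef s); rewrite g1 mul1r.
by rewrite E -!EFinB -EFinD; congr EFin; ring.
Qed.

Lemma periodic_weak (t : R) H Ht Hu Huu : gam = 0 -> t \in `[0, T] -> is_C12 T setT H Ht Hu Huu ->
  (forall s : R, s \in `[0, T] -> periodic1 (H s)) ->
  ((dot (heat t) (H t) - dot rho0 (H 0))%:E
   - \int[leb]_(s in `[0%R, t]) (dot (heat s) (Ht s + Huu s))%:E = 0)%E.
Proof.
move=> g0; rewrite in_itv/= => tT HC per; have /andP[t0 tT'] := tT.
have [t1|t1] := leP t 0.
  have -> : t = 0 by apply/eqP; rewrite eq_le t1.
  by rewrite set_itv1 !integral_set1 heat0 subrr !sube0.
have HC1 : is_C12 T I01 H Ht Hu Huu.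
  have [h1 h2 h3 h4] := HC.
  have dsub F f : derivative_on setT F f -> derivative_on I01 F f.
    move=> d x x01; apply: cvg_trans (d x I) => B; rewrite /nbhs/= /within/=.
    by apply: filterS => y hy _; exact: hy.
  split; [by move=> u _; exact: h1|by move=> s sT; apply: dsub; exact: h2|
          by move=> s sT; apply: dsub; exact: h3|].
  move=> F hF; apply: continuous_subspaceW (h4 F hF) => -[s u] /= [sT _]; split => //.
have [IA [iA -> cA]] := bulk_limit HC1 tT.
have t1T : 0 < t <= T by rewrite t1.
(* [modal_identity] carries end terms that the periodic formulation does not have. They cancel once
   H and its space derivative match at 0 and 1; the latter comes from differentiating H (u + 1) = H
   u. *)
have Hper (s : R) : 0 <= s <= T -> H s 1 = H s 0 /\ Hu s 1 = Hu s 0.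
  move=> sT; have sT' : s \in `[0, T] by rewrite in_itv.
  split; first by have := per s sT' 0; rewrite add0r.
  have [_ h2 _ _] := HC.
  have d0 : is_derive (0 : R) 1 (H s) (Hu s 0).
    by apply: derivative_on_is_derive (h2 s sT'); exact: filterT.
  have d1 : is_derive (0 + 1 : R) 1 (H s) (Hu s 1).
    by rewrite add0r; apply: derivative_on_is_derive (h2 s sT'); exact: filterT.
  have ds : is_derive (0 : R) 1 (fun u => u + 1) (1 : R).
    by apply: (is_derive_eq (is_derive_addf (is_derive_id (0 : R) 1) (is_derive_cst (1 : R) (0 : R)
      1))); rewrite addr0.
  have d2 := @is_derive1_comp _ (H s) (fun u => u + 1) 0 _ _ d1 ds.
  have E : H s \o (fun u => u + 1) = H s by apply/funext => u; exact: per.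
  rewrite E mulr1 in d2; have e0 := @derive_val _ _ _ _ _ _ _ d0.
  by have := @derive_val _ _ _ _ _ _ _ d2; rewrite e0.
have E : dot (heat t) (H t) - dot rho0 (H 0) = IA.
  rewrite -(cvg_lim _ (ends_limit HC1 t1T))//; apply/cvg_lim => //.
  apply: cvg_trans cA; apply: near_eq_cvg; apply: nearW => N.
  rewrite (modal_identity HC1 N tT); apply: eq_Rintegral => s;
    rewrite inE/= in_itv/= => /andP[s0 st].
  have [-> ->] : H s 1 = H s 0 /\ Hu s 1 = Hu s 0 by apply: Hper; rewrite s0 (le_trans st).
  (* With gam = 0 the condition reads a (w 0 - w 1) = 0 and a is nonzero, so the partial sums agree
     at 0 and 1. *)
  have [_] := combo_boundary em N (decay_coef s); rewrite g0 mul0r => /esym/eqP.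
  rewrite mulf_eq0 => /orP[/eqP az|/eqP hz]; first by have := gama; rewrite g0 az addr0 ltxx.
  have -> : combo e N (decay_coef s) 1 = combo e N (decay_coef s) 0.
    by apply/esym/eqP; rewrite -subr_eq0 hz.
  by ring.
by rewrite E -EFinB subrr.
Qed.

Lemma heat_joint_measurable :
  measurable_fun (`[0, T] `*` `[0, 1] : set (R * R)) (fun p : R * R => heat p.1 p.2).
Proof.
have mI : measurable (I01 : set R) by exact: measurable_itv.
have -> : (`[0, T] `*` `[0, 1] : set (R * R)) = ([set 0] `*` `[0, 1]) `|` (`]0, T] `*` `[0, 1]).
  apply/seteqP; split => -[s u] /=.
    rewrite !in_itv/= => -[/andP[s0 sT] u01].
    by have [z|z] := eqVneq s 0; [left|right; rewrite lt_neqAle eq_sym z s0 sT].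
  rewrite !in_itv/= => -[[-> ->]|[/andP[s0 ->] ->]]; first by rewrite lexx ltW.
  by rewrite ltW.
apply/measurable_funU; [by apply: measurableX => //; exact: measurable_itv|
  by apply: measurableX => //; exact: measurable_itv|split].
  have m0 : measurable_fun I01 rho0 by have [] := L0.
  apply: (@eq_measurable_fun _ _ _ _ _ (rho0 \o snd)).
    by move=> [s u]; rewrite inE/= => -[-> _]; rewrite heat0.
  apply: (@measurable_comp _ _ _ _ _ _ I01) => //.
    by move=> _ [[s u] [_ u01] <-].
  by apply: measurable_funTS; exact: measurable_snd.
apply: (@measurable_fun_cvg _ _ R _ (fun N (p : R * R) => combo e N (decay_coef p.1) p.2)).
  move=> N; apply: measurable_funTS; apply: measurable_sum => k; apply: measurable_funM.
    apply: (@measurableT_comp _ _ _ _ _ _ (fun s => decay_coef s k)); last exact: measurable_fst.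
    by apply: continuous_measurable_fun; exact: coef_cont.
  apply: (@measurableT_comp _ _ _ _ _ _ (e k)); last exact: measurable_snd.
  by apply: continuous_measurable_fun; exact: mode_cont em k.
move=> [s u] /=; rewrite !in_itv/= => -[/andP[s0 sT] u01]; rewrite heatE//.
by have [] := modal_cvg gam0 a0 gama em (decay_smooth s0) u01.
Qed.

Lemma heat_H1norm_sqr (s : R) : 0 < s -> H1norm (heat s) ^+ 2 =
  dot (modal e (decay_coef s)) (modal e (decay_coef s)) + dot (modal e1 (decay_coef s)) (modal e1
    (decay_coef s)).
Proof.
move=> s0; rewrite (H1normE (heat_weak_derivative s0)) sqr_sqrtr; last by rewrite addr_ge0 ?dot_ge0.
by rewrite heatE.
Qed.

Lemma heat_L2_H1 : L2_H1 T heat.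
Proof.
pose A := `]0%R, T]%classic : set R.
have Apos s : A s -> 0 < s by rewrite /A /= in_itv/= => /andP[].
have mA : measurable (A : set (measurableTypeR R)) by exact: measurable_itv.
have AH s : A s -> H1 (heat s).
  by move=> /Apos s0; exact: cont01_H1 (heat_cont01 s0) (heat_weak_derivative s0).
exists A; split => //.
- by move=> s; rewrite /A /= !in_itv/= => /andP[s0 ->]; rewrite ltW.
- rewrite (_ : _ `\` _ = [set 0]); first exact: lebesgue_measure_set1.
  apply/seteqP; split => s /=; rewrite /A /= !in_itv/=.
    by move=> [/andP[s0 ->] /negP]; rewrite andbT -leNgt => s1; apply/eqP; rewrite eq_le s0 s1.
  by move=> ->; rewrite lexx ltxx ltW.
split.
(* V is open in the time variable by its very form. On positive times it equals the preimage of U by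
   the Lipschitz bound [H1norm_heatB], used near s with r = s / 2. *)
- move=> U Uo; pose V := [set s : R | exists t r : R, [/\ 0 < r, `|s - t| < r &
    forall s' : R, `|s' - t| < r -> 0 < s' -> U (heat s')]].
  have -> : A `&` [set t | U (heat t)] = A `&` V.
    apply/seteqP; split => s [As h]; split => //; last first.
      by have [t [r [r0 st hU]]] := h; exact: hU st (Apos s As).
    have s0 := Apos s As; have [r r0 hr] := Uo (heat s) (AH s As) h.
    set K := (1 + (s / 2 / 2)^-1) ^+ 2 * Num.sqrt C0 + 1.
    have K0 : 0 < K by rewrite ltr_wpDl// mulr_ge0 ?sqr_ge0 ?sqrtr_ge0.
    exists s, (Num.min (s / 2) (r / K)); split.
    + by rewrite lt_min !divr_gt0.
    + by rewrite subrr normr0 lt_min !divr_gt0.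
    + move=> s'; rewrite lt_min => /andP[d1 d2] s'0.
      apply: hr.
        exact: cont01_H1 (heat_cont01 s'0) (heat_weak_derivative s'0).
      have h2 : 0 < s / 2 by rewrite divr_gt0.
      have r1 : s / 2 <= s by lra.
      have r2 : s / 2 <= s' by move: d1; rewrite ltr_norml; lra.
      apply: le_lt_trans (H1norm_heatB h2 r1 r2) _.
      rewrite ltr_pdivlMr// in d2; apply: le_lt_trans d2.
      by apply: ler_wpM2l => //; rewrite /K lerDl.
  apply: measurableI => //; apply: open_measurable.
  rewrite openE => s [t [r [r0 st hU]]]; rewrite /interior.
  have d0 : 0 < r - `|s - t| by rewrite subr_gt0.
  apply: filterS (nbhsx_ballx s _ d0) => y; rewrite /ball/= => sy.
  exists t, r; split => //.
  have -> : y - t = (s - t) - (s - y) by ring.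
  by apply: le_lt_trans (ler_normB _ _) _; rewrite -ltrBrDl.
have mE : measurable_fun A energy_series.
  have /integrableP[mE _] := energy_integrable.
  by apply: measurable_funS mE => // s; rewrite /A /= !in_itv/= => /andP[s0 ->]; rewrite ltW.
apply: (@le_lt_trans _ _ (\int[leb]_(s in IT) energy_series s)%E); last first.
  have /integrableP[_] := energy_integrable.
  apply: le_lt_trans; rewrite le_eqVlt; apply/orP; left; apply/eqP.
  apply: eq_integral => s _; rewrite gee0_abs//.
  by apply: nneseries_ge0 => k _ _; rewrite lee_fin energy_term_ge0.
apply: (@le_trans _ _ (\int[leb]_(s in A) energy_series s)%E); last first.
  apply: ge0_subset_integral => //.
  - by have /integrableP[mE' _] := energy_integrable.
  - by move=> s _; apply: nneseries_ge0 => k _ _; rewrite lee_fin energy_term_ge0.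
  - by move=> s; rewrite /A /= !in_itv/= => /andP[s0 ->]; rewrite ltW.
apply: ge0_le_integral => //.
- by move=> s _; rewrite lee_fin sqr_ge0.
- apply/measurable_EFinP.
  apply: (@measurable_fun_cvg _ _ R A (fun N s => dot (combo e N (decay_coef s)) (combo e N
    (decay_coef s))
    + dot (combo e1 N (decay_coef s)) (combo e1 N (decay_coef s)))).
    move=> N; apply: measurable_funTS; apply: continuous_measurable_fun.
    have quad (h : nat -> R -> R) : (forall k, L2 (h k)) ->
        continuous (fun s => dot (combo h N (decay_coef s)) (combo h N (decay_coef s))).
      move=> Lh; have Lc s : L2 (combo h N (decay_coef s)) by apply: L2_sum => k; exact: L2Z.
      have -> : (fun s => dot (combo h N (decay_coef s)) (combo h N (decay_coef s))) =
          fun s => \sum_(i < N) decay_coef s i * \sum_(j < N) decay_coef s j * dot (h i) (h j).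
        apply/funext => s; rewrite [in X in dot X _]/combo dot_suml//; last by move=> i; exact: L2Z.
        apply: eq_bigr => i _; rewrite dotZl//; congr (_ * _).
        rewrite dot_sumr//; last by move=> j; exact: L2Z.
        by apply: eq_bigr => j _; rewrite dotZr.
      move=> s; apply: (@cvg_sumR R R 'I_N _ _
        (fun i s => decay_coef s i * \sum_(j < N) decay_coef s j * dot (h i) (h j))) => i.
      apply: cvgM; first exact: coef_cont.
      apply: (@cvg_sumR R R 'I_N _ _ (fun j s => decay_coef s j * dot (h i) (h j))) => j.
      by apply: cvgM; [exact: coef_cont|exact: cvg_cst].
    move=> s; apply: cvgD; first by apply: quad => k; exact: mode_L2 em k.
    by apply: quad => k; apply: cont01_L2; have [] := mode_cont01 em k.
  move=> s /Apos s0; rewrite heat_H1norm_sqr//.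
  exact: (modal_norm_cvg gam0 a0 gama em (decay_smooth s0)).
- move=> s /Apos s0; rewrite heat_H1norm_sqr//.
  have := energy_partial _ (ltW s0).
  case: (energy_series s) => [x| |] hx; [|exact: leey|by have := hx 0%N].
  rewrite lee_fin; apply: (modal_energy gam0 a0 gama em (decay_smooth s0)) => N.
  by have := hx N; rewrite lee_fin.
Qed.

Lemma heat_periodic_solution : gam = 0 -> periodic_solution T rho0 heat.
Proof.
move=> g0; split; [exact: heat_joint_measurable|by move=> t _; exact: heat_L2|].
by move=> t H Ht Hu Huu tT HC per; exact: (periodic_weak g0 tT HC per).
Qed.

Lemma heat_robin_solution : gam = 1 -> robin_solution a T rho0 heat.
Proof.
move=> g1; split; [exact: heat_L2_H1|by move=> t _; exact: heat_L2|].
by move=> t H Ht Hu Huu tT HC; exact: (robin_weak g1 tT HC).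
Qed.

Lemma heat_neumann_solution : gam = 1 -> a = 0 -> neumann_solution T rho0 heat.
Proof.
move=> g1 az; split; [exact: heat_L2_H1|by move=> t _; exact: heat_L2|].
move=> t H Ht Hu Huu tT HC; have := robin_weak g1 tT HC.
have -> : (\int[leb]_(s in `[0%R, t]) (a * (trace (heat s) 0 - trace (heat s) 1) * (H s 0 - H s
  1))%:E = 0)%E.
  by apply: integral0_eq => s _; rewrite az !mul0r.
by rewrite adde0.
Qed.

End time.
End modes.
End heat.

(** * The particle system *)

Section semigroup.
Context {R : realType} (n : nat).
Implicit Types (f g : config n -> R) (eta zeta xi : config n).

Definition bounded_generator (L : (config n -> R) -> config n -> R) :=
  [/\ forall (c : R) f g, L (fun eta => c * f eta + g eta) = (fun eta => c * L f eta + L g eta),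
      exists2 K : R, 0 <= K & forall f (M : R), (forall eta, `|f eta| <= M) -> forall eta, `|L f
        eta| <= K * M
    & L (fun=> 1) = (fun=> 0)].

Context (L : (config n -> R) -> config n -> R).
Hypothesis bL : bounded_generator L.

Lemma config_bound f : exists2 M : R, 0 <= M & forall eta, `|f eta| <= M.
Proof.
exists (\sum_eta `|f eta|); first exact: sumr_ge0.
by move=> eta; rewrite (bigD1 eta)//= lerDl sumr_ge0.
Qed.

Lemma gen_lin (c : R) f g : L (fun eta => c * f eta + g eta) = (fun eta => c * L f eta + L g eta).
Proof. by case: bL. Qed.

Lemma gen0 : L (fun=> 0) = (fun=> 0).
Proof.
have := gen_lin (-1) (fun=> 0) (fun=> 0).
have -> : (fun eta : config n => -1 * 0 + 0) = (fun=> 0 : R) by apply/funext => eta;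
  rewrite mulr0 addr0.
by move=> E; apply/funext => eta; move: (congr1 (@^~ eta) E); rewrite mulN1r addNr.
Qed.

(** Coefficients of the semigroup as a power series in t: termwise differentiation then yields that
    the derivative of S_t f is S_t (L f). *)
Definition gen_coef f eta (k : nat) : R := iter k L f eta / k`!%:R.

Lemma gen_coef_diffs f eta : pseries_diffs (gen_coef f eta) = gen_coef (L f) eta.
Proof.
apply/funext => k; rewrite /pseries_diffs /gen_coef -iterSr factS natrM invfM mulrCA.
by congr (_ * _); rewrite mulVKf// pnatr_eq0.
Qed.

Lemma gen_coef_cvg f eta (t : R) : cvgn (pseries (gen_coef f eta) t).
Proof.
have [_ [K K0 hK] _] := bL; have [M M0 hM] := config_bound f.
have it k : forall eta, `|iter k L f eta| <= K ^+ k * M.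
  by elim: k => [|k IH] zeta; [rewrite mul1r|rewrite iterS exprS -mulrA; exact: hK].
apply: normed_cvg; apply: (@series_le_cvg R _ (fun k => M * exp_coeff (K * `|t|) k)).
- by move=> k; exact: normr_ge0.
- by move=> k; rewrite mulr_ge0// exp_coeff_ge0// mulr_ge0.
- move=> k; rewrite /gen_coef /exp_coeff /= !normrM normrX exprMn.
  rewrite normfV (ger0_norm (ler0n _ _)).
  have -> : M * (K ^+ k * `|t| ^+ k / k`!%:R) = K ^+ k * M * ((k`!%:R)^-1 * `|t| ^+ k) by ring.
  by rewrite -mulrA; apply: ler_wpM2r => //; rewrite mulr_ge0 ?exprn_ge0// invr_ge0 ler0n.
- rewrite [X in cvgn X](_ : _ = M *: series (exp_coeff (K * `|t|))).
    by apply: is_cvgZr; exact: is_cvg_series_exp_coeff.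
  by apply/funext => k; rewrite /series /= -mulr_sumr.
Qed.

Lemma semigroupE (t : R) f eta : semigroup L t f eta = limn (pseries (gen_coef f eta) t).
Proof.
rewrite /semigroup /pseries; congr (limn (series _)); apply/funext => k.
change (t ^+ k / k`!%:R * iter k L f eta = iter k L f eta / k`!%:R * t ^+ k); ring.
Qed.

Lemma semigroup_derive f eta (t : R) :
  is_derive t 1 (fun t => semigroup L t f eta) (semigroup L t (L f) eta).
Proof.
rewrite semigroupE -gen_coef_diffs.
have -> : (fun t => semigroup L t f eta) = (fun t => limn (pseries (gen_coef f eta) t)).
  by apply/funext => s; exact: semigroupE.
apply: (@pseries_snd_diffs _ _ (`|t| + 1)); rewrite ?gen_coef_diffs; try exact: gen_coef_cvg.
by rewrite [ltRHS]ger0_norm ?ltrDl// addr_ge0.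
Qed.

Lemma semigroup_lin (c t : R) f g eta :
  semigroup L t (fun eta => c * f eta + g eta) eta = c * semigroup L t f eta + semigroup L t g eta.
Proof.
have itl k : iter k L (fun eta => c * f eta + g eta) = fun eta => c * iter k L f eta + iter k L g
  eta.
  by elim: k => [|k IH] //; rewrite !iterS IH gen_lin.
rewrite !semigroupE; apply/cvg_lim => //.
have -> : pseries (gen_coef (fun eta => c * f eta + g eta) eta) t =
  (fun N => c * pseries (gen_coef f eta) t N + pseries (gen_coef g eta) t N).
  apply/funext => N; rewrite /pseries /series /= mulr_sumr -big_split/=.
  by apply: eq_bigr => k _; rewrite /gen_coef itl; ring.
by apply: cvgD; [apply: cvgM; [exact: cvg_cst|exact: gen_coef_cvg]|exact: gen_coef_cvg].
Qed.

Lemma semigroup_fixed (t : R) f eta : L f = (fun=> 0) -> semigroup L t f eta = f eta.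
Proof.
move=> Lf; rewrite semigroupE; apply/cvg_lim => //; apply: cvg_near_cst.
exists 1%N => // -[//|N] _ /=; rewrite /pseries /series /= big_nat_recl//= big1 ?addr0.
  by rewrite /gen_coef /= fact0 invr1 expr0 !mulr1.
move=> k _; rewrite /gen_coef iterSr Lf.
have -> : iter k L (fun=> 0) = fun=> 0 by elim: k => // k IH; rewrite iterS IH gen0.
by rewrite !mul0r.
Qed.

Lemma semigroup1 (t : R) eta : semigroup L t (fun=> 1) eta = 1.
Proof. by apply: semigroup_fixed; case: bL. Qed.

Lemma semigroup_zero (t : R) eta : semigroup L t (fun=> 0) eta = 0.
Proof. exact: semigroup_fixed gen0. Qed.

Lemma semigroup_at0 f eta : semigroup L 0 f eta = f eta.
Proof.
rewrite semigroupE; apply/cvg_lim => //; apply: cvg_near_cst.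
exists 1%N => // -[//|N] _ /=; rewrite /pseries /series /= big_nat_recl//= big1 ?addr0.
  by rewrite /gen_coef /= fact0 invr1 expr0 !mulr1.
by move=> k _; rewrite expr0n mulr0.
Qed.

Lemma semigroup_sum (I : Type) (r : seq I) (w : I -> R) (F : I -> config n -> R) (t : R) eta :
  semigroup L t (fun eta => \sum_(i <- r) w i * F i eta) eta = \sum_(i <- r) w i * semigroup L t (F
    i) eta.
Proof.
elim: r => [|i r IH].
  rewrite big_nil (_ : (fun _ => _) = (fun=> 0)) ?semigroup_zero//.
  by apply/funext => zeta; rewrite big_nil.
rewrite big_cons -IH -semigroup_lin; congr (semigroup L t _ eta).
by apply/funext => zeta; rewrite big_cons.
Qed.

Lemma semigroup_transition (t : R) f zeta :
  semigroup L t f zeta = \sum_xi f xi * transition L t zeta xi.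
Proof.
rewrite /transition -semigroup_sum; congr (semigroup L t _ zeta); apply/funext => eta.
rewrite (bigD1 eta)//= eqxx mulr1 big1 ?addr0// => xi /negbTE.
by rewrite eq_sym => ->; rewrite mulr0.
Qed.

Section from_state.
Context (zeta : config n).
(* Positivity is only available at the states zeta charged by the initial law, where the transition
   is a conditional probability. *)
Hypothesis pos : forall (t : R) xi, 0 <= t -> 0 <= transition L t zeta xi.

Lemma semigroup_mono (t : R) f g : 0 <= t -> (forall eta, f eta <= g eta) ->
  semigroup L t f zeta <= semigroup L t g zeta.
Proof.
move=> t0 fg; rewrite !semigroup_transition; apply: ler_sum => xi _.
by apply: ler_wpM2r; [exact: pos|exact: fg].
Qed.

(* Dynkin's computation for (F - e^{-nu t} F(zeta))^2; the drift of F is -nu F up to eps. *)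
Lemma mode_variance (F : config n -> R) (nu eps gam B t : R) : 0 <= nu -> 0 <= t ->
  (forall eta, `|L F eta + nu * F eta| <= eps) -> (forall eta, `|F eta| <= B) ->
  (forall eta, L (fun eta => F eta ^+ 2) eta - 2 * F eta * L F eta <= gam) ->
  semigroup L t (fun eta => (F eta - expR (- (nu * t)) * F zeta) ^+ 2) zeta <= (gam + 4 * B * eps)
    * t.
Proof.
move=> nu0 t0 hd hB hG; set S := fun (t : R) f => semigroup L t f zeta.
pose d (s : R) := expR (- (nu * s)) * F zeta.
pose D (s : R) := S s (fun eta => F eta ^+ 2) + (d s) ^+ 2 - 2 * d s * S s F.
have B0 : 0 <= B := le_trans (normr_ge0 _) (hB zeta).
have eps0 : 0 <= eps := le_trans (normr_ge0 _) (hd zeta).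
have DE s : S s (fun eta => (F eta - d s) ^+ 2) = D s.
  have -> : (fun eta => (F eta - d s) ^+ 2) =
      (fun eta => (- 2 * d s) * F eta + (1 * F eta ^+ 2 + d s ^+ 2 * 1)).
    by apply/funext => eta; ring.
  rewrite /S semigroup_lin semigroup_lin.
  have := semigroup_lin (d s ^+ 2) s (fun=> 1) (fun=> 0) zeta.
  under eq_fun do rewrite addr0; rewrite semigroup1 semigroup_zero => ->.
  by rewrite /D /S; ring.
have dD (s : R) : is_derive s 1 D (S s (L (fun eta => F eta ^+ 2)) + 2 * d s * (- nu * d s)
    - 2 * (d s * S s (L F) + (- nu * d s) * S s F)).
  have dd : is_derive s 1 d (- nu * d s).
    have d1 : is_derive s 1 (fun s => - (nu * s)) (- nu).
      by apply: (is_derive_eq (is_deriveN (is_derive_scalef nu (is_derive_id s 1)))); rewrite mulr1.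
    have d2 : is_derive s 1 (fun s => expR (- (nu * s))) _ :=
      @is_derive1_comp _ expR (fun s => - (nu * s)) s _ _ (is_derive_expR (- (nu * s))) d1.
    have d3 : is_derive s 1 d _ := is_derive_mulf d2 (is_derive_cst (F zeta) s 1).
    by apply: (is_derive_eq d3); rewrite /d mulr0 add0r /=; ring.
  have dq := is_derive_mulf dd dd; have dS := is_derive_mulf dd (semigroup_derive F zeta s).
  have dA := is_derive_subf (is_derive_addf (semigroup_derive (fun eta => F eta ^+ 2) zeta s) dq)
    (is_derive_scalef 2 dS).
  have -> : D = fun u => semigroup L u (fun eta => F eta ^+ 2) zeta + d u * d u - 2 * (d u *
    semigroup L u F zeta).
    by apply/funext => u; rewrite /D /S; ring.
  by apply: (is_derive_eq dA); rewrite /S; ring.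
(* The computation gives D' <= gam + 4 B eps - 2 nu D, and D >= 0 lets the last term go. Here 4 B
   eps bounds 2 (F - d) (L F + nu F), as |F - d| <= 2 B. *)
have bound (s : R) : 0 <= s -> S s (L (fun eta => F eta ^+ 2)) + 2 * d s * (- nu * d s)
    - 2 * (d s * S s (L F) + (- nu * d s) * S s F) <= gam + 4 * B * eps.
  move=> s0; have dB : `|d s| <= B.
    rewrite /d normrM (ger0_norm (expR_ge0 _)) -[leRHS]mul1r ler_pM ?expR_ge0//.
    by rewrite expR_le1 oppr_le0 mulr_ge0.
  have D0 : 0 <= D s.
    rewrite -DE -(semigroup_zero s zeta); apply: semigroup_mono => // eta; exact: sqr_ge0.
  have step1 : S s (L (fun eta => F eta ^+ 2)) <=
      S s (fun eta => (2 * d s) * L F eta + ((- 2 * nu) * F eta ^+ 2 +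
        ((2 * d s * nu) * F eta + (gam + 4 * B * eps) * 1))).
    apply: semigroup_mono => // eta.
    have h1 := hG eta; have h2 := hd eta.
    have h3 : 2 * ((F eta - d s) * (L F eta + nu * F eta)) <= 4 * B * eps.
      have : `|(F eta - d s) * (L F eta + nu * F eta)| <= (B + B) * eps.
        rewrite normrM ler_pM//; apply: le_trans (ler_normB _ _) _; exact: lerD.
      by move=> /(le_trans (ler_norm _)); lra.
    by move: h1 h3; lra.
  move: step1; rewrite /S !semigroup_lin.
  have -> : semigroup L s (fun eta => (gam + 4 * B * eps) * 1) zeta = gam + 4 * B * eps.
    have := semigroup_lin (gam + 4 * B * eps) s (fun=> 1) (fun=> 0) zeta.
    by under eq_fun do rewrite addr0; rewrite semigroup1 semigroup_zero => ->; ring.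
  rewrite -/(S s (fun eta => F eta ^+ 2)) -/(S s (L (fun eta => F eta ^+ 2))) -/(S s (L F)) -/(S s
    F) => step1.
  have : 0 <= nu * D s by rewrite mulr_ge0.
  by rewrite /D; move: step1; lra.
have D00 : D 0 = 0.
  by rewrite -DE /S semigroup_at0 /d mulr0 oppr0 expR0 mul1r subrr expr0n.
have cD : {within `[0, t], continuous D}.
  by apply: continuous_subspaceT => s; have [/derivable1_diffP/differentiable_continuous] := dD s.
have [c] := MVT_segment t0 (fun x _ => dD x) cD.
rewrite in_itv/= D00 !subr0 => /andP[c0 _] E.
change (S t (fun eta => (F eta - d t) ^+ 2) <= (gam + 4 * B * eps) * t).
by rewrite DE E; apply: ler_wpM2r => //; exact: bound.
Qed.

End from_state.
End semigroup.

(** * The exclusion generator on weighted occupations *)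

Section exclusion.
Context {R : realType} (alpha : R) (beta : \bar R) (n : nat).
Implicit Types (f g : config n -> R) (eta : config n).
Local Notation L := (@speeded_gen R alpha beta n).
Local Notation r := (@rate R alpha beta n).

Lemma speeded_genE f eta : L f eta = n%:R ^+ 2 * \sum_(x < n) r x * (f (exchange x eta) - f eta).
Proof. by []. Qed.

Lemma speeded_gen_bounded : bounded_generator L.
Proof.
split.
- move=> c f g; apply/funext => eta; rewrite !speeded_genE mulrCA -mulrDr; congr (_ * _).
  by rewrite mulr_sumr -big_split/=; apply: eq_bigr => x _; ring.
- exists (n%:R ^+ 2 * ((\sum_(x < n) `|r x|) * 2)).
    by rewrite !mulr_ge0 ?sqr_ge0//; apply: sumr_ge0.
  move=> f M hM eta; rewrite speeded_genE normrM (ger0_norm (sqr_ge0 _)).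
  rewrite [leRHS](_ : _ = n%:R ^+ 2 * ((\sum_(x < n) `|r x|) * (2 * M))); last by ring.
  apply: ler_wpM2l; first exact: sqr_ge0.
  apply: le_trans (ler_norm_sum _ _ _) _; rewrite mulr_suml; apply: ler_sum => x _.
  rewrite normrM; apply: ler_wpM2l => //; apply: le_trans (ler_normB _ _) _.
  by apply: le_trans (lerD (hM _) (hM _)) _; rewrite mulr_natl mulr2n.
- by apply/funext => eta; rewrite speeded_genE big1 ?mulr0// => x _; rewrite subrr mulr0.
Qed.

Definition weighted (h : 'I_n -> R) eta : R := n%:R^-1 * \sum_(x < n) h x * (eta x)%:R.

Lemma weighted_exchange h (x : 'I_n) eta : weighted h (exchange x eta) - weighted h eta =
  n%:R^-1 * ((h (ordS x) - h x) * ((eta x)%:R - (eta (ordS x))%:R)).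
Proof.
rewrite /weighted -mulrBr; congr (_ * _).
rewrite (reindex_inj (@perm_inj _ (tperm x (ordS x))))/= -sumrB.
have -> : \sum_(i < n) (h (tperm x (ordS x) i) * (exchange x eta (tperm x (ordS x) i))%:R - h i *
  (eta i)%:R)
   = \sum_(i < n) (h (tperm x (ordS x) i) - h i) * (eta i)%:R.
  by apply: eq_bigr => i _; rewrite ffunE tpermK; ring.
(* On the ring with a single site the bond joins the site to itself, and both sides vanish. *)
have [E|xS] := eqVneq (ordS x) x.
  rewrite E subrr mul0r big1// => i _.
  by rewrite tperm1 perm1 subrr mul0r.
rewrite (bigD1 x)//= (bigD1 (ordS x))//= tpermL tpermR big1 ?addr0; last first.
  by move=> i /andP[ix iS]; rewrite tpermD 1?eq_sym// subrr mul0r.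
by ring.
Qed.

Lemma weighted_gen h eta :
  L (weighted h) eta = \sum_(x < n) n%:R * (r x * (h (ordS x) - h x)) * ((eta x)%:R - (eta (ordS
    x))%:R).
Proof.
rewrite speeded_genE mulr_sumr; apply: eq_bigr => x _; rewrite weighted_exchange.
have n0 : n%:R != 0 :> R by rewrite pnatr_eq0 -lt0n; case: (x) => m; case: (n).
by field.
Qed.

Lemma carre_du_champ f eta : L (fun eta => f eta ^+ 2) eta - 2 * f eta * L f eta =
  n%:R ^+ 2 * \sum_(x < n) r x * (f (exchange x eta) - f eta) ^+ 2.
Proof.
rewrite !speeded_genE mulrCA -mulrBr mulr_sumr -sumrB; congr (_ * _).
by apply: eq_bigr => x _; ring.
Qed.

Lemma occupation_diff (a b : bool) : ((a%:R - b%:R : R) ^+ 2) <= 1.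
Proof. by case: a; case: b; rewrite ?subrr ?subr0 ?sub0r ?sqrrN ?expr1n ?expr0n//= ?ler01. Qed.

Lemma weighted_champ h eta : (forall x, 0 <= r x) ->
  L (fun eta => weighted h eta ^+ 2) eta - 2 * weighted h eta * L (weighted h) eta <=
  \sum_(x < n) r x * (h (ordS x) - h x) ^+ 2.
Proof.
move=> r0; rewrite carre_du_champ mulr_sumr; apply: ler_sum => x _; rewrite weighted_exchange.
have n0 : n%:R != 0 :> R by rewrite pnatr_eq0 -lt0n; case: (x) => m; case: (n).
have -> : n%:R ^+ 2 * (r x * (n%:R^-1 * ((h (ordS x) - h x) * ((eta x)%:R - (eta (ordS x))%:R))) ^+
  2) =
  r x * (h (ordS x) - h x) ^+ 2 * ((eta x)%:R - (eta (ordS x))%:R) ^+ 2 by field.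
by rewrite ler_piMr ?occupation_diff// mulr_ge0 ?sqr_ge0.
Qed.

Lemma mean_le (w : 'I_n -> R) (B : R) : 0 <= B -> (forall x, `|w x| <= B) ->
  `|n%:R^-1 * \sum_(x < n) w x| <= B.
Proof.
move=> B0 wB; rewrite normrM ger0_norm ?invr_ge0//.
have [n0|n0] := posnP n.
  by rewrite (_ : n%:R = 0 :> R) ?n0// invr0 mul0r.
rewrite mulrC ler_pdivrMr ?ltr0n//; apply: le_trans (ler_norm_sum _ _ _) _.
apply: (@le_trans _ _ (\sum_(x < n) B)); first exact: ler_sum.
by rewrite sumr_const card_ord mulr_natr.
Qed.

Lemma weighted_bound h (B : R) eta : 0 <= B -> (forall x, `|h x| <= B) -> `|weighted h eta| <= B.
Proof.
move=> B0 hB; apply: mean_le => // x; rewrite normrM.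
by case: (eta x); rewrite ?normr1 ?mulr1// normr0 mulr0.
Qed.

Lemma weighted_diff h h' (B : R) eta : 0 <= B -> (forall x, `|h x - h' x| <= B) ->
  `|weighted h eta - weighted h' eta| <= B.
Proof.
move=> B0 hB; have -> : weighted h eta - weighted h' eta = weighted (fun x => h x - h' x) eta.
  by rewrite /weighted -mulrBr -sumrB; congr (_ * _); apply: eq_bigr => x _; ring.
exact: weighted_bound.
Qed.

Section profile.
Context (e e1 : R -> R) (nu M xi : R).
Hypotheses (de : forall u : R, is_derive u 1 e (e1 u)) (de1 : forall u : R, is_derive u 1 e1 (- nu
  * e u)).
Hypotheses (nu0 : 0 <= nu) (e1_ends : e1 0 = e1 1) (M0 : 0 <= M).
Hypothesis eM : forall u : R, 0 <= u <= 1 -> `|e u| <= M /\ `|e1 u| <= M.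
Hypotheses (n2 : (1 < n)%N) (xi0 : 0 <= xi).
Hypothesis rE : forall x : 'I_n, r x = if x.+1 == n then xi else 1.

Let n_gt0 : 0 < n%:R :> R. Proof. by rewrite ltr0n; apply: ltn_trans n2. Qed.
Let n_neq0 : n%:R != 0 :> R. Proof. by rewrite gt_eqF. Qed.

Let n_inv0 : 0 <= n%:R^-1 :> R. Proof. by rewrite invr_ge0 ltW. Qed.

Local Notation node j := (j%:R / n%:R : R).

Lemma node_in j : (j <= n)%N -> 0 <= node j <= 1.
Proof. by move=> jn; rewrite divr_ge0//= ler_pdivrMr// mul1r ler_nat. Qed.

Lemma node_step j : node j.+1 - node j = n%:R^-1.
Proof. by rewrite -mulrBl -natrB// subSnn mul1r. Qed.

Lemma step_MVT F (f : R -> R) j : (forall u : R, is_derive u 1 F (f u)) -> (j < n)%N ->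
  exists c : R, [/\ node j <= c <= node j.+1, 0 <= c <= 1 & F (node j.+1) - F (node j) = f c /
    n%:R].
Proof.
move=> dF jn; have /andP[j0 _] := node_in (ltnW jn); have /andP[_ j1] := node_in jn.
have le : node j <= node j.+1 by rewrite -subr_ge0 node_step invr_ge0.
have [c /andP[c0 c1] E] := deriv01_MVT (fun x _ => dF x) j0 le j1.
by exists c; rewrite E node_step c0 c1 (le_trans j0 c0) (le_trans c1 j1).
Qed.

Lemma lip_MVT F (f : R -> R) (K x y : R) : (forall u : R, is_derive u 1 F (f u)) ->
  (forall u : R, 0 <= u <= 1 -> `|f u| <= K) -> 0 <= x <= 1 -> 0 <= y <= 1 -> `|F y - F x| <= K *
    `|y - x|.
Proof.
move=> dF fK; wlog xy : x y / x <= y => [h x01 y01|/andP[x0 x1] /andP[y0 y1]].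
  have [xy|/ltW yx] := leP x y; first exact: h.
  by rewrite distrC (distrC y); exact: h.
have [c /andP[c0 c1] ->] := deriv01_MVT (fun x _ => dF x) x0 xy y1.
by rewrite normrM ler_wpM2r//; apply: fK; rewrite (le_trans x0 c0) (le_trans c1 y1).
Qed.

(** A right-endpoint Riemann sum in place of e - e 0: its increments are exactly the sampled
    derivative over n, which e satisfies only approximately. *)
Definition discrete_primitive (j : nat) : R := n%:R^-1 * \sum_(i < j) e1 (node i.+1).

(** Each step errs by at most nu M / n^2, because |e1'| <= nu M, and there are at most n steps. *)
Lemma discrete_primitive_close j : (j <= n)%N ->
  `|discrete_primitive j - (e (node j) - e 0)| <= nu * M / n%:R.
Proof.
move=> jn; apply: (@le_trans _ _ (j%:R * (nu * M / n%:R / n%:R))); last first.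
  have -> : j%:R * (nu * M / n%:R / n%:R) = nu * M / n%:R * node j by ring.
  have /andP[_ j1] := node_in jn.
  by rewrite ler_piMr// divr_ge0 ?mulr_ge0.
elim: j jn => [_|j IH jn].
  by rewrite /discrete_primitive big_ord0 mulr0 mul0r subrr subr0 normr0 mul0r.
have {}IH := IH (ltnW jn); have [c [/andP[c0 c1] c01 E]] := step_MVT de jn.
have -> : discrete_primitive j.+1 - (e (node j.+1) - e 0) =
    (discrete_primitive j - (e (node j) - e 0)) + (e1 (node j.+1) - e1 c) / n%:R.
  rewrite /discrete_primitive big_ord_recr/= mulrDr mulrBl -E; ring.
have -> : j.+1%:R * (nu * M / n%:R / n%:R) = j%:R * (nu * M / n%:R / n%:R) + nu * M / n%:R / n%:R.
  by rewrite -[j.+1%:R]natr1 mulrDl mul1r.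
apply: le_trans (ler_normD _ _) _; apply: lerD => //.
rewrite normrM (ger0_norm n_inv0); apply: ler_wpM2r => //.
have K u : 0 <= u <= 1 -> `|- nu * e u| <= nu * M.
  by move=> u01; rewrite normrM normrN (ger0_norm nu0); apply: ler_wpM2l => //; have [] := eM u01.
apply: le_trans (lip_MVT de1 K c01 (node_in jn)) _.
by apply: ler_wpM2l; rewrite ?mulr_ge0// ger0_norm ?subr_ge0// -[leRHS](node_step j) lerD2l lerN2.
Qed.

(* Chosen so that the flux n * rate * gradient of [profile] through the bond {x, x + 1} is
   e1 ((x + 1) / n) + slope_shift for every x, the slow bond included. *)
Definition slope_shift : R := - (e1 0 + n%:R * xi * discrete_primitive n.-1) / (1 + xi * n.-1%:R).

Definition profile (j : nat) : R := e 0 + discrete_primitive j + slope_shift * node j.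

Local Notation theta := slope_shift.

(** Replacing the discrete primitive by e 1 - e 0 costs O(1 / n), uniformly in the rate xi because
    xi also multiplies n - 1 in the denominator. *)
Lemma slope_shift_le : `|theta| <= `|e1 0 + n%:R * xi * (e 1 - e 0)| / (1 + xi * n.-1%:R)
  + 2 * (nu + 1) * M / n%:R.
Proof.
have p1 : 0 < n.-1%:R :> R by rewrite ltr0n -subn1 subn_gt0.
have nE : n%:R = n.-1%:R + 1 :> R by rewrite natr1 prednK// ltnW.
have X0 : 0 < 1 + xi * n.-1%:R by rewrite ltr_wpDr// mulr_ge0// ltW.
rewrite /slope_shift normrM normrN normfV (gtr0_norm X0).
have d : `|discrete_primitive n.-1 - (e 1 - e 0)| <= (nu + 1) * M / n%:R.
  have h := discrete_primitive_close (leq_pred n).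
  have n1 : node n = 1 by rewrite divff.
  have h2 := lip_MVT de (fun u u01 => (eM u01).2) (node_in (leq_pred n)) (node_in (leqnn n)).
  have E := node_step n.-1; rewrite prednK ?(ltnW n2)// in E.
  rewrite E (ger0_norm n_inv0) n1 in h2.
  have -> : discrete_primitive n.-1 - (e 1 - e 0) =
    (discrete_primitive n.-1 - (e (node n.-1) - e 0)) - (e 1 - e (node n.-1)) by ring.
  apply: le_trans (ler_normB _ _) _; apply: le_trans (lerD h h2) _.
  by rewrite mulrDl mul1r mulrDl.
have -> : e1 0 + n%:R * xi * discrete_primitive n.-1 = (e1 0 + n%:R * xi * (e 1 - e 0))
  + n%:R * xi * (discrete_primitive n.-1 - (e 1 - e 0)) by ring.
apply: le_trans (ler_wpM2r _ (ler_normD _ _)) _; first by rewrite invr_ge0 ltW.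
rewrite mulrDl lerD2l ler_pdivrMr// normrM (ger0_norm (mulr_ge0 (ltW n_gt0) xi0)).
apply: le_trans (ler_wpM2l _ d) _; first by rewrite mulr_ge0// ltW.
have -> : n%:R * xi * ((nu + 1) * M / n%:R) = xi * ((nu + 1) * M) by field.
have -> : 2 * (nu + 1) * M / n%:R * (1 + xi * n.-1%:R) = (nu + 1) * M * (2 * (1 + xi * n.-1%:R) /
  n%:R) by field.
rewrite mulrC; apply: ler_wpM2l; first by rewrite mulr_ge0// addr_ge0.
rewrite ler_pdivlMr// nE.
(* The factor 2 comes from n <= 2 (n - 1), valid since n > 1. *)
have q1 : 1 <= n.-1%:R :> R by rewrite ler1n -subn1 subn_gt0.
by set p := n.-1%:R in q1 *; nra.
Qed.

Lemma profile_close j : (j <= n)%N -> `|profile j - e (node j)| <= nu * M / n%:R + `|theta|.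
Proof.
move=> jn; have -> : profile j - e (node j) = (discrete_primitive j - (e (node j) - e 0)) + theta *
  node j.
  by rewrite /profile; ring.
apply: le_trans (ler_normD _ _) _; apply: lerD; first exact: discrete_primitive_close.
have /andP[h0 h1] := node_in jn.
by rewrite normrM (ger0_norm h0) ler_piMr.
Qed.

Lemma profile_step j : profile j.+1 - profile j = (e1 (node j.+1) + theta) / n%:R.
Proof.
have -> : profile j.+1 - profile j =
   (discrete_primitive j.+1 - discrete_primitive j) + theta * (node j.+1 - node j) by rewrite
     /profile; ring.
by rewrite node_step /discrete_primitive big_ord_recr/=; ring.
Qed.

Lemma ordS_val (x : 'I_n) : val (ordS x) = if x.+1 == n then 0%N else x.+1.
Proof.
rewrite /=; case: eqP => [->|/eqP xn]; first by rewrite modnn.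
by rewrite modn_small// ltn_neqAle xn ltn_ord.
Qed.

Lemma profile_flux (x : 'I_n) : n%:R * (r x * (profile (ordS x) - profile x)) = e1 (node x.+1) +
  theta.
Proof.
rewrite rE ordS_val; case: eqP => [E|_]; last by rewrite mul1r profile_step mulrC divfK.
have xE : x = n.-1 :> nat by move: E => /(congr1 predn).
rewrite (_ : x.+1%:R = n%:R :> R) ?E// divff// xE -e1_ends.
have -> : profile 0 - profile n.-1 = - (discrete_primitive n.-1 + theta * node n.-1).
  by rewrite /profile {1}/discrete_primitive big_ord0; ring.
have p1 : 0 < n.-1%:R :> R by rewrite ltr0n -subn1 subn_gt0.
have X0 : 1 + xi * n.-1%:R != 0 by rewrite gt_eqF// ltr_wpDr// mulr_ge0// ltW.
have tE : theta * (1 + xi * n.-1%:R) = - (e1 0 + n%:R * xi * discrete_primitive n.-1).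
  by rewrite /slope_shift mulfVK.
have -> : n%:R * (xi * - (discrete_primitive n.-1 + theta * node n.-1)) =
  - (n%:R * xi * discrete_primitive n.-1) - xi * n.-1%:R * theta by field.
have -> : - (n%:R * xi * discrete_primitive n.-1) = theta * (1 + xi * n.-1%:R) + e1 0 by rewrite
  tE; ring.
by ring.
Qed.

Local Notation F := (weighted (fun x : 'I_n => profile x)).

(** Summation by parts around the ring: the constant theta drops out, and e1 at (x + 1) / n may be
    read at the successor site since e1 0 = e1 1. *)
Lemma profile_gen eta : L F eta = n%:R^-1 * \sum_(x < n) (n%:R * (e1 (node x.+1) - e1 (node x))) *
  (eta x)%:R.
Proof.
rewrite weighted_gen; under eq_bigr do rewrite profile_flux.
have sh (G : 'I_n -> R) : \sum_(x < n) G (ordS x) = \sum_(x < n) G x.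
  by rewrite [RHS](reindex_inj (@ordS_inj n)).
have e1S (x : 'I_n) : e1 (node x.+1) = e1 (node (ordS x)).
  by rewrite ordS_val; case: eqP => // ->; rewrite divff// mul0r.
rewrite mulr_sumr.
have -> : \sum_(x < n) (e1 (node x.+1) + theta) * ((eta x)%:R - (eta (ordS x))%:R) =
  \sum_(x < n) (e1 (node x.+1) + theta) * (eta x)%:R
   - \sum_(x < n) (e1 (node (ordS x)) + theta) * (eta (ordS x))%:R.
  by rewrite -sumrB; apply: eq_bigr => x _; rewrite e1S; ring.
rewrite (sh (fun x => (e1 (node x) + theta) * (eta x)%:R)) -sumrB.
by apply: eq_bigr => x _; field.
Qed.

Section bounds.
Context (k : R).
Hypotheses (thk : `|theta| <= k) (nk : n%:R^-1 <= k) (k1 : k <= 1).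
Local Notation A := (1 + M + nu * M).

Let k0 : 0 <= k. Proof. exact: le_trans (normr_ge0 _) thk. Qed.
Let nuM0 : 0 <= nu * M. Proof. exact: mulr_ge0. Qed.

Lemma profile_error j : (j <= n)%N -> `|profile j - e (node j)| <= A * k.
Proof.
move=> jn; apply: le_trans (profile_close jn) _.
have := ler_wpM2l nuM0 nk; have := mulr_ge0 M0 k0; move: thk.
by set q := nu * M / n%:R; set p := nu * M; lra.
Qed.

Lemma profile_bound j : (j <= n)%N -> `|profile j| <= A.
Proof.
move=> jn; have [h _] := eM (node_in jn).
have h2 := profile_close jn.
have -> : profile j = e (node j) + (profile j - e (node j)) by ring.
apply: le_trans (ler_normD _ _) _; apply: le_trans (lerD h h2) _.
have := ler_wpM2l nuM0 (le_trans nk k1); move: thk k1.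
by set q := nu * M / n%:R; set p := nu * M; lra.
Qed.

Lemma profile_drift eta : `|L F eta + nu * F eta| <= (1 + nu) * A * k.
Proof.
have -> : L F eta + nu * F eta = n%:R^-1 * \sum_(x < n)
    (n%:R * (e1 (node x.+1) - e1 (node x)) + nu * profile x) * (eta x)%:R.
  rewrite profile_gen /weighted mulrCA -mulrDr mulr_sumr -big_split/=; congr (_ * _).
  by apply: eq_bigr => x _; ring.
have A0 : 0 <= A by rewrite !addr_ge0.
apply: weighted_bound; first by rewrite !mulr_ge0// addr_ge0.
move=> x; have xn := ltn_ord x.
have [c [/andP[c0 c1] c01 ->]] := step_MVT de1 xn.
have -> : n%:R * (- nu * e c / n%:R) + nu * profile x =
   nu * (profile x - e (node x)) + nu * (e (node x) - e c) by field.
apply: le_trans (ler_normD _ _) _; rewrite !normrM (ger0_norm nu0).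
have h1 := ler_wpM2l nu0 (profile_error (ltnW xn)).
have h2 := lip_MVT de (fun u u01 => (eM u01).2) c01 (node_in (ltnW xn)).
have h3 : `|node x - c| <= k.
  by rewrite distrC ger0_norm ?subr_ge0//; apply: le_trans nk; rewrite -[leRHS](node_step x) lerD2r.
have h4 : nu * `|e (node x) - e c| <= nu * M * k.
  by rewrite -mulrA; apply: ler_wpM2l => //; apply: le_trans h2 _; exact: ler_wpM2l.
apply: le_trans (lerD h1 h4) _.
have -> : (1 + nu) * A * k = nu * (A * k) + A * k by ring.
by rewrite lerD2l; apply: ler_wpM2r => //; rewrite lerDr addr_ge0.
Qed.

(** One of the two gradients, together with the rate, is the bounded flux divided by n. The other
    gradient is O(1 / n) on ordinary bonds and bounded on the single slow bond, so the total is O(1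
    / n) uniformly in the slow rate. *)
Lemma profile_champ eta : L (fun eta => F eta ^+ 2) eta - 2 * F eta * L F eta <= 3 * A ^+ 2 * k.
Proof.
have A0 : 0 <= A by rewrite !addr_ge0.
apply: le_trans (weighted_champ _ _ _) _.
  by move=> x; rewrite rE; case: ifP.
have M1 (x : 'I_n) : `|e1 (node x.+1) + theta| <= A.
  apply: le_trans (ler_normD _ _) _; have [_ h] := eM (node_in (ltn_ord x)).
  by apply: le_trans (lerD h (le_trans thk k1)) _; move: nuM0; lra.
have -> : \sum_(x < n) r x * (profile (ordS x) - profile x) ^+ 2 =
  n%:R^-1 * \sum_(x < n) (e1 (node x.+1) + theta) * (profile (ordS x) - profile x).
  by rewrite mulr_sumr; apply: eq_bigr => x _; rewrite -profile_flux; field.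
have -> : 3 * A ^+ 2 * k = k * (A * A + A * (A + A)) by ring.
have S0 : 0 <= A * A + A * (A + A) by rewrite addr_ge0 ?mulr_ge0 ?addr_ge0.
apply: (@le_trans _ _ (n%:R^-1 * (A * A + A * (A + A)))); last exact: ler_wpM2r.
apply: ler_wpM2l; first by rewrite invr_ge0 ltW.
have term (x : 'I_n) : (e1 (node x.+1) + theta) * (profile (ordS x) - profile x) <=
    A * A / n%:R + (if x.+1 == n then A * (A + A) else 0).
  apply: le_trans (ler_norm _) _; rewrite normrM ordS_val; case: eqP => [_|_].
    apply: (@le_trans _ _ (A * (A + A))); last by rewrite lerDr divr_ge0// mulr_ge0.
    apply: ler_pM => //; apply: le_trans (ler_normB _ _) _.
    by apply: lerD; [exact: profile_bound|exact: (profile_bound (ltnW (ltn_ord x)))].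
  rewrite addr0 profile_step -mulrA; apply: ler_pM => //.
  by rewrite normrM (ger0_norm n_inv0); apply: ler_wpM2r.
apply: le_trans (ler_sum _ (fun x _ => term x)) _.
rewrite big_split/= sumr_const card_ord.
have -> : A * A / n%:R *+ n = A * A by rewrite -[LHS]mulr_natr divfK.
rewrite lerD2l -big_mkcond/=.
have zn : (n.-1 < n)%N by rewrite prednK// ltnW.
rewrite (big_pred1 (Ordinal zn))// => x /=.
by apply/eqP/eqP => [/(congr1 predn) E|-> /=]; [exact: val_inj|exact: prednK (ltnW n2)].
Qed.

End bounds.
End profile.
End exclusion.

(** * Two-time laws of the process and the Chebyshev bound *)

Section laws.
Context {R : realType}.

Lemma finite_law d (W : measurableType d) (P : probability W R) (I : finType) (Y : W -> I) (B :
  {pred I}) :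
  (forall i, measurable (Y @^-1` [set i])) ->
  P [set w | Y w \in B] = (\sum_(i in B) P (Y @^-1` [set i]))%E.
Proof.
move=> mY; have -> : [set w | Y w \in B] = \bigcup_(i in [set` enum B]) (Y @^-1` [set i]).
  apply/seteqP; split => w /=; first by move=> h; exists (Y w); rewrite //= mem_enum.
  by move=> [i /=]; rewrite mem_enum => iB ->.
rewrite measure_fin_bigcup//.
  by rewrite -fsbig_seq ?enum_uniq// big_enum.
by move=> i j _ _ [w [/= <- <-]].
Qed.

Lemma config_measurable n d (W : measurableType d) (P : probability W R) (X : {RV P >-> config n})
  A :
  measurable (X @^-1` A).
Proof. by have := @measurable_funPT _ _ _ _ X measurableT A I; rewrite setTI. Qed.

Lemma joint_measurable n d (W : measurableType d) (P : probability W R) (X Y : {RV P >-> config n})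
  (B : config n -> config n -> Prop) : measurable [set w | B (X w) (Y w)].
Proof.
rewrite (_ : [set w | _] = \bigcup_(z in [set: config n]) (X @^-1` [set z] `&` Y @^-1` [set y | B z
  y])).
  apply: fin_bigcup_measurable; first exact: finite_finset.
  by move=> z _; apply: measurableI; exact: config_measurable.
by apply/seteqP; split => w /=; [move=> h; exists (X w)|move=> [z _ [/= -> h]]].
Qed.

Section markov.
Context (n : nat) (L : (config n -> R) -> config n -> R) (mu : probability (config n) R).
Context (d : measure_display) (W : measurableType d) (P : probability W R) (X : R -> {RV P >->
  config n}).
Hypotheses (bL : bounded_generator L) (mX : markov_process L mu X).

Definition initial_mass (zeta : config n) : R := fine (P (X 0 @^-1` [set zeta])).

Lemma initial_mass_sum : \sum_zeta initial_mass zeta = 1.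
Proof.
have := @finite_law _ _ P _ (X 0) predT (fun i => config_measurable (X 0) [set i]).
rewrite (_ : [set w | _] = setT) ?probability_setT; last by apply/seteqP; split.
have -> : (\sum_(i in predT) P (X 0 @^-1` [set i]) = \sum_(i : config n) (initial_mass i)%:E)%E.
  by apply: eq_bigr => i _; rewrite fineK// fin_num_measure//; exact: config_measurable.
by rewrite sumEFin => -[].
Qed.

Lemma joint_law (t : R) (zeta xi : config n) : 0 <= t ->
  P ((fun w => (X 0 w, X t w)) @^-1` [set (zeta, xi)]) = (initial_mass zeta * transition L t zeta
    xi)%:E.
Proof.
move=> t0; have [_ _ _ h] := mX.
have := h [::] 0 t zeta xi (fun p pn => False_ind _ (Bool.diff_false_true pn)) (lexx _) t0.
rewrite add0r => E; rewrite EFinM fineK; last by rewrite fin_num_measure//;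
  exact: config_measurable.
rewrite (_ : _ @^-1` _ = [set w | [/\ forall p : R * config n, p \in [::] -> X p.1 w = p.2,
   X 0 w = zeta & X t w = xi]]).
  rewrite E; congr (P _ * _)%E; apply/seteqP; split => w /=; first by case.
  by move=> w0; split.
by apply/seteqP; split => w /=; [case=> -> ->; split|case=> _ -> ->].
Qed.

Lemma transition_ge0 (t : R) (zeta xi : config n) : initial_mass zeta != 0 -> 0 <= t ->
  0 <= transition L t zeta xi.
Proof.
move=> m0 t0; have m1 : 0 < initial_mass zeta.
  by rewrite lt_neqAle eq_sym m0 fine_ge0.
have : (0 <= (initial_mass zeta * transition L t zeta xi)%:E)%E by rewrite -joint_law.
by rewrite lee_fin pmulr_rge0.
Qed.

Lemma mode_chebyshev (F : config n -> R) (nu eps gam B t delta : R) : 0 <= nu -> 0 <= t -> 0 <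
  delta ->
  (forall eta, `|L F eta + nu * F eta| <= eps) -> (forall eta, `|F eta| <= B) ->
  (forall eta, L (fun eta => F eta ^+ 2) eta - 2 * F eta * L F eta <= gam) ->
  (P [set w | (delta < `|F (X t w) - expR (- (nu * t)) * F (X 0 w)|)%R] <=
    ((gam + 4 * B * eps) * t / delta ^+ 2)%:E)%E.
Proof.
move=> nu0 t0 delta0 hd hB hG; pose Z := fun w => (X 0 w, X t w).
pose dev (p : config n * config n) := F p.2 - expR (- (nu * t)) * F p.1.
have mZ p : measurable (Z @^-1` [set p]).
  rewrite (_ : _ @^-1` _ = X 0 @^-1` [set p.1] `&` X t @^-1` [set p.2]).
    by apply: measurableI; exact: config_measurable.
  by case: p => p q; apply/seteqP; split => w; [case=> E1 E2; split|case=> E1 E2; congr pair].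
rewrite (_ : [set w | _] = [set w | Z w \in [pred p | delta < `|dev p|]]); last by [].
rewrite finite_law// (eq_bigr (fun p => (initial_mass p.1 * transition L t p.1 p.2)%:E));
  last first.
  by move=> [zeta xi] _; exact: joint_law.
rewrite sumEFin lee_fin.
have jp (p : config n * config n) : 0 <= initial_mass p.1 * transition L t p.1 p.2.
  by rewrite -lee_fin -joint_law.
have d2 : 0 < delta ^+ 2 by rewrite exprn_gt0.
apply: (@le_trans _ _ (\sum_(p : config n * config n)
   initial_mass p.1 * transition L t p.1 p.2 * (dev p ^+ 2 / delta ^+ 2))).
  rewrite [leLHS]big_mkcond/=; apply: ler_sum => p _; case: ifP => [dp|_]; last first.
    by rewrite mulr_ge0// divr_ge0 ?sqr_ge0.
  rewrite ler_peMr// ler_pdivlMr// mul1r -[leRHS]real_normK ?num_real//.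
  have dp' : delta < `|dev p| := dp.
  by rewrite ler_pXn2r ?nnegrE ?(ltW delta0)//; exact: ltW.
rewrite -(pair_bigA _ (fun zeta xi => initial_mass zeta * transition L t zeta xi * (dev (zeta, xi)
  ^+ 2 / delta ^+ 2)))/=.
have -> : (gam + 4 * B * eps) * t / delta ^+ 2 =
    \sum_zeta initial_mass zeta * ((gam + 4 * B * eps) * t / delta ^+ 2).
  by rewrite -mulr_suml initial_mass_sum mul1r.
apply: ler_sum => zeta _.
(* Initial states without mass contribute nothing, and at the others the transition probabilities
   are known to be nonnegative, as [mode_variance] requires. *)
have [->|m0] := eqVneq (initial_mass zeta) 0.
  by rewrite mul0r big1// => xi _; rewrite !mul0r.
have pos s xi : 0 <= s -> 0 <= transition L s zeta xi by exact: transition_ge0.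
have := mode_variance bL pos nu0 t0 hd hB hG; rewrite (semigroup_transition bL) => h.
have -> : \sum_xi initial_mass zeta * transition L t zeta xi * (dev (zeta, xi) ^+ 2 / delta ^+ 2) =
  initial_mass zeta * ((\sum_xi (F xi - expR (- (nu * t)) * F zeta) ^+ 2 * transition L t zeta xi)
    / delta ^+ 2).
  by rewrite mulr_suml mulr_sumr; apply: eq_bigr => xi _; rewrite /dev /=; ring.
apply: ler_wpM2l; first by rewrite fine_ge0.
by apply: ler_wpM2r => //; rewrite invr_ge0 ltW.
Qed.

Lemma initial_law (B : set (config n)) : P [set w | B (X 0 w)] = mu B.
Proof. by have [_ _ <-] := mX. Qed.

End markov.
End laws.

(** * The boundary defect in the three regimes and the decay of a mode *)

Section convergence.
Context {R : realType} (alpha : R) (beta : \bar R).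
Hypothesis alpha0 : 0 < alpha.

Definition slow_rate (n : nat) : R := if beta is b%:E then alpha * n%:R `^ (- b) else 0.

Lemma slow_rate_ge0 n : 0 <= slow_rate n.
Proof. by rewrite /slow_rate; case: beta => // b; rewrite mulr_ge0// ltW. Qed.

Lemma rate_slow n (x : 'I_n) : @rate R alpha beta n x = if x.+1 == n then slow_rate n else 1.
Proof. by []. Qed.

Lemma inv_nat_cvg : (n%:R^-1 : R) @[n --> \oo] --> (0 : R).
Proof. by rewrite -(cvg_shiftS (fun n => n%:R^-1 : R)); exact: cvg_harmonic. Qed.

Lemma inv_powR_cvg (c : R) : 0 < c -> ((n%:R `^ c)^-1 : R) @[n --> \oo] --> (0 : R).
Proof.
move=> c0; apply/cvgrPdist_le => eps eps0.
have [N hN] : exists N : nat, eps^-1 `^ c^-1 <= N%:R.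
  exists (Num.truncn (eps^-1 `^ c^-1)).+1; apply: ltW; exact: truncnS_gt.
exists N.+1 => // n /= Nn; rewrite sub0r normrN ger0_norm ?invr_ge0 ?powR_ge0//.
have n0 : 0 < n%:R :> R by rewrite ltr0n (leq_ltn_trans _ Nn).
rewrite invf_ple ?posrE ?powR_gt0//.
have -> : eps^-1 = (eps^-1 `^ c^-1) `^ c.
  by rewrite -powRrM mulVf ?gt_eqF// powRr1// invr_ge0 ltW.
apply: ge0_ler_powR; rewrite ?nnegrE ?powR_ge0//; first exact: ltW.
by apply: le_trans hN _; rewrite ler_nat ltnW.
Qed.

(** The part of the bound [slope_shift_le] that depends on the regime. *)
Definition boundary_defect (e e1 : R -> R) (n : nat) : R :=
  `|e1 0 + n%:R * slow_rate n * (e 1 - e 0)| / (1 + slow_rate n * n.-1%:R).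

Lemma nat_slow_rate (b : R) n : (0 < n)%N -> n%:R * (alpha * n%:R `^ (- b)) = alpha * n%:R `^ (1 -
  b).
Proof.
move=> n0; rewrite mulrCA; congr (_ * _); rewrite powRD; last by rewrite pnatr_eq0 -lt0n n0 implybT.
by rewrite powRr1.
Qed.

(** The numerator reduces to |e1 0|, while the denominator is at least alpha n^(1 - beta) / 2 for n
    >= 2 and diverges. *)
Lemma defect_fast (e e1 : R -> R) : (0 <= beta)%E -> (beta < 1)%E -> e 1 = e 0 ->
  boundary_defect e e1 n @[n --> \oo] --> (0 : R).
Proof.
rewrite /boundary_defect /slow_rate; case: beta => // b b0; rewrite lte_fin => b1 ->.
have c0 : 0 < 1 - b by rewrite subr_gt0.
have lim : `|e1 0| * (2 / alpha) * (n%:R `^ (1 - b))^-1 @[n --> \oo] --> `|e1 0| * (2 / alpha) * 0.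
  by apply: cvgM; [exact: cvg_cst|exact: inv_powR_cvg].
rewrite mulr0 in lim; apply: (squeeze_cvgr _ (@cvg_cst _ (0 : R) _ \oo _) lim).
exists 2%N => // n /= n2; rewrite subrr mulr0 addr0.
have n0 : (0 < n)%N by apply: ltn_trans n2.
have p0 : 0 < n%:R `^ (1 - b) :> R by rewrite powR_gt0// ltr0n.
have pr : 0 <= n%:R `^ (- b) :> R by rewrite powR_ge0.
have X0 : 0 < 1 + alpha * n%:R `^ (- b) * n.-1%:R by rewrite ltr_wpDr// !mulr_ge0// ltW.
rewrite divr_ge0 ?(ltW X0)//= -[leRHS]mulrA; apply: ler_wpM2l => //.
have -> : 2 / alpha / n%:R `^ (1 - b) = (alpha / 2 * n%:R `^ (1 - b))^-1.
  by field; rewrite !gt_eqF.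
rewrite lef_pV2 ?posrE ?mulr_gt0 ?divr_gt0//.
have -> : alpha / 2 * n%:R `^ (1 - b) = (n%:R * (alpha * n%:R `^ (- b))) / 2.
  by rewrite nat_slow_rate//; ring.
have nE : n%:R = n.-1%:R + 1 :> R by rewrite natr1 prednK.
have p1 : 1 <= n.-1%:R :> R by rewrite ler1n -subn1 subn_gt0.
have q0 : 0 <= alpha * n%:R `^ (- b) by rewrite mulr_ge0// ltW.
rewrite {1}nE; move: q0 p1; set q := alpha * _; set p := n.-1%:R => q0 p1.
by rewrite ler_pdivrMr//; nra.
Qed.

(** Here n times the slow rate is exactly alpha, so the Robin condition makes the numerator vanish
    for every n >= 1. *)
Lemma defect_critical (e e1 : R -> R) : beta = 1%E -> e1 0 = alpha * (e 0 - e 1) ->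
  boundary_defect e e1 n @[n --> \oo] --> (0 : R).
Proof.
move=> b1 E; apply: cvg_near_cst; exists 1%N => // n /= n0.
rewrite /boundary_defect /slow_rate b1 nat_slow_rate// subrr powRr0 E.
by rewrite (_ : alpha * (e 0 - e 1) + _ = 0) ?normr0 ?mul0r//; ring.
Qed.

(** The denominator is at least 1 and the numerator is of order n^(1 - beta), or 0 when beta is
    infinite. *)
Lemma defect_slow (e e1 : R -> R) : (1 < beta)%E -> e1 0 = 0 ->
  boundary_defect e e1 n @[n --> \oo] --> (0 : R).
Proof.
move=> b1 E; have s0 := slow_rate_ge0; rewrite /boundary_defect /slow_rate; move: b1 s0;
  rewrite /slow_rate.
case: beta => // [b b1 s0|_ _]; last first.
  apply: cvg_near_cst; apply: nearW => n.
  by rewrite mulr0 mul0r E add0r normr0 mul0r.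
rewrite lte_fin in b1; have c0 : 0 < b - 1 by rewrite subr_gt0.
have lim : alpha * `|e 1 - e 0| * (n%:R `^ (b - 1))^-1 @[n --> \oo] --> alpha * `|e 1 - e 0| * 0.
  by apply: cvgM; [exact: cvg_cst|exact: inv_powR_cvg].
rewrite mulr0 in lim; apply: (squeeze_cvgr _ (@cvg_cst _ (0 : R) _ \oo _) lim).
exists 1%N => // n /= n0; have q0 := s0 n; rewrite E add0r nat_slow_rate//.
have X1 : 1 <= 1 + alpha * n%:R `^ (- b) * n.-1%:R by rewrite lerDl mulr_ge0.
have X0 := lt_le_trans ltr01 X1.
rewrite divr_ge0 ?(ltW X0)//= ler_pdivrMr// normrM ger0_norm; last by rewrite mulr_ge0// ltW.
have -> : n%:R `^ (1 - b) = (n%:R `^ (b - 1))^-1 :> R by rewrite -powRN opprB.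
have p0 : 0 <= (n%:R `^ (b - 1))^-1 :> R by rewrite invr_ge0 powR_ge0.
have -> : alpha * (n%:R `^ (b - 1))^-1 * `|e 1 - e 0| = alpha * `|e 1 - e 0| * (n%:R `^ (b - 1))^-1
  by ring.
by rewrite ler_peMr// !mulr_ge0// ltW.
Qed.

Section mode.
Context (e e1 : R -> R) (nu : R).
Hypotheses (de : forall u : R, is_derive u 1 e (e1 u)) (de1 : forall u : R, is_derive u 1 e1 (- nu
  * e u)).
Hypotheses (nu0 : 0 <= nu) (e1_ends : e1 0 = e1 1).
Hypothesis defect0 : boundary_defect e e1 n @[n --> \oo] --> (0 : R).
Context (d : nat -> measure_display) (W : forall n, measurableType (d n))
  (P : forall n, probability (W n) R) (eta : forall n, R -> {RV (P n) >-> config n})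
  (mu : forall n, probability (config n) R).
Hypothesis mX : forall n, markov_process (@speeded_gen R alpha beta n) (mu n) (eta n).

Lemma mode_decay (t delta : R) : 0 <= t -> 0 < delta ->
  P n [set w | delta < `|empirical e (eta n t w) - expR (- (nu * t)) * empirical e (eta n 0 w)|]
    @[n --> \oo] --> 0%E.
Proof.
move=> t0 delta0.
have ce : cont01 e by apply: continuous_cont01; exact: is_derive_cont de.
have ce1 : cont01 e1 by apply: continuous_cont01; exact: is_derive_cont de1.
have [M1 M10 hM1] := cont01_bounded ce; have [M2 M20 hM2] := cont01_bounded ce1.
pose M := M1 + M2; have M0 : 0 <= M by rewrite addr_ge0 ?ltW.
have eM (u : R) : 0 <= u <= 1 -> `|e u| <= M /\ `|e1 u| <= M.
  move=> u01; have h1 := hM1 u u01; have h2 := hM2 u u01; rewrite /M; split; lra.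
(* One small quantity above both the slope shift, by [slope_shift_le], and 1 / n; the latter
   accounts for the additional 1. *)
pose k n : R := boundary_defect e e1 n + (2 * (nu + 1) * M + 1) * n%:R^-1.
have k_cvg : k n @[n --> \oo] --> (0 : R).
  rewrite -[X in _ --> X](_ : 0 + (2 * (nu + 1) * M + 1) * 0 = 0); last by rewrite mulr0 addr0.
  by apply: cvgD => //; apply: cvgM; [exact: cvg_cst|exact: inv_nat_cvg].
pose A := 1 + M + nu * M; have A0 : 0 < A by rewrite /A -addrA ltr_wpDr// addr_ge0// mulr_ge0.
pose C := (3 * A ^+ 2 + 4 * A * ((1 + nu) * A)) * t / (delta / 2) ^+ 2.
have lim : (C * k n)%:E @[n --> \oo] --> 0%E.
  apply: cvg_EFin; first exact: nearW.
  by rewrite -[X in _ --> X](mulr0 C); apply: cvgM; [exact: cvg_cst|].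
apply: (squeeze_cvge _ (@cvg_cst _ 0%E _ \oo _) lim).
have k1 : \forall n \near \oo, k n <= 1 by exact: (cvgr_le _ k_cvg _ ltr01).
(* Exchanging the sampled mode for its profile costs at most delta / 4 at each of the two times,
   which leaves delta / 2 for Chebyshev. *)
have k2 : \forall n \near \oo, k n <= delta / (4 * A).
  by apply: (cvgr_le _ k_cvg); rewrite divr_gt0// mulr_gt0.
have n2 : \forall n \near \oo, (1 < n)%N by exists 2%N.
apply: filterS3 k1 k2 n2 => n k1 k2 n2; rewrite measure_ge0/=.
have xi0 := slow_rate_ge0 n; have rE := @rate_slow n.
have b0 : 0 <= boundary_defect e e1 n by rewrite divr_ge0// addr_ge0// mulr_ge0.
have i0 : 0 <= n%:R^-1 :> R by rewrite invr_ge0.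
have thk : `|slope_shift n e1 (slow_rate n)| <= k n.
  have := slope_shift_le de de1 nu0 M0 eM n2 xi0 => h; apply: le_trans h _.
  by rewrite /k lerD2l; apply: ler_wpM2r => //; rewrite lerDl.
have nk : n%:R^-1 <= k n.
  rewrite /k -[leLHS]add0r lerD// ler_peMl// lerDr !mulr_ge0// addr_ge0//.
have k0 : 0 <= k n := le_trans i0 nk.
pose F := weighted (fun x : 'I_n => profile n e e1 (slow_rate n) x) : config n -> R.
have FB := fun z : config n => weighted_bound z (ltW A0)
  (fun x : 'I_n => profile_bound de de1 nu0 M0 eM n2 thk nk k1 (ltnW (ltn_ord x))).
have Fd := profile_drift de de1 nu0 e1_ends M0 eM n2 xi0 rE thk nk.
have Fc := profile_champ de de1 nu0 e1_ends M0 eM n2 xi0 rE thk nk k1.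
have Fe (z : config n) : `|empirical e z - F z| <= A * k n.
  rewrite distrC; apply: weighted_diff; first by rewrite mulr_ge0// ltW.
  by move=> x; exact: (profile_error de de1 nu0 M0 eM n2 thk nk (ltnW (ltn_ord x))).
have h2 : 0 < delta / 2 by rewrite divr_gt0.
have cheb := mode_chebyshev (@speeded_gen_bounded R alpha beta n) (mX n) nu0 t0 h2 Fd FB Fc.
have KE : (3 * A ^+ 2 * k n + 4 * A * ((1 + nu) * A * k n)) * t / (delta / 2) ^+ 2 = C * k n.
  by rewrite /C; ring.
rewrite KE in cheb; apply: le_trans cheb; apply: le_measure; rewrite ?inE.
- exact: (joint_measurable (eta n t) (eta n 0)
    (fun x y => delta < `|empirical e x - expR (- (nu * t)) * empirical e y|)).
- exact: (joint_measurable (eta n t) (eta n 0) (fun x y => delta / 2 < `|F x - expR (- (nu * t)) *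
    F y|)).
move=> w /= hw; have h1 := Fe (eta n t w); have h0 := Fe (eta n 0 w).
have Ak : A * k n <= delta / 4.
  by move: k2; rewrite ler_pdivlMr ?mulr_gt0//; lra.
have q1 : expR (- (nu * t)) <= 1 by rewrite expR_le1 oppr_le0 mulr_ge0.
have h0' : `|expR (- (nu * t)) * (empirical e (eta n 0 w) - F (eta n 0 w))| <= A * k n.
  by rewrite normrM (ger0_norm (expR_ge0 _)) -[leRHS]mul1r ler_pM// expR_ge0.
have : `|empirical e (eta n t w) - expR (- (nu * t)) * empirical e (eta n 0 w)| <=
    `|F (eta n t w) - expR (- (nu * t)) * F (eta n 0 w)| + (A * k n + A * k n).
  rewrite [X in `|X| <= _](_ : _ = (F (eta n t w) - expR (- (nu * t)) * F (eta n 0 w)) +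
     ((empirical e (eta n t w) - F (eta n t w)) -
      expR (- (nu * t)) * (empirical e (eta n 0 w) - F (eta n 0 w)))); last by ring.
  apply: le_trans (ler_normD _ _) _; rewrite lerD2l.
  by apply: le_trans (ler_normB _ _) _; exact: lerD.
lra.
Qed.

End mode.
End convergence.

(** * The hydrodynamic limit *)

Section riemann.
Context {R : realType}.
Implicit Types (f g H : R -> R).
Local Notation leb := (@lebesgue_measure R).
Local Notation I01 := (`[0%R, 1%R]%classic : set R).

Lemma riemann_sum f : cont01 f ->
  n%:R^-1 * \sum_(x < n) f (x%:R / n%:R) @[n --> \oo] --> (\int[leb]_(u in I01) f u)%R.
Proof.
move=> cf; have [F [F0 dF]] := cont01_primitive cf.
rewrite (FTC01 (lexx 0) ltr01 (lexx 1) dF cf); apply/cvgrPdist_le => eps eps0.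
have [del del0 hdel] := cont01_unif cf eps0.
have small : \forall n \near \oo, n%:R^-1 < del by apply: (cvgr_lt _ inv_nat_cvg).
have n1 : \forall n \near \oo, (1 < n)%N by exists 2%N.
apply: filterS2 small n1 => n small n1.
have n0 : n%:R != 0 :> R by rewrite pnatr_eq0 -lt0n ltnW.
have i0 : 0 <= n%:R^-1 :> R by rewrite invr_ge0.
have -> : F 1 - F 0 = \sum_(x < n) (F (x.+1%:R / n%:R) - F (x%:R / n%:R)).
  rewrite -(big_mkord xpredT (fun x => F (x.+1%:R / n%:R) - F (x%:R / n%:R))).
  by rewrite (telescope_sumr (fun x => F (x%:R / n%:R)))// divff// mul0r.
rewrite mulr_sumr -sumrB; apply: le_trans (ler_norm_sum _ _ _) _.
apply: (@le_trans _ _ (\sum_(x < n) eps / n%:R)); last first.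
  by rewrite sumr_const card_ord -[leLHS]mulr_natr divfK.
apply: ler_sum => x _; have xn := ltn_ord x.
have /andP[x0 _] := @node_in R n n1 x (ltnW xn); have /andP[_ x1] := @node_in R n n1 x.+1 xn.
have st := @node_step R n x.
have le : x%:R / n%:R <= x.+1%:R / n%:R :> R by rewrite -subr_ge0 st.
have [c /andP[c0 c1] ->] := deriv01_MVT dF x0 le x1.
rewrite st mulrC -mulrBr normrM (ger0_norm i0) mulrC; apply: ler_wpM2r => //; apply: ltW.
apply: hdel; rewrite ?(le_trans x0 c0) ?(le_trans c1 x1) ?x0 ?(le_trans le x1)//.
rewrite ger0_norm ?subr_ge0//; apply: le_lt_trans small.
by rewrite -[leRHS]st lerD2r.
Qed.

Lemma empiricalD n (c : R) f g (z : config n) :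
  empirical (fun u => c * f u + g u) z = c * empirical f z + empirical g z.
Proof.
rewrite /empirical mulrCA -mulrDr; congr (_ * _); rewrite mulr_sumr -big_split/=.
by apply: eq_bigr => x _; ring.
Qed.

Lemma empirical_abs n f (z : config n) :
  `|empirical f z| <= n%:R^-1 * \sum_(x < n) `|f (x%:R / n%:R)|.
Proof.
rewrite /empirical normrM ger0_norm ?invr_ge0//; apply: ler_wpM2l; first by rewrite invr_ge0.
apply: le_trans (ler_norm_sum _ _ _) _; apply: ler_sum => x _; rewrite normrM.
by case: (z x); rewrite ?normr1 ?mulr1// normr0 mulr0.
Qed.

Section laws.
Context (law : forall n, probability (config n) R) (rho : R -> R).
Hypothesis Lrho : L2 rho.

Definition concentrates f := forall delta : R, 0 < delta ->
  law n [set z | delta < `|empirical f z - dot f rho|] @[n --> \oo] --> 0%E.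

Lemma law_squeeze (A B : forall n, set (config n)) : (\forall n \near \oo, A n `<=` B n) ->
  law n (B n) @[n --> \oo] --> 0%E -> law n (A n) @[n --> \oo] --> 0%E.
Proof.
move=> AB lim; apply: (squeeze_cvge _ (@cvg_cst _ 0%E _ \oo _) lim).
apply: filterS AB => n AB; rewrite measure_ge0/=; apply: le_measure; rewrite ?inE//.
Qed.

Lemma law_union (A B : forall n, set (config n)) : law n (A n) @[n --> \oo] --> 0%E ->
  law n (B n) @[n --> \oo] --> 0%E -> law n (A n `|` B n) @[n --> \oo] --> 0%E.
Proof.
move=> hA hB; have lim : (law n (A n) + law n (B n))%E @[n --> \oo] --> (0 + 0)%E by apply: cvgeD.
rewrite adde0 in lim; apply: (squeeze_cvge _ (@cvg_cst _ 0%E _ \oo _) lim).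
by apply: nearW => n; rewrite measure_ge0/=; apply: measureU2.
Qed.

Lemma concentratesD (c : R) f g : L2 f -> L2 g -> concentrates f -> concentrates g ->
  concentrates (fun u => c * f u + g u).
Proof.
move=> Lf Lg hf hg delta delta0; have c0 : 0 < 2 * (`|c| + 1) by rewrite mulr_gt0// ltr_wpDl.
have d1 : 0 < delta / (2 * (`|c| + 1)) by rewrite divr_gt0.
have d2 : 0 < delta / 2 by rewrite divr_gt0.
apply: law_squeeze (law_union (hf _ d1) (hg _ d2)); apply: nearW => n z /= hz.
have E : empirical (fun u => c * f u + g u) z - dot (fun u => c * f u + g u) rho =
   c * (empirical f z - dot f rho) + (empirical g z - dot g rho).
  rewrite empiricalD dotDl//; last exact: L2Z.
  by rewrite dotZl//; ring.
rewrite E in hz; have := ler_normD (c * (empirical f z - dot f rho)) (empirical g z - dot g rho).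
rewrite normrM => h; have {}h := lt_le_trans hz h.
have [h1|h1] := ltP (delta / 2) `|empirical g z - dot g rho|; first by right.
left; rewrite ltr_pdivrMr//.
have := normr_ge0 (empirical f z - dot f rho); move: h h1; set p := `|_ - dot f rho|; set q := `|c|.
by set s := `|_|; nra.
Qed.

Lemma concentrates_combo e N b : (forall k, L2 (e k)) -> (forall k, concentrates (e k)) ->
  concentrates (combo e N b).
Proof.
move=> Le he; elim: N => [|N IH].
  have -> : combo e 0 b = fun=> 0 by apply/funext => u; rewrite /combo big_ord0.
  move=> delta delta0; apply: cvg_near_cst; apply: nearW => n.
  rewrite (_ : [set z | _] = set0) ?measure0//; apply/seteqP; split => z //=.
  rewrite dot0l /empirical big1 ?mulr0 ?subrr ?normr0; last by move=> x _; rewrite mul0r.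
  by rewrite ltNge ltW.
have -> : combo e N.+1 b = fun u => b N * e N u + combo e N b u.
  by apply/funext => u; rewrite /combo big_ord_recr/= addrC.
by apply: concentratesD => //; apply: L2_sum => k; exact: L2Z.
Qed.

(** Occupations are at most 1, so the empirical mean of D = H - G is bounded, whatever the
    configuration, by a Riemann sum of |D|, which tends to an integral below the L2 norm of D. *)
Lemma concentrates_dense H : cont01 H ->
  (forall eps : R, 0 < eps -> exists G, [/\ cont01 G, concentrates G &
     dot (fun u => H u - G u) (fun u => H u - G u) < eps]) -> concentrates H.
Proof.
move=> cH dense delta delta0; have LH := cont01_L2 cH.
(* The summand 1 keeps the norm of D itself small, for the empirical side; the norm of rho serves
   the product of D with rho. *)
pose K := 1 + norm2 rho; have K0 : 0 < K by rewrite ltr_wpDr// norm2_ge0.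
have X0 : 0 < delta / (8 * K) by rewrite divr_gt0// mulr_gt0.
have [G [cG hG GH]] := dense _ (exprn_gt0 2 X0); have LG := cont01_L2 cG.
have cD := cont01B cH cG; have LD := cont01_L2 cD.
set D := fun u => H u - G u in GH cD LD.
have nD : norm2 D <= delta / (8 * K) by apply: norm2_le; exact: ltW.
have nDK : norm2 D * K <= delta / 8.
  apply: le_trans (ler_wpM2r (ltW K0) nD) _.
  by rewrite invfM mulrA divfK// gt_eqF.
have [D1 D2] : norm2 D <= delta / 8 /\ norm2 D * norm2 rho <= delta / 8.
  have := norm2_ge0 D; have := norm2_ge0 rho; move: nDK; rewrite /K.
  by set p := norm2 D; set q := norm2 rho; split; nra.
have rs := riemann_sum (cont01_abs cD).
have d4 : 0 < delta / 4 by rewrite divr_gt0.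
have int : (\int[leb]_(u in I01) `|D u|)%R < delta / 4.
  have := dot_abs_le LD (L2_cst 1).
  rewrite (eq_Rint01 (g := fun u => `|D u|)); last by move=> u _; rewrite mulr1.
  have -> : Num.sqrt (dot (fun=> 1 : R) (fun=> 1)) = 1.
    by rewrite /dot (eq_Rint01 (g := fun=> 1)) ?Rint01_cst ?sqrtr1// => u _; rewrite mulr1.
  by rewrite mulr1 -/(norm2 D) => /le_lt_trans; apply; apply: le_lt_trans D1 _; lra.
apply: law_squeeze (hG _ d4); apply: filterS (cvgr_lt _ rs _ int) => n rn z /= hz.
have E : empirical H z - dot H rho =
   (empirical G z - dot G rho) + (empirical D z - dot D rho).
  have -> : empirical D z = - 1 * empirical G z + empirical H z.
    by rewrite -empiricalD /D; congr (empirical _ z); apply/funext => u; ring.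
  by rewrite dotBl//; ring.
have h1 := empirical_abs D z.
have h2 : `|dot D rho| <= delta / 8 by apply: le_trans (dot_CS_norm LD Lrho) D2.
have h3 := ler_normD (empirical G z - dot G rho) (empirical D z - dot D rho).
have h4 := ler_normB (empirical D z) (dot D rho).
rewrite -E in h3; move: hz rn h1 h2 h3 h4; set s := n%:R^-1 * _; lra.
Qed.

End laws.

(* Only test functions continuous on the torus are granted; periodic eigenfunctions are such, and
   approximate in L2 any function continuous on [0, 1]. *)
Lemma associated_concentrates (mu : forall n, probability (config n) R) rho0 f : L2 rho0 ->
  associated mu rho0 -> cont01 f -> concentrates mu rho0 f.
Proof.
move=> L0 as0 cf; apply: concentrates_dense => // eps eps0.
have g01 : 0 < 0 + 1 :> R by rewrite add0r.
have [e [e1 [nu em]]] := @eigenmodes_exist R 0 1 (lexx 0) ler01 g01.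
have [N [b hb]] := mode_dense em cf eps0.
exists (combo e N b); split => //; first by have [] := combo_cont01 em N b.
move=> delta delta0; apply: as0 => //; split; last by have [] := combo_cont em N b.
by move=> u; apply: eq_bigr => k _; rewrite (mode_periodic em erefl).
Qed.

Lemma piecewise_measurable rho0 : torus_piecewise_continuous rho0 -> measurable_fun I01 rho0.
Proof.
move=> [_ [D hD] _]; pose E := I01 `\` [set` D].
have mI := @measurable_I01 R.
have fD (B : set R) : measurable (B `&` [set` D] : set (measurableTypeR R)).
  apply: countable_measurable => [t|]; first exact: measurable_set1.
  by apply: finite_set_countable; apply: finite_setIr; exact: finite_seq.
have mE : measurable (E : set (measurableTypeR R)).
  by apply: measurableD => //; have := fD setT; rewrite setTI.
have -> : I01 = E `|` (I01 `&` [set` D]) by rewrite setUC setUIDK.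
apply/(measurable_funU _ mE (fD I01)); split.
  apply: subspace_continuous_measurable_fun => //.
  apply/continuous_in_subspaceT => u; rewrite inE => -[u01 /negP uD].
  exact: hD.
by move=> _ Y _; rewrite -setIA (setIC [set` D]) setIA; exact: fD.
Qed.

(** * From modes to general test functions *)

Section hydrodynamics.
Context (gam a : R) (gam0 : 0 <= gam) (a0 : 0 <= a) (gama : 0 < gam + a).
Context (e e1 : nat -> R -> R) (nu : nat -> R).
Hypothesis em : eigenmodes gam a e e1 nu.
Context (alpha : R) (beta : \bar R) (alpha0 : 0 < alpha) (rho0 : R -> R).
Hypotheses (L0 : L2 rho0)
  (defect0 : forall k, boundary_defect alpha beta (e k) (e1 k) n @[n --> \oo] --> (0 : R)).
Context (mu : forall n, probability (config n) R) (as0 : associated mu rho0).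
Context (d : nat -> measure_display) (W : forall n, measurableType (d n))
  (P : forall n, probability (W n) R) (eta : forall n, R -> {RV (P n) >-> config n}).
Hypothesis mX : forall n, markov_process (@speeded_gen R alpha beta n) (mu n) (eta n).

Definition law_at (t : R) n : probability (config n) R := distribution (P n) (eta n t).

(** The deviation splits into the dynamical one, handled by [mode_decay], and the initial one
    multiplied by exp(- nu t) <= 1; each gets delta / 2. *)
Lemma mode_concentrates (t : R) k : 0 <= t -> concentrates (law_at t) (heat e nu rho0 t) (e k).
Proof.
move=> t0 delta delta0; have d2 : 0 < delta / 2 by rewrite divr_gt0.
have [ce _] := mode_cont01 em k; have [e_ends _] := mode_boundary em k.
have h1 := mode_decay alpha0 (mode_deriv em k) (mode_deriv2 em k) (mode_nu em k) e_ends (defect0 k)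
  mX t0 d2.
have h2 := associated_concentrates L0 as0 ce d2.
have lim : (P n [set w | (delta / 2 < `|empirical (e k) (eta n t w) - expR (- (nu k * t)) *
  empirical (e k) (eta n 0 w)|)%R]
   + mu n [set z | (delta / 2 < `|empirical (e k) z - dot (e k) rho0|)%R])%E @[n --> \oo] --> (0 +
       0)%E.
  by apply: cvgeD.
rewrite adde0 in lim; apply: (squeeze_cvge _ (@cvg_cst _ 0%E _ \oo _) lim).
apply: nearW => n; rewrite measure_ge0/=.
rewrite -(initial_law (mX n) (fun z => delta / 2 < `|empirical (e k) z - dot (e k) rho0|)).
have m1 := joint_measurable (eta n t) (eta n 0)
  (fun x y => delta / 2 < `|empirical (e k) x - expR (- (nu k * t)) * empirical (e k) y|).
have m2 := joint_measurable (eta n 0) (eta n 0) (fun x y => delta / 2 < `|empirical (e k) x - dot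
  (e k) rho0|).
change (P n [set w | (delta < `|empirical (e k) (eta n t w) - dot (e k) (heat e nu rho0 t)|)%R] <=
  P n [set w | (delta / 2 < `|empirical (e k) (eta n t w) - expR (- (nu k * t)) * empirical (e k)
    (eta n 0 w)|)%R]
  + P n [set w | (delta / 2 < `|empirical (e k) (eta n 0 w) - dot (e k) rho0|)%R])%E.
apply: le_trans (measureU2 _ m1 m2); apply: le_measure; rewrite ?inE.
- exact: (joint_measurable (eta n t) (eta n t) (fun x y => delta < `|empirical (e k) x - dot (e k)
    (heat e nu rho0 t)|)).
- exact: measurableU.
move=> w /= hw.
have [h|h] := ltP (delta / 2) `|empirical (e k) (eta n 0 w) - dot (e k) rho0|; first by right.
left; have q1 : expR (- (nu k * t)) <= 1 by rewrite expR_le1 oppr_le0 mulr_ge0// (mode_nu em).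
have q0 := expR_ge0 (- (nu k * t)).
have E : empirical (e k) (eta n t w) - dot (e k) (heat e nu rho0 t) =
   (empirical (e k) (eta n t w) - expR (- (nu k * t)) * empirical (e k) (eta n 0 w)) +
   expR (- (nu k * t)) * (empirical (e k) (eta n 0 w) - dot (e k) rho0).
  rewrite (dotC _ (heat _ _ _ _)) (heat_mode gam0 a0 gama em L0 _ t0) /decay_coef (dotC rho0); ring.
rewrite E in hw; have := ler_normD (empirical (e k) (eta n t w) - expR (- (nu k * t)) * empirical
  (e k) (eta n 0 w))
   (expR (- (nu k * t)) * (empirical (e k) (eta n 0 w) - dot (e k) rho0)).
rewrite [X in _ <= _ + X]normrM (ger0_norm q0) => h3.
have h4 : expR (- (nu k * t)) * `|empirical (e k) (eta n 0 w) - dot (e k) rho0| <= delta / 2.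
  by rewrite -[leRHS]mul1r; apply: ler_pM.
by have := lt_le_trans hw h3; lra.
Qed.

Lemma hydrodynamic_limit (t delta : R) H : 0 <= t -> 0 < delta -> torus_continuous H ->
  P n [set w | delta < `|empirical H (eta n t w) - dot H (heat e nu rho0 t)|] @[n --> \oo] --> 0%E.
Proof.
move=> t0 delta0 [_ cH]; have cH1 := continuous_cont01 cH.
suff h : concentrates (law_at t) (heat e nu rho0 t) H by exact: h.
apply: concentrates_dense => //; first exact: (heat_L2 gam0 a0 gama em L0).
move=> eps eps0; have [N [b hb]] := mode_dense em cH1 eps0.
exists (combo e N b); split => //; first by have [] := combo_cont01 em N b.
apply: concentrates_combo => [|k|k]; [exact: (heat_L2 gam0 a0 gama em L0)|exact: mode_L2 em k|].
exact: mode_concentrates.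
Qed.

End hydrodynamics.

Lemma heat_unique gam a (gam0 : 0 <= gam) (a0 : 0 <= a) (gama : 0 < gam + a) (e e1 : nat -> R -> R)
    (nu : nat -> R) (em : eigenmodes gam a e e1 nu) (T : R) rho0 (L0 : L2 rho0) (sol : (R -> R ->
      R) -> Prop) :
  sol (heat e nu rho0) ->
  (forall rho, sol rho -> forall t : R, t \in `[0, T] -> L2 (rho t) /\
     forall k, dot (rho t) (e k) = expR (- (nu k * t)) * dot rho0 (e k)) ->
  unique_solution T sol (heat e nu rho0).
Proof.
move=> hs hm; split=> // rho' hr t tT; have [Lr hk] := hm _ hr t tT.
apply: (modes_separate em) => //; first exact: (heat_L2 gam0 a0 gama em L0).
move: tT; rewrite in_itv/= => /andP[t0 _] k.
by rewrite hk (heat_mode gam0 a0 gama em L0).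
Qed.

End riemann.

Theorem theorem4p1 (R : realType) (alpha T : R) (beta : \bar R) (rho0 : R -> R)
    (alpha_gt0 : 0 < alpha) (T_gt0 : 0 < T) (beta_ge0 : (0 <= beta)%E)
    (rho0_pc : torus_piecewise_continuous rho0)
    (rho0_01 : forall u, 0 <= rho0 u <= 1) :
  exists2 rho : R -> R -> R,
    unique_solution T (hydrodynamic_solution alpha beta T rho0) rho &
    forall (mu : forall n, probability (config n) R), associated mu rho0 ->
    forall (d : nat -> measure_display) (W : forall n, measurableType (d n))
      (P : forall n, probability (W n) R)
      (eta : forall n, R -> {RV (P n) >-> config n}),
    (forall n, markov_process (@speeded_gen R alpha beta n) (mu n) (eta n)) ->
    forall (t : R) (delta : R) (H : R -> R),
      t \in `[0, T] -> 0 < delta -> torus_continuous H ->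
      P n [set w | delta < `|empirical H (eta n t w) - dot H (rho t)|]
        @[n --> \oo] --> 0%E.
Proof.
have L0 : L2 rho0.
  apply: (bounded_L2 (piecewise_measurable rho0_pc) (M := 1)) => u _.
  by have /andP[r0 r1] := rho0_01 u; rewrite ger0_norm.
(* A regime enters only through its boundary parameters: it has to supply a vanishing defect for
   each mode, and the fact that the heat series is the unique solution. *)
suff [gam [a [gam0 a0 gama [e [e1 [nu [em defect0 uniq]]]]]]] : exists gam a : R,
    [/\ 0 <= gam, 0 <= a, 0 < gam + a & exists e e1 nu, [/\ eigenmodes gam a e e1 nu,
      forall k, boundary_defect alpha beta (e k) (e1 k) n @[n --> \oo] --> (0 : R) &
      unique_solution T (hydrodynamic_solution alpha beta T rho0) (heat e nu rho0)]].
  exists (heat e nu rho0) => // mu as0 d W P eta mX t delta H.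
  rewrite in_itv/= => /andP[t0 _] delta0 tH.
  exact: (hydrodynamic_limit gam0 a0 gama em alpha_gt0 L0 defect0 as0 mX t0 delta0 tH).
rewrite /hydrodynamic_solution.
have [b1|b1] := ltP beta 1%E.
  have g01 : 0 < 0 + 1 :> R by rewrite add0r.
  exists 0, 1; split => //; have [e [e1 [nu em]]] := eigenmodes_exist (lexx 0) ler01 g01.
  exists e, e1, nu; split => // [k|].
    apply: defect_fast => //; have [_] := mode_boundary em k.
    by rewrite mul0r mul1r => /esym/eqP; rewrite subr_eq0 => /eqP.
  apply: (heat_unique (lexx 0) ler01 g01 em L0).
    exact: (heat_periodic_solution (lexx 0) ler01 g01 em L0 T_gt0 erefl).
  move=> rho hr t tT; have [_ Lr _] := hr.
  by split=> [|k]; [exact: Lr|exact: (periodic_mode em k erefl L0 hr tT)].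
have [b2|b2] := eqVneq beta 1%E.
  have g1a : 0 < 1 + alpha by rewrite addr_gt0.
  exists 1, alpha; split => //; first exact: ltW.
  have [e [e1 [nu em]]] := eigenmodes_exist ler01 (ltW alpha_gt0) g1a.
  exists e, e1, nu; split => // [k|].
    by apply: defect_critical => //; have [_] := mode_boundary em k; rewrite mul1r.
  apply: (heat_unique ler01 (ltW alpha_gt0) g1a em L0).
    exact: (heat_robin_solution ler01 (ltW alpha_gt0) g1a em L0 T_gt0 erefl).
  move=> rho hr t tT; have [_ Lr _] := hr.
  by split=> [|k]; [exact: Lr|exact: (robin_mode em k erefl L0 hr tT)].
have g10 : 0 < 1 + 0 :> R by rewrite addr0.
have b3 : (1 < beta)%E by rewrite lt_neqAle eq_sym b2 b1.
exists 1, 0; split => //; have [e [e1 [nu em]]] := eigenmodes_exist ler01 (lexx 0) g10.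
exists e, e1, nu; split => // [k|].
  by apply: defect_slow => //; have [_] := mode_boundary em k; rewrite mul1r mul0r.
apply: (heat_unique ler01 (lexx 0) g10 em L0).
  exact: (heat_neumann_solution ler01 (lexx 0) g10 em L0 T_gt0 erefl erefl).
move=> rho hr t tT; have [_ Lr _] := hr.
by split=> [|k]; [exact: Lr|exact: (neumann_mode em k erefl erefl L0 hr tT)].
Qed.
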